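(* Let $2\le p<\infty$, let $\mathbf m=(m_k)_{k\ge0}$ be any sequence of integers with $m_k\ge2$, and let $X$ be a complex Banach space. If $X$ satisfies the $\mathrm{LPR}_{p,=}$ property (with respect to $\mathbf m$), then $X$ is UMD and has type $2$. The same conclusion (that $X$ is UMD and has type $2$) holds if $X$ satisfies the $\mathrm{LPR}_{p,=}^{\oplus}$ property (with respect to $\mathbf m$).
   Context: $\mathbb N=\{0,1,2,\dots\}$; for integers $a<b$, $[a,b)$ is the set of integers $n$ with $a\le n<b$. Let $\mathbf m=(m_k)_{k\ge0}$ with integers $m_k\ge2$, $G_{\mathbf m}=\prod_{k\ge0}\mathbb Z_{m_k}$ with normalized Haar measure $\mu$. Put $M_0=1$, $M_{k+1}=m_kM_k$. Each $n\in\mathbb N$ has a unique expansion $n=\sum_{k\ge0}n_kM_k$ with $0\le n_k<m_k$ (finitely many nonzero digits). For $x=(x_k)_k\in G_{\mathbf m}$ let $\psi_n(x)=\prod_{k\ge0}e^{2\pi i n_kx_k/m_k}$. For $a,b\in\mathbb N$, $a\oplus b=\sum_k((a_k+b_k)\bmod m_k)M_k$, and $a\oplus D=\{a\oplus n:n\in D\}$ for $D\subset\mathbb N$. For $f\in L^p(G_{\mathbf m};X)$ (Bochner space) let $\widehat f(n)=\int_{G_{\mathbf m}}f\,\overline{\psi_n}\,d\mu$, and for finite $I\subset\mathbb N$ let $P_If=\sum_{n\in I}\widehat f(n)\psi_n$. $(\varepsilon_s)_s$ denotes an i.i.d. Rademacher ($\pm1$) sequence on an auxiliary probability space. Consider the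 inequality $$( * )\qquad \Bigl(\mathbb E_\varepsilon\Bigl\|\sum_s\varepsilon_sP_{I_s}f\Bigr\|_{L^p(G_{\mathbf m};X)}^p\Bigr)^{1/p}\le C\,\|f\|_{L^p(G_{\mathbf m};X)}.$$ $X$ has the $\mathrm{LPR}_{p,=}$ property if there is a finite constant $C=C_{p,X,\mathbf m}$ such that $( * )$ holds for every finite family $(I_s)_s$ of pairwise disjoint (usual) intervals $[a,b)\subset\mathbb N$ having equal cardinality and every $f\in L^p(G_{\mathbf m};X)$. $X$ has the $\mathrm{LPR}_{p,=}^{\oplus}$ property if there is a finite constant $C=C_{p,X,\mathbf m}$ such that $( * )$ holds for every finite pairwise disjoint family of sets of the form $I_s=\zeta_s\oplus[0,L)$ with $\zeta_s,L\in\mathbb N$, $L$ independent of $s$, and every $f\in L^p(G_{\mathbf m};X)$. Type $2$: there is $C<\infty$ with $(\mathbb E_\varepsilon\|\sum_{j=1}^n\varepsilon_jx_j\|_X^2)^{1/2}\le C(\sum_{j=1}^n\|x_j\|_X^2)^{1/2}$ for all finite families in $X$. UMD: for some (equivalently every) $1<r<\infty$ there is $C_r<\infty$ with $\|\sum_{k=1}^n\theta_kd_k\|_{L^r(\Omega;X)}\le C_r\|\sum_{k=1}^nd_k\|_{L^r(\Omega;X)}$ for every finite $X$-valued martingale difference sequence $(d_k)$ in $L^r(\Omega;X)$ on any filtered probability space and all signs $\theta_k\in\{-1,1\}$. *)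

(* Defs.v *)
From HB Require Import structures.
From mathcomp Require Import all_boot all_order all_algebra.
From mathcomp Require Import finmap complex.
From mathcomp Require Import all_classical all_reals all_analysis.

Set Implicit Arguments.
Unset Strict Implicit.
Unset Printing Implicit Defensive.

Import Order.TTheory GRing.Theory Num.Theory.
Import numFieldNormedType.Exports.

Local Open Scope classical_set_scope.
Local Open Scope ring_scope.

(* In [X : normedModType R[i]] the norm takes values in [R[i]]; it is real and
   nonnegative there, so its real part is the usual real-valued norm. *)
Definition rnorm (R : realType) (X : normedModType R[i]) (v : X) : R :=
  complex.Re `|v|.

Section Bochner.
Context {R : realType} {X : completeNormedModType R[i]}.

Definition simple_function {T : Type} (F : set_system T) (s : T -> X) : Prop :=
  finite_set (range s) /\ forall v : X, F (s @^-1` [set v]).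

Definition strongly_measurable {T : Type} (F : set_system T) (f : T -> X) :
    Prop :=
  exists s : nat -> T -> X,
    (forall n, simple_function F (s n)) /\
    forall t, s n t @[n --> \oo] --> f t.

Context {d : measure_display} {T : measurableType d} (P : probability T R).

Definition simple_integral (s : T -> X) : X :=
  \sum_(v \in range s) ((fine (P (s @^-1` [set v])))%:C)%C *: v.

Definition is_bochner_integral (f : T -> X) (v : X) : Prop :=
  strongly_measurable measurable f /\
  exists s : nat -> T -> X,
    [/\ forall n, simple_function measurable (s n),
        (\int[P]_t (rnorm (f t - s n t))%:E)%E @[n --> \oo] --> 0%E &
        simple_integral (s n) @[n --> \oo] --> v].

Definition bochner_integrable (f : T -> X) : Prop :=
  exists v, is_bochner_integral f v.

(* Equal to 0 when [f] is not Bochner integrable. *)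
Definition bochner_integral (f : T -> X) : X :=
  xget 0 [set v | is_bochner_integral f v].

Definition bochner_norm (p : R) (f : T -> X) : \bar R :=
  ('N[P]_(p%:E) [(fun t => (rnorm (f t))%:E)])%E.

Definition bochner_Lp (p : R) (f : T -> X) : Prop :=
  strongly_measurable measurable f /\ (bochner_norm p f < +oo)%E.

Definition is_cond_exp (F : set_system T) (f g : T -> X) : Prop :=
  [/\ strongly_measurable F g, bochner_integrable g &
      forall A, F A ->
        bochner_integral (fun t => (\1_A t : R[i]) *: g t) =
        bochner_integral (fun t => (\1_A t : R[i]) *: f t)].

Definition filtration (F : nat -> set_system T) : Prop :=
  forall k, [/\ sigma_algebra setT (F k), F k `<=` measurable &
                F k `<=` F k.+1].

(* The differences [df 0, ..., df n.-1] are adapted to [F 0, ..., F n.-1]; the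
   first one need not be centred. *)
Definition mart_diff_seq (r : R) (F : nat -> set_system T) (n : nat)
    (df : nat -> T -> X) : Prop :=
  (forall k, (k < n)%N -> strongly_measurable (F k) (df k) /\
                          bochner_Lp r (df k)) /\
  (forall k, (k.+1 < n)%N -> is_cond_exp (F k) (df k.+1) (fun=> 0)).

End Bochner.

(* The expectation over independent Rademacher signs [(-1) ^+ eps s], realized
   on the space of sign patterns with the uniform probability. *)
Definition rademacher_mean (R : realType) (J : finType)
    (F : {ffun J -> bool} -> \bar R) : \bar R :=
  ((2^-1 ^+ #|J|)%:E * \sum_(eps : {ffun J -> bool}) F eps)%E.

Definition type2 (R : realType) (X : completeNormedModType R[i]) : Prop :=
  exists C : R, forall (n : nat) (x : 'I_n -> X),
    (rademacher_mean (fun eps : {ffun 'I_n -> bool} =>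
        (rnorm (\sum_j (-1) ^+ eps j *: x j) ^+ 2)%:E) `^ 2^-1
     <= C%:E * (\sum_j (rnorm (x j) ^+ 2)%:E) `^ 2^-1)%E.

Definition UMD (R : realType) (X : completeNormedModType R[i]) : Prop :=
  exists r : R, 1 < r /\ exists C : R,
    forall (d : measure_display) (T : measurableType d) (P : probability T R)
      (F : nat -> set_system T) (n : nat) (df : nat -> T -> X)
      (theta : nat -> bool),
    filtration F -> mart_diff_seq P r F n df ->
    (bochner_norm P r (fun t => (\sum_(k < n) (-1) ^+ theta k *: df k t)%R)
     <= C%:E * bochner_norm P r (fun t => (\sum_(k < n) df k t)%R))%E.

Section Vilenkin.
Variable m : nat -> nat.

Definition vilenkin_prod := forall k, 'Z_(m k).

HB.instance Definition _ := Choice.on vilenkin_prod.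
HB.instance Definition _ := isPointed.Build vilenkin_prod (fun=> 0).

(* As each factor is finite, the product sigma-algebra on the countable product
   is also the Borel sigma-algebra of the compact group. *)
Definition coordinate_sets : set_system vilenkin_prod :=
  [set A | exists k (j : 'Z_(m k)), A = [set x | x k = j]].

Definition vilenkin := g_sigma_algebraType coordinate_sets.

Definition vilenkin_add (a x : vilenkin) : vilenkin := fun k => a k + x k.

Definition normalized_haar (R : realType) (mu : probability vilenkin R) : Prop :=
  forall (a : vilenkin) (A : set vilenkin), measurable A ->
    mu (vilenkin_add a @^-1` A) = mu A.

Definition vbase (k : nat) : nat := (\prod_(i < k) m i)%N.

Definition vdigit (n k : nat) : nat := ((n %/ vbase k) %% m k)%N.

(* When all [m k] are at least 2, [vbase k >= 2 ^ k > k], so that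
   [vdigit n k = 0] for [k >= n]; this makes the following ranges sufficient. *)
Definition oplus (a b : nat) : nat :=
  (\sum_(k < maxn a b) ((vdigit a k + vdigit b k) %% m k) * vbase k)%N.

Context {R : realType}.

Definition vpsi (n : nat) (x : vilenkin) : R[i] :=
  \prod_(k < n)
    let t : R := 2 * pi * (vdigit n k)%:R * (x k : nat)%:R / (m k)%:R in
    (cos t +i* sin t)%C.

Context {X : completeNormedModType R[i]} (mu : probability vilenkin R).

Definition fourier_coef (f : vilenkin -> X) (n : nat) : X :=
  bochner_integral mu (fun x => (vpsi n x)^* *: f x).

Definition fourier_proj (I : {fset nat}) (f : vilenkin -> X) (x : vilenkin) : X :=
  \sum_(n <- I) vpsi n x *: fourier_coef f n.

Definition LPR_ineq (p C : R) (J : finType) (I : J -> {fset nat})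
    (f : vilenkin -> X) : Prop :=
  (rademacher_mean (fun eps : {ffun J -> bool} =>
      bochner_norm mu p
        (fun x => (\sum_s (-1) ^+ eps s *: fourier_proj (I s) f x)%R) `^ p) `^ p^-1
   <= C%:E * bochner_norm mu p f)%E.

End Vilenkin.

Definition nat_interval (a b : nat) : {fset nat} :=
  [fset n in iota a (b - a)]%fset.

Definition oplus_shift (m : nat -> nat) (z : nat) (D : {fset nat}) : {fset nat} :=
  [fset oplus m z n | n in D]%fset.

Definition pairwise_disjoint (J : finType) (I : J -> {fset nat}) : Prop :=
  forall s t, s != t -> [disjoint I s & I t]%fset.

Definition LPR_eq (R : realType) (m : nat -> nat)
    (mu : probability (vilenkin m) R) (p : R)
    (X : completeNormedModType R[i]) : Prop :=
  exists C : R, forall (N : nat) (I : 'I_N -> {fset nat}),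
    (forall s, exists a b : nat, (a < b)%N /\ I s = nat_interval a b) ->
    (forall s t, #|` I s| = #|` I t|) ->
    pairwise_disjoint I ->
    forall f : vilenkin m -> X, bochner_Lp mu p f -> LPR_ineq mu p C I f.

Definition LPR_eq_oplus (R : realType) (m : nat -> nat)
    (mu : probability (vilenkin m) R) (p : R)
    (X : completeNormedModType R[i]) : Prop :=
  exists C : R, forall (N L : nat) (zeta : 'I_N -> nat),
    let I := fun s => oplus_shift m (zeta s) (nat_interval 0 L) in
    pairwise_disjoint I ->
    forall f : vilenkin m -> X, bochner_Lp mu p f -> LPR_ineq mu p C I f.

(* Main.v *)
Require Import Defs.
From mathcomp Require Import all_boot all_order all_algebra.
From mathcomp Require Import finmap complex.
From mathcomp Require Import all_classical all_reals all_analysis.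
From mathcomp Require Import measurable_realfun ring lra zify.

Set Implicit Arguments.
Unset Strict Implicit.
Unset Printing Implicit Defensive.

Import Order.TTheory GRing.Theory Num.Theory.
Import numFieldNormedType.Exports.
Local Open Scope classical_set_scope.
Local Open Scope ring_scope.

(** Singletons are both intervals [[n, n + 1)] and sets [zeta (+) [0, 1)], and the initial
    intervals [[0, n)] belong to both families, so the two hypotheses yield the same two
    inequalities.

    Type 2: apply the singleton inequality to [f = sum_j +-x_j 1_(B_j)], with disjoint
    [B_j] that are unions of cosets. The norm of [f] does not depend on the signs, so they
    may be averaged. The coefficient of [x_j] is a random sum [g_j] over the frequencies,
    with second moment [mu(B_j)] by Plancherel; contraction and Jensen replace it by
    [E|g_j|], and Khintchine bounds this below by [c mu(B_j)^(1/2)]. Taking [mu(B_j)]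
    proportional to [|y_j|^2] and [x_j] parallel to [y_j] with constant norm gives type 2.

    UMD: if all digits of [n] in the base [m] are [0] or [m_k - 1], the Dirichlet kernel
    of [[0, n)] is [psi_n] times the sum of the martingale difference kernels over the
    nonzero digits. Hence martingale differences on the Vilenkin group are unconditional
    in [L^p]. Blocks of consecutive coordinates simulate any finite tree whose transition
    probabilities are rational with suitable denominators, a limit removes the
    rationality, and a general martingale is approximated by one on a tree: replace [df k]
    by a simple [s k] and subtract from it its conditional expectation given [s 0, ..., s
    (k - 1)]. *)

(** * The norm of a complex normed space and real powers *)

(** Multiplying a function by [psi_n] before projecting onto [[0, n)] moves the character of the
    kernel outside, where its modulus one makes it invisible to the norm. The set of nonzero digits
    is free, so this bounds every sub-sum of martingale differences; a signed sum is twice the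
    sub-sum with positive signs minus the full sum. The first difference of a martingale need not be
    centred, hence the starting value [c] with a sign of its own in the tree inequality. The radices
    are arbitrary, so a single coordinate cannot realise a prescribed transition. A block of [N]
    coordinates has more than [N] equally likely values, which allows rounding of the probabilities;
    the rounded ones no longer centre the increments, which are therefore recentred before [N] tends
    to infinity. The constant depends neither on [N] nor on the tree, and on a finite tree the limit
    is termwise. For type 2 the sets [B_j] need only have measure at least a fixed fraction of the
    target, since a surplus is absorbed by contraction. *)

Section Rnorm.
Context {R : realType} {X : normedModType R[i]}.
Implicit Types (u v : X) (a : R[i]).

Lemma rnormE v : ((rnorm v)%:C)%C = `|v|.
Proof. by rewrite /rnorm RRe_real ?normr_real. Qed.

Lemma rnorm_ge0 v : 0 <= rnorm v.
Proof. by rewrite -ler0c rnormE normr_ge0. Qed.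

Lemma rnorm0 : rnorm (0 : X) = 0.
Proof. by rewrite /rnorm normr0. Qed.

Lemma rnormN v : rnorm (- v) = rnorm v.
Proof. by rewrite /rnorm normrN. Qed.

Lemma rnorm_eq0 v : rnorm v = 0 -> v = 0.
Proof. by move=> h; apply/normr0_eq0; rewrite -rnormE h. Qed.

Lemma ler_rnormD u v : rnorm (u + v) <= rnorm u + rnorm v.
Proof. by rewrite -lecR rmorphD /= !rnormE ler_normD. Qed.

Lemma rnormZ a v : rnorm (a *: v) = complex.Re `|a| * rnorm v.
Proof.
rewrite /rnorm normrZ -[X in X * _](RRe_real (normr_real a)).
by rewrite -[X in _ * X](RRe_real (normr_real v)) -rmorphM.
Qed.

Lemma rnormZr (r : R) v : rnorm ((r%:C)%C *: v) = `|r| * rnorm v.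
Proof. by rewrite rnormZ normc_def /= expr0n addr0 sqrtr_sqr. Qed.

Lemma rnorm_sign (b : bool) v : rnorm ((-1) ^+ b *: v) = rnorm v.
Proof. by case: b; rewrite ?expr1 ?expr0 ?scaleN1r ?scale1r ?rnormN. Qed.

Lemma ler_rnorm_sum (I : Type) (s : seq I) (P : pred I) (F : I -> X) :
  rnorm (\sum_(i <- s | P i) F i) <= \sum_(i <- s | P i) rnorm (F i).
Proof.
elim/big_rec2: _ => [|i a v _ h]; first by rewrite rnorm0.
by apply: le_trans (ler_rnormD _ _) _; rewrite lerD2l.
Qed.

Lemma ler_rnormB_dist u v : `|rnorm u - rnorm v| <= rnorm (u - v).
Proof.
rewrite ler_norml; apply/andP; split.
  by have := ler_rnormD u (v - u); rewrite addrC subrK -(rnormN (v - u)) opprB; lra.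
by have := ler_rnormD v (u - v); rewrite addrC subrK; lra.
Qed.

End Rnorm.

Section RnormCvg.
Context {R : realType} {X : normedModType R[i]}.

(** Balls of [X] have radii in [R[i]]; a positive element there is real, so its real part serves as
    the radius. *)
Lemma cvg_rnormP (s : nat -> X) (l : X) :
  (s n @[n --> \oo] --> l) <-> (rnorm (s n - l) @[n --> \oo] --> (0 : R)).
Proof.
split.
- move=> /cvgrPdist_lt h; apply/cvgrPdist_lt => e e0.
  have e0' : 0 < (e%:C)%C by rewrite -ltcR in e0.
  have [N _ hN] := h _ e0'.
  exists N => // n /hN /=.
  by rewrite sub0r normrN ger0_norm ?rnorm_ge0 // -ltcR rnormE distrC.
- move=> /cvgrPdist_lt h; apply/cvgrPdist_lt => e e0.
  have er : e = ((complex.Re e)%:C)%C by rewrite RRe_real // gtr0_real.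
  have e0' : 0 < complex.Re e by rewrite er in e0; rewrite -ltcR.
  have [N _ hN] := h _ e0'.
  exists N => // n /hN /=.
  by rewrite sub0r normrN ger0_norm ?rnorm_ge0 // er -ltcR rnormE distrC.
Qed.

Lemma cvg_rnorm (s : nat -> X) (l : X) :
  s n @[n --> \oo] --> l -> rnorm (s n) @[n --> \oo] --> rnorm l.
Proof.
move=> /cvg_rnormP /cvgrPdistC_lt h; apply/cvgrPdistC_lt => e e0.
move: (h e e0); apply: filterS => n.
rewrite subr0 ger0_norm ?rnorm_ge0 //; exact/le_lt_trans/ler_rnormB_dist.
Qed.

End RnormCvg.

(** * Convexity and continuity of real powers *)

Section PowR.
Context {R : realType}.
Implicit Types (a b c s t p : R).

(* Young's inequality, read as: the graph of [t ^ p] lies above its tangent at [s]. *)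
Lemma powR_tangent p s t : 1 <= p -> 0 <= s -> 0 <= t ->
  p * (s `^ (p - 1) * t) - (p - 1) * s `^ p <= t `^ p.
Proof.
move=> p1 s0 t0; have p0 : 0 < p by lra.
(* The conjugate exponent [p / (p - 1)] exists only for [p > 1]; at [p = 1] the claim reads
   [t <= t]. *)
have [->|p1'] := eqVneq p 1.
  rewrite subrr powRr0 powRr1 // powRr1 //; lra.
have pp : 0 < p - 1 by rewrite subr_gt0 lt_neqAle eq_sym p1'.
have q0 : 0 < p / (p - 1) by apply: divr_gt0.
have := @conjugate_powR R t (s `^ (p - 1)) p (p / (p - 1)) t0 (powR_ge0 _ _) p0 q0.
have -> : p^-1 + (p / (p - 1))^-1 = 1 by field; lra.
move=> /(_ erefl); rewrite -powRrM mulrC [_ * (p / _)]mulrC divfK ?gt_eqF // => h.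
have : p * (s `^ (p - 1) * t) <= p * (t `^ p / p + s `^ p / (p / (p - 1))).
  by rewrite ler_pM2l.
have -> : p * (t `^ p / p + s `^ p / (p / (p - 1))) = t `^ p + (p - 1) * s `^ p.
  by field; lra.
lra.
Qed.

Lemma powRSB1 p s : 1 <= p -> 0 <= s -> s `^ (p - 1) * s = s `^ p.
Proof. by move=> p1 s0; rewrite mulrC mulr_powRB1 //; lra. Qed.

(** Averaging the tangent inequality at the mean [s] leaves [p s ^ p - (p - 1) s ^ p = s ^ p]. *)
Lemma jensen_powR (I : finType) (w t : I -> R) p : 1 <= p ->
  (forall i, 0 <= w i) -> \sum_i w i = 1 -> (forall i, 0 <= t i) ->
  (\sum_i w i * t i) `^ p <= \sum_i w i * t i `^ p.
Proof.
move=> p1 w0 w1 t0; set s := \sum_i w i * t i.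
have s0 : 0 <= s by apply: sumr_ge0 => i _; apply: mulr_ge0.
have h : \sum_i w i * (p * (s `^ (p - 1) * t i) - (p - 1) * s `^ p)
   <= \sum_i w i * t i `^ p.
  by apply: ler_sum => i _; apply: ler_wpM2l => //; apply: powR_tangent.
apply: le_trans h.
under eq_bigr do rewrite mulrBr.
rewrite sumrB -mulr_suml w1.
have -> : \sum_i w i * (p * (s `^ (p - 1) * t i)) = p * s `^ (p - 1) * s.
  by rewrite mulr_sumr; apply: eq_bigr => i _; ring.
by rewrite -mulrA powRSB1 //; lra.
Qed.

(** Each term is at most the largest one, whose power is among the summands on the right. The power
    of the cardinality is not optimal, which only affects constants. *)
Lemma ler_powR_sum (I : finType) (t : I -> R) p : 1 <= p -> (forall i, 0 <= t i) ->
  (\sum_i t i) `^ p <= #|I|%:R `^ p * \sum_i t i `^ p.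
Proof.
move=> p1 t0.
have p0 : 0 <= p by lra.
have [i0 _|I0] := pickP (fun _ : I => true); last first.
  rewrite big1 => [|i _]; last by have := I0 i.
  by rewrite powR0 ?mulr_ge0 ?powR_ge0 ?sumr_ge0 // => [i _|]; [exact: powR_ge0|lra].
have [j _ hj] := @Order.TotalTheory.arg_maxP _ R I i0 xpredT t isT.
apply: (@le_trans _ _ ((#|I|%:R * t j) `^ p)).
  apply: ge0_ler_powR; rewrite ?nnegrE ?sumr_ge0 ?mulr_ge0 //.
  rewrite mulr_natl -sumr_const; apply: ler_sum => i _; exact: hj.
rewrite powRM // ler_wpM2l ?powR_ge0 //.
by rewrite (bigD1 j) //= lerDl sumr_ge0 // => i _; exact: powR_ge0.
Qed.

Lemma ler_powRD a b p : 1 <= p -> 0 <= a -> 0 <= b ->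
  (a + b) `^ p <= 2 `^ p * (a `^ p + b `^ p).
Proof.
move=> p1 a0 b0.
have := @ler_powR_sum bool (fun x => if x then a else b) p p1.
by rewrite card_bool !big_bool; apply; case.
Qed.

Lemma cvg_powR (u : nat -> R) (l p : R) : 0 < p -> (forall n, 0 <= u n) ->
  u n @[n --> \oo] --> l -> u n `^ p @[n --> \oo] --> l `^ p.
Proof.
move=> p0 u0 ul.
have l0 : 0 <= l by apply: (cvgr_to_ge ul); apply: nearW.
(* [powR] is the exponential of a logarithm only at positive arguments, so a zero limit is treated
   separately, with the threshold [e ^ (1 / p)]. *)
move: l0; rewrite le_eqVlt => /predU1P[l0|l0].
  rewrite -l0 powR0 ?gt_eqF //; apply/cvgr0Pnorm_lt => e e0.
  have e1 : 0 < e `^ p^-1 by apply: powR_gt0.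
  move: ul; rewrite -l0 => /cvgr0Pnorm_lt /(_ _ e1).
  apply: filterS => n; rewrite !ger0_norm ?powR_ge0 // => h.
  have -> : e = (e `^ p^-1) `^ p by rewrite -powRrM mulVf ?gt_eqF // powRr1 // ltW.
  by apply: gt0_ltr_powR; rewrite ?nnegrE ?powR_ge0.
have -> : l `^ p = expR (p * ln l) by rewrite /powR gt_eqF.
apply: (@cvg_trans _ ((expR (p * ln (u n))) @[n --> \oo])).
  apply: near_eq_cvg; near=> n.
  rewrite /powR gt_eqF //; near: n; exact: (cvgr_gt l).
have h : p * ln (u n) @[n --> \oo] --> p * ln l.
  apply: cvgM; first exact: cvg_cst.
  exact: (cvg_comp _ _ ul (continuous_ln l0)).
exact: (cvg_comp _ _ h (@continuous_expR R (p * ln l))).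
Unshelve. all: by end_near.
Qed.

End PowR.

(** * Simple functions and the Bochner integral *)

Section FiniteValued.
Context {d : measure_display} {T : measurableType d} {J : finType}.
Implicit Types c : T -> J.

Lemma preimage_finE c (U : Type) (g : J -> U) (Y : set U) :
  (g \o c) @^-1` Y = \bigcup_(j in [set j | Y (g j)]) c @^-1` [set j].
Proof.
apply/seteqP; split=> [t Yt|t [j /= Yj ct]]; last by rewrite /= ct.
by exists (c t).
Qed.

Lemma measurable_preimage_fin c (U : Type) (g : J -> U) (Y : set U) :
  (forall j, measurable (c @^-1` [set j])) -> measurable ((g \o c) @^-1` Y).
Proof.
by move=> mc; rewrite preimage_finE; apply: fin_bigcup_measurable => //; exact: finite_finset.
Qed.

Lemma measurable_fun_fin c d' (U : measurableType d') (g : J -> U) :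
  (forall j, measurable (c @^-1` [set j])) -> measurable_fun setT (g \o c).
Proof. by move=> mc _ Y _; rewrite setTI; exact: measurable_preimage_fin. Qed.

Lemma trivIset_fiber c (D : set J) : trivIset D (fun j => c @^-1` [set j]).
Proof. by move=> i j _ _ [t [/= <- <-]]. Qed.

Lemma setT_fiber c : [set: T] = \big[setU/set0]_(j <- index_enum J) c @^-1` [set j].
Proof.
apply/seteqP; split=> // t _; rewrite -bigcup_seq.
by exists (c t) => //=; rewrite mem_index_enum.
Qed.

Lemma ge0_integral_fiber (R : realType) (mu : {measure set T -> \bar R}) c (f : T -> \bar R) :
  (forall j, measurable (c @^-1` [set j])) -> measurable_fun setT f -> (forall t, (0 <= f t)%E) ->
  (\int[mu]_t f t = \sum_(j : J) \int[mu]_(t in c @^-1` [set j]) f t)%E.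
Proof.
move=> mc mf f0; rewrite [in LHS](setT_fiber c) ge0_integral_bigsetU //=.
- exact: index_enum_uniq.
- exact: trivIset_fiber.
- by rewrite -setT_fiber.
Qed.

Lemma ge0_integral_fin (R : realType) (mu : {measure set T -> \bar R}) c (g : J -> R) :
  (forall j, measurable (c @^-1` [set j])) -> (forall j, 0 <= g j) ->
  (\int[mu]_t (g (c t))%:E = \sum_(j : J) (g j)%:E * mu (c @^-1` [set j]))%E.
Proof.
move=> mc g0; rewrite (ge0_integral_fiber mu mc); last 2 first.
- by apply/measurable_EFinP; exact: measurable_fun_fin.
- by move=> t; rewrite lee_fin.
apply: eq_bigr => j _; rewrite -integral_cst //.
by apply: eq_integral => t; rewrite inE /= => ->.
Qed.

End FiniteValued.

Section SubSigma.
Context {T : pointedType} (F : set_system T).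

(** A filtration consists of bare set systems; this turns each of them into the measurable sets of a
    type, so that measurability arguments apply relative to [F]. *)
Lemma sub_sigmaE : sigma_algebra setT F ->
  (measurable : set_system (g_sigma_algebraType F)) = F.
Proof. by move=> sF; rewrite /measurable /= sigma_algebra_id. Qed.

Lemma sigma_fin_preimage (J : finType) (c : T -> J) (U : Type) (g : J -> U) (Y : set U) :
  sigma_algebra setT F ->
  (forall j, F (c @^-1` [set j])) -> F ((g \o c) @^-1` Y).
Proof.
move=> sF; rewrite -(sub_sigmaE sF) => mc.
exact: (@measurable_preimage_fin _ (g_sigma_algebraType F)).
Qed.

End SubSigma.

Section SimpleFunctions.
Context {R : realType} {X : completeNormedModType R[i]}.
Context {T : pointedType}.
Implicit Types (F : set_system T).

Lemma simple_fin F (J : finType) (c : T -> J) (v : J -> X) :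
  sigma_algebra setT F -> (forall j, F (c @^-1` [set j])) -> simple_function F (v \o c).
Proof.
move=> sF mc; split; last by move=> x; exact: sigma_fin_preimage.
apply: (@sub_finite_set _ _ (v @` [set: J])).
  by move=> x [t _ <-]; exists (c t).
by apply: finite_image; exact: finite_finset.
Qed.

Lemma simple_function_le F G (s : T -> X) : F `<=` G -> simple_function F s -> simple_function G
  s.
Proof. by move=> FG [fs ms]; split=> // v; exact/FG/ms. Qed.

(** The list becomes the alphabet of a tree common to all times; the value [0] supplies a default
    letter. *)
Lemma simple_common (F : nat -> set_system T) (s : nat -> T -> X) (n : nat) :
  (forall k, (k < n)%N -> simple_function (F k) (s k)) ->
  exists l : seq X, 0 \in l /\
    forall k, (k < n)%N -> forall t, s k t \in l.
Proof.
elim: n => [_|n IH h]; first by exists [:: 0]; rewrite mem_seq1.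
have [k kn|l [l0 hl]] := IH; first by apply: h; exact: ltnW.
have [/finite_seqP[l' hl'] _] := h n (ltnSn n).
exists (l ++ l'); rewrite mem_cat l0; split=> // k.
rewrite ltnS leq_eqVlt => /predU1P[->|kn] t; rewrite mem_cat; last by rewrite hl.
have : range (s n) (s n t) by exists t.
by rewrite hl' => /= ->; rewrite orbT.
Qed.

(** Factoring through a finite type of labels makes every integral a finite sum over labels. *)
Lemma simple_fun_factor F (s : T -> X) : sigma_algebra setT F -> simple_function F s ->
  exists (J : finType) (c : T -> J) (v : J -> X),
    s = v \o c /\ forall j, F (c @^-1` [set j]).
Proof.
move=> sF sms.
have [l [_ hl]] := @simple_common (fun _ => F) (fun _ => s) 1 (fun _ _ => sms).
exists (seq_sub l), (fun t => SeqSub (hl 0%N isT t)), (@ssval _ l); split=> // j.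
have -> : (fun t => SeqSub (hl 0%N isT t)) @^-1` [set j] = s @^-1` [set ssval j].
  apply/seteqP; split=> t /=; first by move=> <-.
  by move=> h; apply: val_inj.
by case: sms.
Qed.

End SimpleFunctions.

(** * The Bochner integral *)

Section BochnerIntegral.
Context {R : realType} {X : completeNormedModType R[i]}.
Context {d : measure_display} {T : measurableType d} (P : probability T R).

(** Several labels may carry the same vector: the measure of the fibre of [x] splits over the labels
    [j] with [v j = x], and values that are not attained contribute zero. *)
Lemma simple_integral_fin (J : finType) (c : T -> J) (v : J -> X) :
  (forall j, measurable (c @^-1` [set j])) ->
  simple_integral P (v \o c) =
  \sum_(j : J) ((fine (P (c @^-1` [set j])))%:C)%C *: v j.
Proof.
move=> mc; rewrite /simple_integral.
pose l := undup (map v (enum J)).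
rewrite (fsbig_fwiden l) /=; last first.
- move=> x [_ /= nx].
  suff -> : (v \o c) @^-1` [set x] = set0 by rewrite measure0 /= scale0r.
  by apply/seteqP; split=> // t /= h; apply: nx; exists t.
- exact: undup_uniq.
- by move=> x [t _ <-] /=; rewrite mem_undup map_f // mem_enum.
have h x : fine (P ((v \o c) @^-1` [set x])) =
    \sum_(j : J) ((v j == x)%:R * fine (P (c @^-1` [set j]))).
  have mA : measurable ((v \o c) @^-1` [set x]) by exact: measurable_preimage_fin.
  apply: EFin_inj; rewrite fineK; last exact: fin_num_measure.
  rewrite -[X in P X]setIT -integral_indic //.
  rewrite (_ : (\int[P]_t _)%E = (\int[P]_t ((fun j => (v j == x)%:R) (c t))%:E)%E); last first.
    apply: eq_integral => t _ /=; rewrite indicE; congr ((nat_of_bool _)%:R%:E).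
    by apply/idP/eqP; rewrite inE.
  rewrite (ge0_integral_fin P (g := fun j => (v j == x)%:R)) // -sumEFin; apply: eq_bigr => j _.
  by rewrite EFinM fineK //; exact: fin_num_measure.
under eq_bigr => x _ do rewrite h rmorph_sum scaler_suml.
rewrite exchange_big /=; apply: eq_bigr => j _.
rewrite (bigD1_seq (v j)) /=; last exact: undup_uniq; last first.
  by rewrite mem_undup map_f // mem_enum.
rewrite eqxx mul1r big1 ?addr0 // => x xj.
by rewrite eq_sym (negbTE xj) mul0r scale0r.
Qed.

End BochnerIntegral.

Section Bochner2.
Context {R : realType} {X : completeNormedModType R[i]}.
Context {d : measure_display} {T : measurableType d} (P : probability T R).
Implicit Types (f g s : T -> X).

Let sigT : sigma_algebra setT (@measurable d T) := @sigma_algebra_measurable d T.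

Lemma simple_rnorm_measurable F s : sigma_algebra setT F -> simple_function F s ->
  @measurable_fun _ _ (g_sigma_algebraType F) R setT (fun t => rnorm (s t)).
Proof.
move=> sF /(simple_fun_factor sF)[J [c [v [-> mc]]]].
by apply: (@measurable_fun_fin _ (g_sigma_algebraType F) J c _ _ (fun j => rnorm (v j))) => j;
  rewrite sub_sigmaE.
Qed.

Lemma strongly_measurable_rnorm F f : sigma_algebra setT F -> strongly_measurable F f ->
  @measurable_fun _ _ (g_sigma_algebraType F) R setT (fun t => rnorm (f t)).
Proof.
move=> sF [s [ss sf]].
apply: (@measurable_fun_cvg _ (g_sigma_algebraType F) R setT (fun n t => rnorm (s n t))).
  by move=> n; exact: simple_rnorm_measurable.
by move=> t _; apply: cvg_rnorm.
Qed.

Lemma measurable_sub_sigma F (f : T -> R) : sigma_algebra setT F -> F `<=` measurable ->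
  @measurable_fun _ _ (g_sigma_algebraType F) R setT f -> measurable_fun setT f.
Proof.
move=> sF Fm mf _ Y mY; apply: Fm.
rewrite -(sub_sigmaE sF); exact: (mf measurableT Y mY).
Qed.

Lemma measurable_rnorm f : strongly_measurable measurable f ->
  measurable_fun setT (fun t => rnorm (f t)).
Proof.
by move=> sf; apply: measurable_sub_sigma (strongly_measurable_rnorm sigT sf).
Qed.

Lemma simple_strongly_measurable F s : simple_function F s -> strongly_measurable F s.
Proof. by move=> ss; exists (fun _ => s); split=> // t; exact: cvg_cst. Qed.

Lemma strongly_measurable_le F G f : F `<=` G -> strongly_measurable F f -> strongly_measurable
  G f.
Proof. by move=> FG [s [ss sf]]; exists s; split=> // n; exact: simple_function_le (ss n). Qed.

Lemma simple_map2 F (h : X -> X -> X) s1 s2 : sigma_algebra setT F ->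
  simple_function F s1 -> simple_function F s2 -> simple_function F (fun t => h (s1 t) (s2 t)).
Proof.
move=> sF /(simple_fun_factor sF)[J1 [c1 [v1 [-> m1]]]].
move=> /(simple_fun_factor sF)[J2 [c2 [v2 [-> m2]]]].
apply: (@simple_fin _ _ _ _ (J1 * J2)%type (fun t => (c1 t, c2 t)) (fun j => h (v1 j.1) (v2
  j.2))) => //.
case=> j1 j2.
have -> : (fun t => (c1 t, c2 t)) @^-1` [set (j1, j2)] = c1 @^-1` [set j1] `&` c2 @^-1` [set j2].
  by apply/seteqP; split=> [t [h1 h2]|t [h1 h2]]; [split|congr (_, _)].
move: (m1 j1) (m2 j2); rewrite -(sub_sigmaE sF); exact: measurableI.
Qed.

Lemma strongly_measurable_lin F (a b : R[i]) f g : sigma_algebra setT F ->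
  strongly_measurable F f -> strongly_measurable F g ->
  strongly_measurable F (fun t => a *: f t + b *: g t).
Proof.
move=> sF [s [ss sf]] [r [sr rg]].
exists (fun n t => a *: s n t + b *: r n t); split=> [n|t].
  exact: (@simple_map2 _ (fun x y => a *: x + b *: y)).
by apply: cvgD; apply: cvgZ => //; exact: cvg_cst.
Qed.

Lemma strongly_measurableB F f g : sigma_algebra setT F ->
  strongly_measurable F f -> strongly_measurable F g ->
  strongly_measurable F (fun t => f t - g t).
Proof.
move=> sF sf sg; rewrite (_ : (fun t => _) = (fun t => 1 *: f t + (-1) *: g t)).
  exact: strongly_measurable_lin.
by apply/funext => t; rewrite scale1r scaleN1r.
Qed.

Lemma strongly_measurable_sum F (I : Type) (r : seq I) (Q : pred I) (a : I -> R[i]) (f : I -> T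
  -> X) :
  sigma_algebra setT F -> (forall i, Q i -> strongly_measurable F (f i)) ->
  strongly_measurable F (fun t => \sum_(i <- r | Q i) a i *: f i t).
Proof.
move=> sF sf; elim: r => [|i r IH].
  rewrite (_ : (fun t => _) = (fun=> 0)); last by apply/funext => t; rewrite big_nil.
  apply: simple_strongly_measurable; apply: (@simple_fin _ _ _ _ unit (fun _ => tt) (fun _ =>
    0)) => // j.
  rewrite (_ : _ @^-1` _ = setT); last by apply/seteqP; split=> // t _; case: j.
  by rewrite -(sub_sigmaE sF); exact: measurableT.
rewrite (_ : (fun t => _) = (fun t => (Q i)%:R *: (a i *: f i t) + 1 *: \sum_(j <- r | Q j) a j
  *: f j t)); last first.
  by apply/funext => t; rewrite big_cons scale1r; case: ifP => _;
    rewrite ?scale1r // scale0r add0r.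
case Qi : (Q i); last first.
  rewrite (_ : (fun t => _) = (fun t => \sum_(j <- r | Q j) a j *: f j t)) //.
  by apply/funext => t; rewrite scale0r scale1r add0r.
rewrite (_ : (fun t => _) = (fun t => a i *: f i t + 1 *: \sum_(j <- r | Q j) a j *: f j t)).
  by apply: strongly_measurable_lin => //; exact: sf.
by apply/funext => t; rewrite (scale1r (a i *: f i t)).
Qed.

Lemma ler_rnorm_simple_integral s : simple_function measurable s ->
  ((rnorm (simple_integral P s))%:E <= \int[P]_t (rnorm (s t))%:E)%E.
Proof.
move=> /(simple_fun_factor sigT)[J [c [v [-> mc]]]].
rewrite simple_integral_fin // (ge0_integral_fin P (g := fun j => rnorm (v j))) //; last first.
  by move=> j; exact: rnorm_ge0.
under [leRHS]eq_bigr => j _ do rewrite -[X in (_ * X)%E]fineK ?fin_num_measure // -EFinM.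
rewrite sumEFin lee_fin; apply: le_trans (ler_rnorm_sum _ _ _) _.
apply: ler_sum => j _; rewrite rnormZr ger0_norm ?fine_ge0 //.
by rewrite mulrC.
Qed.

Lemma simple_integralB s1 s2 : simple_function measurable s1 -> simple_function measurable s2 ->
  simple_integral P (fun t => s1 t - s2 t) = simple_integral P s1 - simple_integral P s2.
Proof.
move=> /(simple_fun_factor sigT)[J1 [c1 [v1 [-> m1]]]].
move=> /(simple_fun_factor sigT)[J2 [c2 [v2 [-> m2]]]].
pose c t := (c1 t, c2 t).
have mc j : measurable (c @^-1` [set j]).
  case: j => j1 j2.
  have -> : c @^-1` [set (j1, j2)] = c1 @^-1` [set j1] `&` c2 @^-1` [set j2].
    by apply/seteqP; split=> [t [h1 h2]|t [h1 h2]]; [split|congr (_, _)].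
  exact: measurableI.
have E := fun h : (J1 * J2)%type -> X => simple_integral_fin P h mc.
rewrite (E (fun j => v1 j.1 - v2 j.2)) (E (fun j => v1 j.1)) (E (fun j => v2 j.2)).
by rewrite -sumrB; apply: eq_bigr => j _; rewrite scalerBr.
Qed.

End Bochner2.

Section Bochner3.
Context {R : realType} {X : completeNormedModType R[i]}.
Context {d : measure_display} {T : measurableType d} (P : probability T R).
Implicit Types (f g s : T -> X).

Let sigT : sigma_algebra setT (@measurable d T) := @sigma_algebra_measurable d T.

Lemma measurable_rnorm_powR f p : strongly_measurable measurable f ->
  measurable_fun setT (fun t => (rnorm (f t) `^ p)%:E).
Proof.
move=> sf; apply/measurable_EFinP.
exact: (measurableT_comp (measurable_powR p) (measurable_rnorm sf)).
Qed.

Lemma rnorm_powR_ge0 f p t : (0 <= (rnorm (f t) `^ p)%:E :> \bar R)%E.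
Proof. by rewrite lee_fin powR_ge0. Qed.

(* Dominated by [f] and still measurable for the same sigma-algebra as [f] and [s]. *)
Definition trunc_by f s : T -> X :=
  fun t => if rnorm (s t) <= 2 * rnorm (f t) then s t else 0.

Lemma simple_trunc_by F f s : sigma_algebra setT F -> strongly_measurable F f ->
  simple_function F s -> simple_function F (trunc_by f s).
Proof.
move=> sF sf ss; split.
  case: ss => fs _; apply: (@sub_finite_set _ _ (range s `|` [set 0])).
    by move=> x [t _ <-]; rewrite /trunc_by; case: ifP => _; [left; exists t|right].
  by rewrite finite_setU; split=> //; exact: finite_set1.
move=> v.
have mA : F [set t | rnorm (s t) <= 2 * rnorm (f t)].
  rewrite -(sub_sigmaE sF).
  have h : @measurable_fun _ _ (g_sigma_algebraType F) bool setT
      (fun t => rnorm (s t) <= 2 * rnorm (f t)).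
    apply: measurable_fun_ler; first exact: simple_rnorm_measurable.
    by apply: measurable_funM; [exact: measurable_cst|exact: strongly_measurable_rnorm].
  have := h measurableT [set true] I; rewrite setTI.
  by congr (measurable _); apply/seteqP; split.
have mS : F (s @^-1` [set v]) by case: ss.
have -> : trunc_by f s @^-1` [set v] =
   ([set t | rnorm (s t) <= 2 * rnorm (f t)] `&` s @^-1` [set v]) `|`
   (if v == 0 then ~` [set t | rnorm (s t) <= 2 * rnorm (f t)] else set0).
  apply/seteqP; split=> t; rewrite /trunc_by /=.
    case: ifP => h; first by left.
    by move=> <-; rewrite eqxx; right => /=; rewrite h.
  case=> [[-> //]|]; case: eqP => //= -> /negP h; by rewrite ifN.
move: mA mS; rewrite -(sub_sigmaE sF) => mA mS.
apply: measurableU; first exact: measurableI.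
by case: ifP => _ //; exact: measurableC.
Qed.

(** Where [f t] is nonzero, [|s n t|] is eventually below [2 |f t|] and nothing is cut; where
    [f t = 0], the truncation is identically zero. *)
Lemma cvg_trunc_by f (s : nat -> T -> X) t : s n t @[n --> \oo] --> f t ->
  trunc_by f (s n) t @[n --> \oo] --> f t.
Proof.
move=> sf; have [f0|f0] := eqVneq (rnorm (f t)) 0.
  apply/cvg_rnormP; rewrite (_ : (fun n => _) = fun=> 0); first exact: cvg_cst.
  apply/funext => n; rewrite /trunc_by f0 mulr0 (rnorm_eq0 f0) subr0.
  case: ifP => [h|_]; last exact: rnorm0.
  by apply/eqP; rewrite eq_le h rnorm_ge0.
apply: (cvg_trans _ sf); apply: near_eq_cvg.
have h : rnorm (s n t) @[n --> \oo] --> rnorm (f t) by exact: cvg_rnorm.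
have lt2 : rnorm (f t) < 2 * rnorm (f t).
  have f1 : 0 < rnorm (f t) by rewrite lt_neqAle eq_sym f0 rnorm_ge0.
  lra.
near=> n; rewrite /trunc_by ifT //; near: n.
by apply: filterS (cvgr_lt _ h _ lt2) => n /ltW.
Unshelve. all: by end_near.
Qed.

Lemma rnorm_sub_trunc_by f s t : rnorm (f t - trunc_by f s t) <= 3 * rnorm (f t).
Proof.
rewrite /trunc_by; have := rnorm_ge0 (f t); case: ifP => [h f0|_ f0]; last by rewrite subr0; lra.
by apply: le_trans (ler_rnormD _ _) _; rewrite rnormN; lra.
Qed.

(** The truncated approximants are dominated by [(3 |f|) ^ p], so dominated convergence applies.
    They stay measurable for [F] itself, which an adapted approximation of a martingale requires. *)
Lemma simple_approx F f p : sigma_algebra setT F -> F `<=` measurable ->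
  strongly_measurable F f -> 1 <= p -> (\int[P]_t (rnorm (f t) `^ p)%:E < +oo)%E ->
  exists s : nat -> T -> X, (forall n, simple_function F (s n)) /\
    (\int[P]_t (rnorm (f t - s n t) `^ p)%:E)%E @[n --> \oo] --> 0%E.
Proof.
move=> sF Fm sf p1 fp; have [s [ss cs]] := sf.
have p0 : 0 < p by lra.
exists (fun n => trunc_by f (s n)); split=> [n|]; first exact: simple_trunc_by.
have sfm : strongly_measurable measurable f by exact: strongly_measurable_le sf.
have msub n : measurable_fun setT (fun t => (rnorm (f t - trunc_by f (s n) t) `^ p)%:E).
  apply: measurable_rnorm_powR; apply: strongly_measurableB => //.
  by apply/simple_strongly_measurable/(simple_function_le Fm)/simple_trunc_by.
have := @dominated_convergence _ _ _ P setT measurableT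
  (fun n t => (rnorm (f t - trunc_by f (s n) t) `^ p)%:E) (fun=> 0%E)
  (fun t => ((3 * rnorm (f t)) `^ p)%:E) msub (measurable_cst _).
case.
- apply: aeW => t _; apply: cvg_EFin; first exact: nearW.
  rewrite -(@powR0 R p) ?gt_eqF //; apply: cvg_powR => // [n|]; first exact: rnorm_ge0.
  have := (cvg_rnormP _ _).1 (cvg_trunc_by (cs t)).
  by apply: cvg_trans; apply: near_eq_cvg; apply: nearW => n; rewrite -rnormN opprB.
- apply/integrableP.
  have E t : ((3 * rnorm (f t)) `^ p)%:E = ((3 `^ p)%:E * (rnorm (f t) `^ p)%:E)%E.
    by rewrite -EFinM powRM // rnorm_ge0.
  split.
    apply/measurable_EFinP; apply: (measurableT_comp (measurable_powR p)).
    by apply: measurable_funM; [exact: measurable_cst|exact: measurable_rnorm].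
  under eq_integral => t _ do rewrite gee0_abs ?lee_fin ?powR_ge0 // E.
  rewrite ge0_integralZl_EFin ?powR_ge0 //; last 2 first.
  + by move=> t _; exact: rnorm_powR_ge0.
  + exact: measurable_rnorm_powR.
  by rewrite lte_mul_pinfty ?lee_fin ?powR_ge0.
- apply: aeW => t n _; rewrite gee0_abs ?lee_fin ?powR_ge0 //.
  apply: ge0_ler_powR; rewrite ?nnegrE ?rnorm_ge0 ?mulr_ge0 ?rnorm_ge0 //; first exact: ltW.
  exact: rnorm_sub_trunc_by.
move=> _ + _; apply: cvg_trans; apply: near_eq_cvg; apply: nearW => n /=.
by apply: eq_integral => t _ /=; rewrite subr0 ger0_norm ?powR_ge0.
Qed.

Lemma integral_rnormD f g h (sfh : strongly_measurable measurable (fun t => f t - h t)) 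
  (sfg : strongly_measurable measurable (fun t => f t - g t))
  (sgh : strongly_measurable measurable (fun t => g t - h t)) :
  (\int[P]_t (rnorm (f t - h t))%:E <=
   \int[P]_t (rnorm (f t - g t))%:E + \int[P]_t (rnorm (g t - h t))%:E)%E.
Proof.
have m (k : T -> X) : strongly_measurable measurable k ->
    measurable_fun setT (fun t : T => (rnorm (k t))%:E).
  by move=> sk; apply/measurable_EFinP; exact: measurable_rnorm.
have r0 (v : X) : (0 <= (rnorm v)%:E)%E by rewrite lee_fin rnorm_ge0.
rewrite -ge0_integralD //; try exact: m.
apply: ge0_le_integral => //; first exact: m.
  exact: emeasurable_funD (m _ sfg) (m _ sgh).
move=> t _; rewrite -EFinD lee_fin.
have -> : f t - h t = (f t - g t) + (g t - h t) by rewrite addrA subrK.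
exact: ler_rnormD.
Qed.

Lemma integral_rnorm_distC f g :
  (\int[P]_t (rnorm (f t - g t))%:E = \int[P]_t (rnorm (g t - f t))%:E)%E.
Proof. by apply: eq_integral => t _; rewrite -rnormN opprB. Qed.

Lemma ler_rnorm_simple_integralB f s1 s2 : strongly_measurable measurable f ->
  simple_function measurable s1 -> simple_function measurable s2 ->
  ((rnorm (simple_integral P s1 - simple_integral P s2))%:E <=
   \int[P]_t (rnorm (f t - s1 t))%:E + \int[P]_t (rnorm (f t - s2 t))%:E)%E.
Proof.
move=> sf ss1 ss2; have [S1 S2] := (simple_strongly_measurable ss1, simple_strongly_measurable
  ss2).
rewrite -simple_integralB //.
apply: le_trans (ler_rnorm_simple_integral _ _) _.
  exact: (simple_map2 (fun x y => x - y)); exact: sigT.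
rewrite [X in (_ <= X + _)%E]integral_rnorm_distC.
by apply: integral_rnormD; exact: strongly_measurableB.
Qed.

(** [bochner_integral] is chosen among the limits; uniqueness allows it to be computed from any
    approximating sequence. *)
Lemma is_bochner_integral_unique f v w :
  is_bochner_integral P f v -> is_bochner_integral P f w -> v = w.
Proof.
move=> [sf [s [ss cs iv]]] [_ [r [sr cr iw]]].
apply/eqP; rewrite -subr_eq0; apply/eqP/rnorm_eq0/eqP; rewrite eq_le rnorm_ge0 andbT -lee_fin.
have c1 : (rnorm (simple_integral P (s n) - simple_integral P (r n)))%:E @[n --> \oo]
    --> (rnorm (v - w))%:E.
  by apply: cvg_EFin; [exact: nearW|apply: cvg_rnorm; apply: cvgB].
have c2 : (\int[P]_t (rnorm (f t - s n t))%:E + \int[P]_t (rnorm (f t - r n t))%:E)%E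
    @[n --> \oo] --> (0 + 0 : \bar R)%E.
  by apply: cvgeD.
rewrite adde0 in c2.
have := lee_cvg_to c1 c2; apply; apply: nearW => n.
exact: ler_rnorm_simple_integralB.
Qed.

(** The integrals of approximants in [L^1] form a Cauchy sequence, and [X] is complete. *)
Lemma bochner_integral_exists f : strongly_measurable measurable f ->
  (\int[P]_t (rnorm (f t))%:E < +oo)%E -> bochner_integrable P f.
Proof.
move=> sf fi.
have [s [ss cs]] : exists s : nat -> T -> X, (forall n, simple_function measurable (s n)) /\
    (\int[P]_t (rnorm (f t - s n t))%:E)%E @[n --> \oo] --> 0%E.
  have [|s [ss cs]] := @simple_approx measurable f 1 sigT (fun _ h => h) sf (lexx _).
    by under eq_integral => t _ do rewrite powRr1 ?rnorm_ge0 //.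
  exists s; split=> //; apply: cvg_trans cs; apply: near_eq_cvg; apply: nearW => n.
  by apply: eq_integral => t _; rewrite powRr1 ?rnorm_ge0.
suff /cvg_ex[v cv] : cvg (simple_integral P (s n) @[n --> \oo]).
  by exists v; split=> //; exists s.
apply/cauchy_cvgP/cauchyP => e e0.
have er : e = ((complex.Re e)%:C)%C by rewrite RRe_real // gtr0_real.
have e0' : 0 < complex.Re e by rewrite er in e0; rewrite -ltcR.
have e2 : (0 < (complex.Re e / 2)%:E)%E by rewrite lte_fin divr_gt0.
have [N _ hN] : \forall n \near \oo, (\int[P]_t (rnorm (f t - s n t))%:E < (complex.Re e /
  2)%:E)%E.
  exact: (cs _ (open_ereal_lt' e2)).
exists (simple_integral P (s N)); exists N => // n Nn.
rewrite -ball_normE /ball_ /= er -rnormE ltcR -lte_fin.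
apply: le_lt_trans (ler_rnorm_simple_integralB sf (ss N) (ss n)) _.
rewrite [X in (_ < X%:E)%E](splitr (complex.Re e)) EFinD.
by apply: lteD; apply: hN => /=.
Qed.

(* The first two hypotheses make [f] integrable, so that [bochner_integral P f = 0] is not the
   junk value of a non-integrable function. *)
Lemma bochner_integral0_simple f s : strongly_measurable measurable f ->
  (\int[P]_t (rnorm (f t))%:E < +oo)%E -> bochner_integral P f = 0 ->
  simple_function measurable s ->
  ((rnorm (simple_integral P s))%:E <= \int[P]_t (rnorm (f t - s t))%:E)%E.
Proof.
move=> sf fi f0 ss.
have [v iv] := bochner_integral_exists sf fi.
have : is_bochner_integral P f (bochner_integral P f).
  by rewrite /bochner_integral; case: xgetP => [w -> //|/(_ v)].
rewrite f0 => -[_ [r [sr cr ir]]].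
have c1 : (rnorm (simple_integral P s - simple_integral P (r n)))%:E @[n --> \oo]
    --> (rnorm (simple_integral P s - 0))%:E.
  by apply: cvg_EFin; [exact: nearW|apply: cvg_rnorm; apply: cvgB; [exact: cvg_cst|]].
have c2 : (\int[P]_t (rnorm (f t - s t))%:E + \int[P]_t (rnorm (f t - r n t))%:E)%E
    @[n --> \oo] --> (\int[P]_t (rnorm (f t - s t))%:E + 0 : \bar R)%E.
  by apply: cvgeD; [rewrite fin_num_adde_defl|exact: cvg_cst|].
rewrite adde0 subr0 in c1 c2.
have := lee_cvg_to c1 c2; apply; apply: nearW => n.
exact: ler_rnorm_simple_integralB.
Qed.

Lemma bochner_integral_simple s : simple_function measurable s ->
  bochner_integral P s = simple_integral P s.
Proof.
move=> ss; apply: (@is_bochner_integral_unique s); last first.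
  split; first exact: simple_strongly_measurable.
  exists (fun _ => s); split=> //; last exact: cvg_cst.
  rewrite (_ : (fun n => _) = fun=> 0%E); first exact: cvg_cst.
  apply/funext => n; rewrite -[RHS](integral0 P setT); apply: eq_integral => t _.
  by rewrite subrr rnorm0.
have [|v iv] := bochner_integral_exists (simple_strongly_measurable ss).
  have [J [c [w [-> mc]]]] := simple_fun_factor sigT ss.
  rewrite (ge0_integral_fin P (g := fun j => rnorm (w j))) //; last by move=> j; exact: rnorm_ge0.
  apply: lte_sum_pinfty => j _; rewrite -[X in (_ * X)%E]fineK ?fin_num_measure //.
  by rewrite -EFinM ltry.
by rewrite /bochner_integral; case: xgetP => [u -> //|/(_ v)].
Qed.


End Bochner3.

(** * Mixed radix expansions and Dirichlet kernels *)

Section MixedRadix.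
Variable m : nat -> nat.
Hypothesis hm : forall k, (2 <= m k)%N.

Lemma vbaseS k : vbase m k.+1 = (vbase m k * m k)%N.
Proof. by rewrite /vbase big_ord_recr. Qed.

Lemma vbase0 : vbase m 0 = 1%N.
Proof. by rewrite /vbase big_ord0. Qed.

Lemma radix_gt0 k : (0 < m k)%N. Proof. exact: ltnW. Qed.

Lemma vbase_gt0 k : (0 < vbase m k)%N.
Proof. by apply: prodn_gt0 => i; exact: radix_gt0. Qed.

Lemma vbase_dvd j k : (j <= k)%N -> (vbase m j %| vbase m k)%N.
Proof.
move=> /subnK <-; elim: (k - j)%N => // n IH.
by rewrite addSn vbaseS dvdn_mulr.
Qed.

Lemma ltn_vbase k : (k < vbase m k)%N.
Proof.
elim: k => [|k IH]; first by rewrite vbase0.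
rewrite vbaseS; apply: leq_ltn_trans IH _.
by rewrite -[X in (X < _)%N]muln1 ltn_pmul2l ?vbase_gt0.
Qed.

Lemma vbase_leq j k : (j <= k)%N -> (vbase m j <= vbase m k)%N.
Proof. by move=> jk; apply: dvdn_leq; rewrite ?vbase_gt0 ?vbase_dvd. Qed.

Lemma vdigit_lt n k : (vdigit m n k < m k)%N.
Proof. by rewrite ltn_mod radix_gt0. Qed.

Lemma vdigit_small n k : (n < vbase m k)%N -> vdigit m n k = 0%N.
Proof. by move=> nk; rewrite /vdigit divn_small ?mod0n. Qed.

Lemma modn_vbaseS n k : (n %% vbase m k.+1 = n %% vbase m k + vdigit m n k * vbase m k)%N.
Proof.
rewrite /vdigit vbaseS; set M := vbase m k; have M0 : (0 < M)%N by exact: vbase_gt0.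
rewrite [X in (X %% _)%N](divn_eq n M) [X in (X * M + _)%N](divn_eq (n %/ M) (m k)).
rewrite mulnDl -mulnA (mulnC (m k)) -addnA modnMDl modn_small; first by rewrite addnC.
have h1 := ltn_pmod (n %/ M) (radix_gt0 k); have h2 := ltn_pmod n M0.
apply: (@leq_trans ((n %/ M %% m k).+1 * M)); last by rewrite mulnC leq_pmul2l.
by rewrite mulSn addnC ltn_add2r.
Qed.

Lemma sum_vdigit n L : (\sum_(k < L) vdigit m n k * vbase m k = n %% vbase m L)%N.
Proof.
elim: L => [|L IH]; first by rewrite big_ord0 vbase0 modn1.
by rewrite big_ord_recr /= IH modn_vbaseS.
Qed.

(** This converts cylinders of the group into residue classes, so that conditions on the first
    coordinates become congruences. *)
Lemma eq_vdigitP x y j :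
  (forall k, (k < j)%N -> vdigit m x k = vdigit m y k) <-> (x = y %[mod vbase m j]).
Proof.
elim: j => [|j IH]; first by rewrite vbase0 !modn1.
rewrite !modn_vbaseS; split=> [h|h].
  by rewrite (IH.1 _) ?h // => k kj; apply: h; exact: ltnW.
have M0 := vbase_gt0 j.
have h1 : x = y %[mod vbase m j].
  by move: (congr1 (modn^~ (vbase m j)) h); rewrite /= !(addnC (_ %% _)%N) !modnMDl !modn_mod.
move=> k; rewrite ltnS leq_eqVlt => /predU1P[->|kj]; last exact: IH.2.
move: h; rewrite h1 => /addnI /eqP; rewrite eqn_mul2r => /orP[/eqP h|/eqP //].
by rewrite h in M0.
Qed.

Lemma vdigitD x c L k : (x < vbase m L)%N -> (c < m L)%N ->
  vdigit m (x + c * vbase m L) k =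
  if (k < L)%N then vdigit m x k else if k == L then c else 0%N.
Proof.
move=> xL cL.
have h : (x + c * vbase m L < vbase m L.+1)%N.
  apply: (@leq_trans (c.+1 * vbase m L)); first by rewrite mulSn ltn_add2r.
  by rewrite vbaseS mulnC leq_pmul2l ?vbase_gt0.
case: ltnP => kL.
  have E : (x + c * vbase m L = x %[mod vbase m L])%N by rewrite addnC modnMDl.
  exact: ((eq_vdigitP _ _ _).2 E).
case: eqP => [->|kn].
  rewrite /vdigit addnC divnMDl ?vbase_gt0 // (divn_small xL) addn0 modn_small //.
apply: vdigit_small; apply: leq_trans h _; apply: vbase_leq.
by rewrite ltn_neqAle eq_sym kL andbT; apply/eqP.
Qed.

Lemma oplus0r a : oplus m a 0 = a.
Proof.
rewrite /oplus maxn0 -[RHS](modn_small (ltn_vbase a)) -sum_vdigit.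
apply: eq_bigr => k _; congr (_ * _)%N.
by rewrite /vdigit div0n mod0n addn0 modn_mod.
Qed.

Lemma oplus0l a : oplus m 0 a = a.
Proof.
rewrite -[RHS]oplus0r /oplus maxnC; apply: eq_bigr => k _.
by rewrite addnC.
Qed.

Lemma big_ord_mul (V : nmodType) (M c : nat) (G : nat -> V) :
  \sum_(l < c * M) G l = \sum_(u < c) \sum_(b < M) G (b + u * M)%N.
Proof.
elim: c => [|c IH]; first by rewrite !big_ord0.
rewrite big_ord_recr /= -IH -!(big_mkord xpredT) mulSn (addnC M) (@big_cat_nat _ _ _ (c * M))
  //=; last exact: leq_addr.
by congr (_ + _); rewrite -[X in \sum_(X <= _ < _) _]add0n big_addn addKn big_mkord.
Qed.

(** * Dirichlet kernels *)

Section Dirichlet.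
Variables (K : fieldType) (z : nat -> K).
Hypothesis hz : forall k, z k ^+ m k = 1.

(** The character [psi_l] in terms of its values [z k] at the generators. An arbitrary [z] is
    allowed because the kernels are evaluated at ratios of characters at two points. *)
Definition digit_char (L l : nat) : K := \prod_(k < L) z k ^+ vdigit m l k.

(** For the ratios at two points, this says that their first [j] coordinates agree. *)
Definition trivial_upto (j : nat) : bool := [forall k : 'I_j, z k == 1].

Lemma trivial_uptoS j : trivial_upto j.+1 = trivial_upto j && (z j == 1).
Proof.
apply/forallP/andP => [h|[/forallP h hj] k].
  split; last exact: (h ord_max).
  by apply/forallP => k; exact: (h (widen_ord (leqnSn j) k)).
have := ltn_ord k; rewrite ltnS leq_eqVlt => /predU1P[->//|kj].
exact: (h (Ordinal kj)).
Qed.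

Lemma digit_charS L b c : (b < vbase m L)%N -> (c < m L)%N ->
  digit_char L.+1 (b + c * vbase m L) = digit_char L b * z L ^+ c.
Proof.
move=> bL cL; rewrite /digit_char big_ord_recr /= vdigitD // ltnn eqxx.
by congr (_ * _); apply: eq_bigr => k _; rewrite vdigitD // ltn_ord.
Qed.

Lemma digit_char_trivial L l : trivial_upto L -> digit_char L l = 1.
Proof. by move=> /forallP h; apply: big1 => k _; rewrite (eqP (h k)) expr1n. Qed.

Lemma sum_expr k : \sum_(c < m k) z k ^+ c = (m k)%:R *+ (z k == 1).
Proof.
case: eqP => [->|/eqP zk].
  by under eq_bigr do rewrite expr1n; rewrite sumr_const card_ord mulr1n.
apply/eqP; rewrite mulr0n -(mulrI_eq0 _ (mulfI (_ : z k - 1 != 0))) ?subr_eq0 //.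
by rewrite -subrX1 hz subrr.
Qed.

Lemma sum_digit_charM L c : (c <= m L)%N ->
  \sum_(l < c * vbase m L) digit_char L.+1 l =
  (\sum_(l < vbase m L) digit_char L l) * \sum_(u < c) z L ^+ u.
Proof.
move=> cL; rewrite big_ord_mul mulr_sumr; apply: eq_bigr => u _.
rewrite mulr_suml; apply: eq_bigr => b _; rewrite digit_charS //.
exact: leq_trans (ltn_ord u) cL.
Qed.

(** Paley's formula: the sum over all [l < M_L] factors over the digits, and each factor is a full
    sum of powers of a root of unity. *)
Lemma sum_digit_char L :
  \sum_(l < vbase m L) digit_char L l = (vbase m L)%:R *+ trivial_upto L.
Proof.
elim: L => [|L IH].
  rewrite vbase0 big_ord1 /digit_char big_ord0.
  by have -> : trivial_upto 0 by apply/forallP; case.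
rewrite vbaseS mulnC sum_digit_charM // IH sum_expr trivial_uptoS natrM.
by case: trivial_upto => /=; case: eqP; rewrite ?mulr0n ?mulr0 ?mul0r ?mulr1n // mulrC.
Qed.

Definition top_digits (S : pred nat) (L : nat) : nat :=
  (\sum_(j < L | S j) (m j).-1 * vbase m j)%N.

Lemma top_digitsS S L :
  top_digits S L.+1 = (top_digits S L + (if S L then (m L).-1 else 0) * vbase m L)%N.
Proof.
rewrite /top_digits !(big_mkcond (fun j => S (nat_of_ord j))) big_ord_recr /=.
by case: (S L).
Qed.

Lemma top_digits_lt S L : (top_digits S L < vbase m L)%N.
Proof.
elim: L => [|L IH]; first by rewrite /top_digits big_ord0 vbase0.
rewrite top_digitsS vbaseS -[X in (_ < _ * X)%N](prednK (radix_gt0 L)) mulnS mulnC.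
rewrite (leq_ltn_trans (_ : _ <= top_digits S L + vbase m L * (m L).-1)%N) ?ltn_add2r //.
by rewrite leq_add2l leq_pmul2l ?vbase_gt0 //; case: ifP.
Qed.

(* The Dirichlet kernel of an integer whose digits are all minimal or maximal is, up to a
   character, a sum of martingale difference kernels. *)
Lemma dirichlet_top_digits S L :
  \sum_(l < top_digits S L) digit_char L l =
  digit_char L (top_digits S L) *
  \sum_(j < L | S j) ((vbase m j.+1)%:R *+ trivial_upto j.+1 - (vbase m j)%:R *+ trivial_upto j).
Proof.
elim: L => [|L IH]; first by rewrite /top_digits !big_ord0 mulr0.
have tL := top_digits_lt S L.
rewrite (big_mkcond (fun j : 'I_L.+1 => S (nat_of_ord j))) [in RHS]big_ord_recr /=.
rewrite -(big_mkcond (fun j : 'I_L => S (nat_of_ord j))) /= top_digitsS.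
case: (S L) => /=; last first.
  rewrite mul0n addn0 addr0.
  have E l : (l < vbase m L)%N -> digit_char L.+1 l = digit_char L l.
    by move=> lL; have := @digit_charS L l 0 lL (radix_gt0 L); rewrite mul0n addn0 expr0 mulr1.
  by rewrite E // -IH; apply: eq_bigr => l _; rewrite E //; exact: ltn_trans (ltn_ord l) tL.
have mL : ((m L).-1 < m L)%N by rewrite ltn_predL radix_gt0.
(* Below [(m_L - 1) M_L] the lower digits run freely and the sum factors; above, the top digit is
   constantly [m_L - 1] and the sum is that of level [L] times a power of [z L]. *)
rewrite (addnC (top_digits S L)) -!(big_mkord xpredT) (@big_cat_nat _ _ _ ((m L).-1 * vbase m
  L)) //=; last exact: leq_addr.
rewrite !big_mkord sum_digit_charM; last exact: leq_pred.
rewrite sum_digit_char -{1}[((m L).-1 * _)%N]add0n big_addn addKn big_mkord.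
under [X in _ + X]eq_bigr => l _.
  rewrite digit_charS //; last exact: ltn_trans (ltn_ord l) tL.
  over.
rewrite -mulr_suml IH addnC digit_charS // mulrDr addrC; congr (_ + _); first by ring.
rewrite trivial_uptoS; case: (boolP (trivial_upto L)) => triv /=; last first.
  by rewrite !mulr0n subr0 mul0r mulr0.
rewrite (digit_char_trivial _ triv) mul1r mulr1n.
(* The reason for maximal digits: the sum lacks only its last power, which produces the term with
   [M_L] once the factor [z L ^ (m_L - 1)] is taken out. *)
have /eqP : \sum_(u < (m L).-1) z L ^+ u + z L ^+ (m L).-1 = (m L)%:R *+ (z L == 1).
  rewrite -sum_expr -!(big_mkord xpredT (fun u => z L ^+ u)) -big_nat_recr //=.
  by rewrite prednK ?radix_gt0.
rewrite eq_sym -subr_eq => /eqP <-; rewrite vbaseS natrM.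
case: eqP => [->|_]; rewrite ?expr1n ?mulr1n ?mulr0n; ring.
Qed.

End Dirichlet.
End MixedRadix.

(** * Finite-level functions on the Vilenkin group *)

Section Cis.
Context {R : realType}.

Definition cis (t : R) : R[i] := (cos t +i* sin t)%C.

Lemma cisD s t : cis (s + t) = cis s * cis t.
Proof. by rewrite /cis cosD sinD /GRing.mul /=; congr (_ +i* _)%C; rewrite addrC. Qed.

Lemma cis0 : cis 0 = 1.
Proof. by rewrite /cis cos0 sin0. Qed.

Lemma cisM n t : cis (n%:R * t) = cis t ^+ n.
Proof.
elim: n => [|n IH]; first by rewrite mul0r cis0 expr0.
by rewrite -natr1 mulrDl mul1r cisD IH exprSr.
Qed.

Lemma norm_cis t : `|cis t| = 1.
Proof. by rewrite normc_def /= cos2Dsin2 sqrtr1. Qed.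

Lemma cis_neq0 t : cis t != 0.
Proof. by rewrite -normr_eq0 norm_cis oner_eq0. Qed.

Definition unit_root (m : nat -> nat) (k t : nat) : R[i] := cis (2 * pi * t%:R / (m k)%:R).

Lemma unit_root_expr (m : nat -> nat) k t : (0 < m k)%N -> unit_root m k t ^+ m k = 1.
Proof.
move=> mk; rewrite -cisM mulrC divfK ?pnatr_eq0 -?lt0n //.
rewrite mulrC cisM.
have -> : cis (2 * pi) = 1 by rewrite mulr_natl /cis cos2pi sin2pi.
exact: expr1n.
Qed.

Lemma norm_unit_root (m : nat -> nat) k t : `|unit_root m k t| = 1.
Proof. exact: norm_cis. Qed.

(** If two roots agree, their quotient [cis (2 u)] is [1] with [0 < u < pi], while its real part is
    [1 - 2 (sin u) ^ 2 < 1]. *)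
Lemma unit_root_inj (m : nat -> nat) k s t : (s < m k)%N -> (t < m k)%N ->
  unit_root m k s = unit_root m k t -> s = t.
Proof.
wlog : s t / (t <= s)%N => [h sm tm e|ts sm tm].
  by case/orP: (leq_total s t) => ?; [apply: esym|]; apply: h.
rewrite /unit_root -{1}(subnK ts) natrD mulrDr mulrDl cisD -[RHS]mul1r => /(mulIf (cis_neq0 _)).
have mk : (0 : R) < (m k)%:R by rewrite ltr0n; apply: leq_ltn_trans sm.
case: (posnP (s - t)) => [/eqP st _|d0]; first by apply/eqP; rewrite eqn_leq ts andbT.
set u : R := pi * (s - t)%:R / (m k)%:R.
have -> : 2 * pi * (s - t)%:R / (m k)%:R = u *+ 2 by rewrite -(mulr_natl u 2) /u !mulrA.
have : 0 < sin u.
  apply: sin_gt0_pi; rewrite divr_gt0 ?mulr_gt0 ?pi_gt0 ?mk ?ltr0n //=.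
  rewrite ltr_pdivrMr // ltr_pM2l ?pi_gt0 // ltr_nat.
  by apply: leq_ltn_trans sm; exact: leq_subr.
move=> su e; have := congr1 (@complex.Re R) e; rewrite /= cos_mulr2n cos2sin2 => /eqP h.
have su2 : 0 < sin u ^+ 2 by rewrite exprn_gt0.
by exfalso; move/eqP: h su2; clear; lra.
Qed.

End Cis.

(** * Codes of points and Haar measure *)

Section VilenkinCode.
Context {R : realType} {X : completeNormedModType R[i]}.
Variable m : nat -> nat.
Hypothesis hm : forall k, (2 <= m k)%N.
Variable mu : probability (vilenkin m) R.
Hypothesis hmu : normalized_haar mu.

(* The first [L] coordinates, read as the digits of an integer below [vbase m L]: the functions
   of these coordinates are the [F \o vcode L]. *)
Definition vcode (L : nat) (x : vilenkin m) : nat :=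
  (\sum_(k < L) (x k : nat) * vbase m k)%N.

Lemma vcoord_lt (x : vilenkin m) k : ((x k : nat) < m k)%N.
Proof. by apply: leq_trans (ltn_ord (x k)) _; rewrite Zp_cast. Qed.

Lemma vcodeS L x : vcode L.+1 x = (vcode L x + (x L : nat) * vbase m L)%N.
Proof. by rewrite /vcode big_ord_recr. Qed.

Lemma vcode_lt L x : (vcode L x < vbase m L)%N.
Proof.
elim: L => [|L IH]; first by rewrite /vcode big_ord0 vbase0.
rewrite vcodeS vbaseS; apply: (@leq_trans ((x L : nat).+1 * vbase m L)).
  by rewrite mulSn ltn_add2r.
by rewrite mulnC leq_pmul2l ?vbase_gt0 ?vcoord_lt.
Qed.

Lemma vdigit_vcode L x k : (k < L)%N -> vdigit m (vcode L x) k = x k.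
Proof.
elim: L => // L IH; rewrite ltnS => kL; rewrite vcodeS vdigitD ?vcode_lt ?vcoord_lt //.
by move: kL; rewrite leq_eqVlt => /predU1P[->|kL]; rewrite ?ltnn ?eqxx // kL IH.
Qed.

Lemma vcodeP L x a : (a < vbase m L)%N ->
  vcode L x = a <-> forall k, (k < L)%N -> (x k : nat) = vdigit m a k.
Proof.
move=> aL; split=> [<- k kL|h]; first by rewrite vdigit_vcode.
rewrite -(modn_small aL) -(modn_small (vcode_lt L x)); apply/eq_vdigitP => // k kL.
by rewrite vdigit_vcode // h.
Qed.

Lemma measurable_vcoord k j : measurable [set x : vilenkin m | (x k : nat) = j].
Proof.
have [jm|jm] := ltnP j (m k); last first.
  rewrite (_ : [set _ | _] = set0); first exact: measurable0.
  by apply/seteqP; split=> // x /= e; have := vcoord_lt x k; rewrite e ltnNge jm.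
apply: sub_sigma_algebra; exists k, (j%:R); apply/seteqP; split=> x /= h.
  by apply: val_inj; rewrite /= val_Zp_nat // modn_small.
by rewrite h val_Zp_nat // modn_small.
Qed.

Lemma measurable_vcode L a : measurable [set x : vilenkin m | vcode L x = a].
Proof.
have [aL|aL] := ltnP a (vbase m L); last first.
  rewrite (_ : [set _ | _] = set0); first exact: measurable0.
  by apply/seteqP; split=> // x /= e; have := vcode_lt L x; rewrite e ltnNge aL.
rewrite (_ : [set _ | _] = \bigcap_(k in [set k | (k < L)%N]) [set x : vilenkin m | (x k : nat)
  = vdigit m a k]).
  by apply: bigcap_measurableType => k _; exact: measurable_vcoord.
by apply/seteqP; split=> x /=; [move=> /(vcodeP _ aL) h k|move=> h; apply/(vcodeP _ aL) => k];
  exact: h.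
Qed.

(** Translation by the point with the digits of [a] pulls the cylinder of [a] back to that of
    [0]. *)
Lemma haar_vcode_eq L a : (a < vbase m L)%N ->
  mu [set x | vcode L x = a] = mu [set x | vcode L x = 0%N].
Proof.
move=> aL; pose t : vilenkin m := fun k => (vdigit m a k)%:R.
rewrite -(hmu t (measurable_vcode L a)); congr (mu _).
have tk k : (t k : nat) = vdigit m a k.
  by rewrite /t val_Zp_nat // modn_small // vdigit_lt.
apply/seteqP; split=> x /=.
  move=> /(vcodeP _ aL) h; apply/(vcodeP _ (vbase_gt0 hm L)) => k kL.
  rewrite (vdigit_small (vbase_gt0 hm k)).
  have : vilenkin_add t x k = t k by apply: ord_inj; rewrite tk; exact: h.
  by rewrite /vilenkin_add -[RHS]addr0 => /addrI ->.
move=> /(vcodeP _ (vbase_gt0 hm L)) h; apply/(vcodeP _ aL) => k kL.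
rewrite /vilenkin_add (_ : x k = 0) ?addr0 ?tk //.
by apply: ord_inj; rewrite h //= (vdigit_small (vbase_gt0 hm k)).
Qed.

Definition vcode_ord L x : 'I_(vbase m L) := Ordinal (vcode_lt L x).

Lemma preimage_vcode_ord L (a : 'I_(vbase m L)) :
  vcode_ord L @^-1` [set a] = [set x | vcode L x = a].
Proof. by apply/seteqP; split=> x /= h; [rewrite -h|exact: val_inj]. Qed.

Lemma measurable_vcode_ord L a : measurable (vcode_ord L @^-1` [set a]).
Proof. by rewrite preimage_vcode_ord; exact: measurable_vcode. Qed.

Lemma haar_vcode L (a : 'I_(vbase m L)) :
  mu (vcode_ord L @^-1` [set a]) = ((vbase m L)%:R^-1)%:E.
Proof.
have E b : mu (vcode_ord L @^-1` [set b]) = mu [set x | vcode L x = 0%N].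
  by rewrite preimage_vcode_ord haar_vcode_eq.
rewrite E; set q := mu _.
have qf : q \is a fin_num by apply: fin_num_measure; exact: measurable_vcode.
have : (\int[mu]_x (1%:E) = \sum_(b < vbase m L) 1%:E * mu (vcode_ord L @^-1` [set b]))%E.
  exact: ge0_integral_fin (@measurable_vcode_ord L) (fun=> ler01).
have -> : (\int[mu]_x (1%:E) = 1%:E)%E.
  by rewrite integral_cst // mul1e; exact: probability_setT.
under eq_bigr => b _ do rewrite mul1e E -/q -(fineK qf).
rewrite sumEFin sumr_const card_ord => hE; have h := EFin_inj hE.
have M0 : (vbase m L)%:R != 0 :> R by rewrite pnatr_eq0 -lt0n vbase_gt0.
by rewrite -(fineK qf); congr EFin; apply: (mulfI M0); rewrite mulfV // mulr_natl; exact: esym h.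
Qed.

Lemma integral_vcode L (g : nat -> R) : (forall a, 0 <= g a) ->
  (\int[mu]_x (g (vcode L x))%:E = ((vbase m L)%:R^-1 * \sum_(a < vbase m L) g a)%:E)%E.
Proof.
move=> g0; rewrite (ge0_integral_fin mu (g := fun a : 'I_(vbase m L) => g a)
  (c := vcode_ord L)) //; last exact: measurable_vcode_ord.
rewrite mulr_sumr -sumEFin; apply: eq_bigr => a _.
by rewrite mulrC EFinM; congr (_ * _)%E; exact: haar_vcode.
Qed.

Lemma simple_vcode L (F : nat -> X) : simple_function measurable (F \o vcode L).
Proof.
apply: (@simple_fin _ _ _ _ _ (vcode_ord L) (fun a => F a)).
- exact: sigma_algebra_measurable.
- exact: measurable_vcode_ord.
Qed.

Lemma bochner_integral_vcode L (F : nat -> X) :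
  bochner_integral mu (F \o vcode L) =
  (((vbase m L)%:R^-1 : R)%:C)%C *: \sum_(a < vbase m L) F a.
Proof.
rewrite bochner_integral_simple; last exact: simple_vcode.
rewrite (simple_integral_fin mu (fun a : 'I_(vbase m L) => F a) (@measurable_vcode_ord L)).
rewrite scaler_sumr; apply: eq_bigr => a _.
by rewrite (_ : mu _ = ((vbase m L)%:R^-1)%:E) //; exact: haar_vcode.
Qed.

Lemma bochner_normE d (T : measurableType d) (P : probability T R) (f : T -> X) p : p != 0 ->
  (bochner_norm P p f `^ p = \int[P]_t (rnorm (f t) `^ p)%:E)%E.
Proof.
move=> p0; rewrite /bochner_norm powR_Lnorm //; apply: eq_integral => t _.
by rewrite abse_EFin ger0_norm ?rnorm_ge0 // poweR_EFin.
Qed.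

Lemma bochner_norm_vcode L (F : nat -> X) p : p != 0 ->
  (bochner_norm mu p (F \o vcode L) `^ p =
   ((vbase m L)%:R^-1 * \sum_(a < vbase m L) rnorm (F a) `^ p)%:E)%E.
Proof.
move=> p0; rewrite bochner_normE //.
by rewrite (integral_vcode L (g := fun a => rnorm (F a) `^ p)) // => a; exact: powR_ge0.
Qed.

Lemma bochner_Lp_vcode L (F : nat -> X) p : p != 0 -> bochner_Lp mu p (F \o vcode L).
Proof.
move=> p0; split; first by apply: simple_strongly_measurable; exact: simple_vcode.
by apply: (lty_poweRy p0); rewrite bochner_norm_vcode // ltry.
Qed.

(** The character [psi_n] at a point of code [a]; it sees only the first [L] digits of [n], hence
    the condition [n < M_L] below. *)
Definition vchar (L n a : nat) : R[i] := digit_char m (fun k => unit_root m k (vdigit m a k)) L n.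

(** Reconciles the two truncations: [vpsi] takes [n] factors, [vchar] takes [L]. *)
Lemma digit_char_widen (K : fieldType) (z : nat -> K) L L' n : (L <= L')%N -> (n < vbase m L)%N ->
  digit_char m z L' n = digit_char m z L n.
Proof.
move=> /subnK <- nL; elim: (L' - L)%N => // k IH; rewrite addSn /digit_char big_ord_recr /=.
rewrite -/(digit_char _ _ _ _) IH vdigit_small ?expr0 ?mulr1 //.
by apply: leq_trans nL _; apply: vbase_leq; rewrite ?leq_addl.
Qed.

Lemma vpsiE L n (x : vilenkin m) : (n < vbase m L)%N -> vpsi n x = vchar L n (vcode L x) :> R[i].
Proof.
move=> nL.
pose z k : R[i] := unit_root m k (x k).
have -> : vpsi n x = digit_char m z n n.
  rewrite /vpsi /digit_char; apply: eq_bigr => k _ /=; rewrite /z /unit_root -cisM /cis.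
  by congr (cos _ +i* sin _)%C; ring.
have -> : vchar L n (vcode L x) = digit_char m z L n.
  by apply: eq_bigr => k _; rewrite vdigit_vcode.
have nn := ltn_vbase hm n.
by rewrite -(digit_char_widen z (leq_maxl L n) nL) (digit_char_widen z (leq_maxr L n) nn).
Qed.

Lemma norm_vchar L n a : `|vchar L n a| = 1.
Proof.
rewrite /vchar /digit_char normr_prod big1 // => k _.
by rewrite normrX norm_unit_root expr1n.
Qed.

Lemma fourier_coef_vcode L n (F : nat -> X) : (n < vbase m L)%N ->
  fourier_coef mu (F \o vcode L) n =
  (((vbase m L)%:R^-1 : R)%:C)%C *: \sum_(a < vbase m L) (vchar L n a)^* *: F a.
Proof.
move=> nL; rewrite /fourier_coef -(bochner_integral_vcode L (fun a => (vchar L n a)^* *: F a)).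
by congr (bochner_integral mu _); apply/funext => x /=; rewrite (vpsiE _ nL).
Qed.

End VilenkinCode.

(** * The two inequalities on finite levels *)

Section FiniteLPR.
Context {R : realType} {X : completeNormedModType R[i]}.
Variable m : nat -> nat.
Hypothesis hm : forall k, (2 <= m k)%N.
Variable mu : probability (vilenkin m) R.
Hypothesis hmu : normalized_haar mu.
Variable p : R.
Hypothesis p0 : 0 < p.

(** The Fourier coefficient of [F \o vcode L] at [n < M_L]. *)
Definition vhat (L : nat) (F : nat -> X) (n : nat) : X :=
  (((vbase m L)%:R^-1 : R)%:C)%C *: \sum_(a < vbase m L) (vchar m L n a)^* *: F a.

(** The Haar integral of [g \o vcode L], since codes are uniformly distributed. *)
Definition vmean (L : nat) (g : nat -> R) : R :=
  (vbase m L)%:R^-1 * \sum_(a < vbase m L) g a.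

Lemma rademacher_meanE (J : finType) (g : {ffun J -> bool} -> R) :
  rademacher_mean (fun eps => (g eps)%:E) = (2^-1 ^+ #|J| * \sum_eps g eps)%:E.
Proof. by rewrite /rademacher_mean sumEFin EFinM. Qed.

Lemma LPR_ineq_vcode (L : nat) (C : R) (J : finType) (I : J -> {fset nat}) (F : nat -> X) :
  (forall s n, n \in I s -> (n < vbase m L)%N) ->
  LPR_ineq mu p C I (F \o vcode L) ->
  2^-1 ^+ #|J| * \sum_(eps : {ffun J -> bool})
    vmean L (fun x => rnorm (\sum_s (-1) ^+ eps s *:
      \sum_(n <- I s) vchar m L n x *: vhat L F n) `^ p)
  <= `|C| `^ p * vmean L (fun x => rnorm (F x) `^ p).
Proof.
move=> hI; have pn : p != 0 by rewrite gt_eqF.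
rewrite /LPR_ineq.
have -> : (fun eps : {ffun J -> bool} => bochner_norm mu p
    (fun x => (\sum_s (-1) ^+ eps s *: fourier_proj mu (I s) (F \o vcode L) x)%R) `^ p)%E =
  (fun eps => (vmean L (fun x => rnorm (\sum_s (-1) ^+ eps s *:
      \sum_(n <- I s) vchar m L n x *: vhat L F n) `^ p))%:E).
  apply/funext => eps; rewrite /vmean.
  rewrite -(bochner_norm_vcode hm hmu L (fun x => \sum_s (-1) ^+ eps s *:
      \sum_(n <- I s) vchar m L n x *: vhat L F n)) //.
  congr (bochner_norm _ _ _ `^ _)%E; apply/funext => x /=.
  apply: eq_bigr => s _; congr (_ *: _); rewrite /fourier_proj.
  apply: eq_big_seq => n ns; rewrite (vpsiE hm _ (hI _ _ ns)).
  by rewrite (fourier_coef_vcode hm hmu) //; exact: hI ns.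
rewrite rademacher_meanE => h.
set B := bochner_norm mu p (F \o vcode L) in h.
(* The constant [C] may be negative; with [|C|] both sides are nonnegative and can be raised to the
   power [p]. *)
have h2 : ((2^-1 ^+ #|J| * \sum_(eps : {ffun J -> bool})
    vmean L (fun x => rnorm (\sum_s (-1) ^+ eps s *:
      \sum_(n <- I s) vchar m L n x *: vhat L F n) `^ p))%:E `^ p^-1 <= `|C|%:E * B)%E.
  apply: le_trans h _; apply: lee_wpmul2r; first exact: Lnorm_ge0.
  by rewrite lee_fin ler_norm.
have B0 : (0 <= B)%E by exact: Lnorm_ge0.
have itv0 (x : \bar R) : (0 <= x)%E -> x \in `[0%E, +oo%E] by move=> x0;
  rewrite in_itv /= x0 leey.
have CB0 : (0 <= `|C|%:E * B)%E by rewrite mule_ge0 // lee_fin.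
have := gt0_ler_poweR (ltW p0) (itv0 _ (poweR_ge0 _ _)) (itv0 _ CB0) h2.
rewrite -poweRrM mulVf // poweRe1; last first.
  rewrite lee_fin mulr_ge0 ?exprn_ge0 ?invr_ge0 // sumr_ge0 // => eps _.
  by rewrite mulr_ge0 ?invr_ge0 ?ler0n // sumr_ge0 // => a _; exact: powR_ge0.
by rewrite poweRM ?lee_fin // poweR_EFin (bochner_norm_vcode hm hmu) //.
Qed.

Lemma mem_nat_interval a b n : (n \in nat_interval a b) = (a <= n < b)%N.
Proof.
rewrite /nat_interval !inE /= mem_iota.
by case: (leqP a b) => ab; [rewrite subnKC|]; lia.
Qed.

Lemma sum_nat_interval0 (V : nmodType) n (G : nat -> V) :
  \sum_(k <- nat_interval 0 n) G k = \sum_(k < n) G k.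
Proof.
rewrite -(big_mkord xpredT) /index_iota subn0; apply: perm_big; apply: uniq_perm.
- exact: fset_uniq.
- exact: iota_uniq.
by move=> k; rewrite mem_nat_interval mem_iota.
Qed.

Lemma nat_interval1 n : nat_interval n n.+1 = [fset n]%fset.
Proof. by apply/fsetP => k; rewrite mem_nat_interval inE ltnS -eqn_leq eq_sym. Qed.

Lemma LPR_initial_and_singletons : LPR_eq mu p X \/ LPR_eq_oplus mu p X ->
  exists C : R, forall f : vilenkin m -> X, bochner_Lp mu p f ->
    (forall n, (0 < n)%N -> LPR_ineq mu p C (fun _ : 'I_1 => nat_interval 0 n) f) /\
    (forall M, LPR_ineq mu p C (fun s : 'I_M => [fset (s : nat)]%fset) f).
Proof.
have disj M : pairwise_disjoint (fun s : 'I_M => [fset (s : nat)]%fset).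
  by move=> s t st; rewrite fdisjoint1X inE.
have disj1 D : pairwise_disjoint (fun _ : 'I_1 => D) by move=> s t; rewrite !ord1.
case=> -[C hC]; exists C => f hf; split=> [n n0|M].
- by apply: hC => // s; exists 0%N, n.
- apply: hC => //; last by move=> s t; rewrite !cardfs1.
  by move=> s; exists s, s.+1; rewrite nat_interval1.
- have E : (fun _ : 'I_1 => oplus_shift m 0 (nat_interval 0 n)) = fun=> nat_interval 0 n.
    apply/funext => _; apply/fsetP => k; apply/imfsetP/idP => [[j jn ->]|kn].
      by rewrite (oplus0l hm).
    by exists k => //; rewrite (oplus0l hm).
  have := hC 1%N n (fun=> 0%N); rewrite /= E; apply => //.
- have E : (fun s : 'I_M => oplus_shift m s (nat_interval 0 1)) = fun s : 'I_M => [fset (s :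
  nat)]%fset.
    apply/funext => s; apply/fsetP => k; rewrite inE nat_interval1; apply/imfsetP/eqP => [[j]|->].
      by rewrite /= inE => /eqP -> ->; rewrite (oplus0r hm).
    by exists 0%N; rewrite /= ?inE // (oplus0r hm).
  have := hC M 1%N (fun s => s); rewrite /= E; apply => //.
Qed.

Lemma finite_LPR : LPR_eq mu p X \/ LPR_eq_oplus mu p X ->
  exists K : R, 0 <= K /\ forall L (F : nat -> X),
   (forall n, (n <= vbase m L)%N ->
     vmean L (fun x => rnorm (\sum_(l < n) vchar m L l x *: vhat L F l) `^ p)
     <= K * vmean L (fun x => rnorm (F x) `^ p)) /\
   2^-1 ^+ vbase m L * \sum_(eps : {ffun 'I_(vbase m L) -> bool})
     vmean L (fun x => rnorm (\sum_(s < vbase m L) (-1) ^+ eps s *: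
       (vchar m L s x *: vhat L F s)) `^ p)
     <= K * vmean L (fun x => rnorm (F x) `^ p).
Proof.
move=> /LPR_initial_and_singletons[C hC]; exists (`|C| `^ p); split; first exact: powR_ge0.
move=> L F; have [h1 h2] := hC _ (bochner_Lp_vcode hm hmu L F (lt0r_neq0 p0)).
split=> [n nL|].
  have [->|n0] := posnP n.
    rewrite /vmean big1 ?mulr0; last by move=> a _; rewrite big_ord0 rnorm0 powR0 ?gt_eqF.
    apply: mulr_ge0; first exact: powR_ge0.
    by rewrite mulr_ge0 ?invr_ge0 ?ler0n // sumr_ge0 // => a _; exact: powR_ge0.
  have hI (s : 'I_1) k : k \in nat_interval 0 n -> (k < vbase m L)%N.
    by rewrite mem_nat_interval /= => kn; exact: leq_trans nL.
  have := LPR_ineq_vcode hI (h1 n n0).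
  apply: le_trans; rewrite card_ord expr1.
  have E (eps : {ffun 'I_1 -> bool}) :
    vmean L (fun x => rnorm (\sum_s (-1) ^+ eps s *:
      \sum_(k <- nat_interval 0 n) vchar m L k x *: vhat L F k) `^ p) =
    vmean L (fun x => rnorm (\sum_(l < n) vchar m L l x *: vhat L F l) `^ p).
    by congr (_ * _); apply: eq_bigr => a _; rewrite big_ord1 rnorm_sign sum_nat_interval0.
  rewrite (eq_bigr _ (fun eps _ => E eps)) sumr_const card_ffun card_bool card_ord expn1.
  by rewrite -[X in _ * X]mulr_natl mulKf.
have hI (s : 'I_(vbase m L)) k : k \in [fset (s : nat)]%fset -> (k < vbase m L)%N.
  by rewrite inE => /eqP ->.
have := LPR_ineq_vcode hI (h2 (vbase m L)).
rewrite card_ord; apply: le_trans; rewrite ler_wpM2l ?exprn_ge0 ?invr_ge0 //.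
apply: ler_sum => eps _; rewrite le_eqVlt; apply/orP; left; apply/eqP.
congr (_ * _); apply: eq_bigr => a _; congr (rnorm _ `^ _); apply: eq_bigr => s _.
by rewrite big_seq_fset1.
Qed.

End FiniteLPR.

(** * Unconditionality of martingale differences on the Vilenkin group *)

Section VilenkinUnconditional.
Context {R : realType} {X : completeNormedModType R[i]}.
Variable m : nat -> nat.
Hypothesis hm : forall k, (2 <= m k)%N.

Lemma vchar_conj_mul L n a : vchar m L n a * (vchar m L n a)^* = 1 :> R[i].
Proof. by rewrite -normCK norm_vchar expr1n. Qed.

(* The [k]-th factor of [psi_l x / psi_l a], before raising to the [k]-th digit of [l]. *)
Definition char_ratio (x a k : nat) : R[i] :=
  unit_root m k (vdigit m x k) * (unit_root m k (vdigit m a k))^*.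

Lemma char_ratio_expr x a k : char_ratio x a k ^+ m k = 1.
Proof.
by rewrite /char_ratio exprMn -rmorphXn /= !unit_root_expr ?(radix_gt0 hm) // rmorph1 mulr1.
Qed.

Lemma char_ratio_eq1 x a k : (char_ratio x a k == 1) = (vdigit m x k == vdigit m a k).
Proof.
have h t : unit_root m k t * (unit_root m k t)^* = 1 :> R[i].
  by rewrite -normCK norm_unit_root expr1n.
rewrite /char_ratio; apply/eqP/eqP => [e|->]; last exact: h.
apply: (@unit_root_inj R m k); [exact: vdigit_lt..|].
have n0 : (unit_root m k (vdigit m a k))^* != 0 :> R[i].
  by rewrite conjC_eq0 /unit_root cis_neq0.
by apply: (mulIf n0); rewrite h.
Qed.

Lemma vchar_ratio L n x a :
  vchar m L n x * (vchar m L n a)^* = digit_char m (char_ratio x a) L n :> R[i].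
Proof.
rewrite /vchar /digit_char rmorph_prod -big_split /=; apply: eq_bigr => k _.
by rewrite /char_ratio exprMn rmorphXn.
Qed.

Lemma trivial_upto_ratio x a j : trivial_upto (char_ratio x a) j = (x == a %[mod vbase m j]).
Proof.
apply/forallP/eqP => [h|/(eq_vdigitP hm) h k].
  apply/(eq_vdigitP hm) => k kj; apply/eqP; rewrite -char_ratio_eq1.
  exact: h (Ordinal kj).
by rewrite char_ratio_eq1 h.
Qed.

(* The conditional expectation onto functions of the first [j] coordinates. *)
Definition vcond (L j : nat) (F : nat -> X) (x : nat) : X :=
  (((vbase m j)%:R / (vbase m L)%:R : R)%:C)%C *:
    \sum_(a < vbase m L | x == a %[mod vbase m j]) F a.

(** Written as integration against [M_j] times the indicator of [x = a] modulo [M_j], the form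
    supplied by the Dirichlet kernel. *)
Lemma vcond_sum L j F x : vcond L j F x = (((vbase m L)%:R^-1 : R)%:C)%C *:
  \sum_(a < vbase m L) ((vbase m j)%:R *+ (x == a %[mod vbase m j])) *: F a.
Proof.
rewrite /vcond mulrC rmorphM /= -scalerA; congr (_ *: _).
rewrite big_mkcond scaler_sumr; apply: eq_bigr => a _; rewrite rmorph_nat.
by case: eqP => _; rewrite ?mulr1n // mulr0n scale0r scaler0.
Qed.

(** At the pair [(x, a)] the Dirichlet kernel carries the factor [psi_n(x)] times the conjugate of
    [psi_n(a)]; the modulation of [F] cancels the latter, leaving a factor independent of [a]. *)
Lemma partial_sum_top_digits L S F x : let n := top_digits m S L in
  \sum_(l < n) vchar m L l x *: vhat m L (fun a => vchar m L n a *: F a) l =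
  vchar m L n x *: \sum_(j < L | S j) (vcond L j.+1 F x - vcond L j F x).
Proof.
move=> n.
have -> : \sum_(l < n) vchar m L l x *: vhat m L (fun a => vchar m L n a *: F a) l =
  (((vbase m L)%:R^-1 : R)%:C)%C *: \sum_(a < vbase m L)
    (vchar m L n a * \sum_(l < n) vchar m L l x * (vchar m L l a)^*) *: F a.
  rewrite /vhat; under eq_bigr => l _ do rewrite scalerA mulrC -scalerA scaler_sumr.
  rewrite -scaler_sumr exchange_big /=; congr (_ *: _); apply: eq_bigr => a _.
  rewrite mulr_sumr scaler_suml; apply: eq_bigr => l _.
  by rewrite !scalerA; congr (_ *: _); ring.
have E (a : nat) : vchar m L n a * \sum_(l < n) vchar m L l x * (vchar m L l a)^* =
  vchar m L n x * \sum_(j < L | S j) ((vbase m j.+1)%:R *+ (x == a %[mod vbase m j.+1]) -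
     (vbase m j)%:R *+ (x == a %[mod vbase m j])) :> R[i].
  under eq_bigr => l _ do rewrite vchar_ratio.
  rewrite dirichlet_top_digits //; last exact: char_ratio_expr.
  rewrite -vchar_ratio mulrA [_ * (_ * _^*)]mulrCA vchar_conj_mul mulr1; congr (_ * _).
  by apply: eq_bigr => j _; rewrite !trivial_upto_ratio.
under eq_bigr => a _ do rewrite E -scalerA.
rewrite -scaler_sumr scalerA mulrC -scalerA; congr (_ *: _).
under [RHS]eq_bigr => j _ do rewrite !vcond_sum -scalerBr.
rewrite -scaler_sumr; congr (_ *: _).
under eq_bigr => a _ do rewrite scaler_suml.
rewrite exchange_big /=; apply: eq_bigr => j _.
by rewrite -sumrB; apply: eq_bigr => a _; rewrite scalerBl.
Qed.

Lemma rnorm_vchar L n a (v : X) : rnorm (vchar m L n a *: v) = rnorm v.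
Proof. by rewrite rnormZ norm_vchar /= mul1r. Qed.

Variable mu : probability (vilenkin m) R.
Hypothesis hmu : normalized_haar mu.

Lemma vilenkin_unconditional (p : R) : 0 < p -> LPR_eq mu p X \/ LPR_eq_oplus mu p X ->
  exists K : R, 0 <= K /\ forall L (S : pred nat) (F : nat -> X),
    vmean m L (fun x => rnorm (\sum_(j < L | S j) (vcond L j.+1 F x - vcond L j F x)) `^ p)
    <= K * vmean m L (fun x => rnorm (F x) `^ p).
Proof.
move=> p0 /(finite_LPR hm hmu p0)[K [K0 hK]]; exists K; split=> // L S F.
pose n := top_digits m S L.
have [h _] := hK L (fun a => vchar m L n a *: F a).
have := h n (ltnW (top_digits_lt hm S L)).
rewrite /vmean.
under eq_bigr => x _ do rewrite partial_sum_top_digits rnorm_vchar.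
by under [X in _ <= _ * (_ * X) -> _]eq_bigr => x _ do rewrite rnorm_vchar.
Qed.

Lemma sum_fiber L j (F : nat -> X) x : (j <= L)%N ->
  \sum_(a < vbase m L | x == a %[mod vbase m j]) F a =
  \sum_(u < vbase m L %/ vbase m j) F (x %% vbase m j + u * vbase m j)%N.
Proof.
move=> jL; have M0 := vbase_gt0 hm j; set M := vbase m j in M0 *.
have E : vbase m L = (vbase m L %/ M * M)%N by rewrite divnK // vbase_dvd.
rewrite big_mkcond -(big_mkord xpredT (fun a => if x == a %[mod M] then F a else 0)) {1}E
  big_mkord.
rewrite (big_ord_mul M _ (fun a => if x == a %[mod M] then F a else 0)).
apply: eq_bigr => u _.
have xM : (x %% M < M)%N by rewrite ltn_mod.
rewrite (bigD1 (Ordinal xM)) //= addnC modnMDl modn_mod eqxx big1 ?addr0 // => b bx.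
rewrite addnC modnMDl (modn_small (ltn_ord b)) ifN //.
by apply: contra bx => /eqP h; apply/eqP/val_inj.
Qed.

End VilenkinUnconditional.

(** * Random signs *)

Section RandomSigns.
Context {R : realType} {J : finType}.
Implicit Types (d : {ffun J -> bool}) (s : J).

Definition flip_sign s d : {ffun J -> bool} := [ffun t => (t == s) (+) d t].

Lemma flip_signK s : involutive (flip_sign s).
Proof. by move=> d; apply/ffunP => t; rewrite !ffunE addKb. Qed.

Lemma sum_flip (V : nmodType) s (f : {ffun J -> bool} -> V) :
  \sum_d f (flip_sign s d) = \sum_d f d.
Proof. by rewrite [RHS](reindex_inj (inv_inj (flip_signK s))). Qed.

(** Averaging over the [s]-th sign alone kills the terms that are odd in it, which permits induction
    on the list of signs. *)
Lemma sum_flip2 s (f : {ffun J -> bool} -> R) :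
  \sum_d f d = \sum_d (f d + f (flip_sign s d)) / 2.
Proof. by rewrite -mulr_suml big_split /= sum_flip; field. Qed.

Lemma flip_sign_eq s d : flip_sign s d s = ~~ d s.
Proof. by rewrite ffunE eqxx. Qed.

Lemma flip_sign_neq s t d : t != s -> flip_sign s d t = d t.
Proof. by move=> ts; rewrite ffunE (negbTE ts). Qed.

Lemma flip_sum (V : lmodType R) (s : J) (l : seq J) (x : J -> V) d : s \notin l ->
  \sum_(t <- l) (-1) ^+ flip_sign s d t *: x t = \sum_(t <- l) (-1) ^+ d t *: x t.
Proof.
move=> sl; apply: eq_big_seq => t tl; rewrite flip_sign_neq //.
by apply: contraNneq sl => <-.
Qed.

Variables (a b : J -> R).

(** The squared modulus of a signed sum of complex numbers with real parts [a] and imaginary parts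
    [b]. *)
Let sq (l : seq J) d : R :=
  (\sum_(t <- l) (-1) ^+ d t * a t) ^+ 2 + (\sum_(t <- l) (-1) ^+ d t * b t) ^+ 2.

Let var (l : seq J) : R := \sum_(t <- l) (a t ^+ 2 + b t ^+ 2).

Let sq_cons s l d : s \notin l ->
  (sq (s :: l) d + sq (s :: l) (flip_sign s d)) / 2 = sq l d + (a s ^+ 2 + b s ^+ 2).
Proof.
move=> sl; rewrite /sq !big_cons flip_sign_eq.
have Ha := @flip_sum R^o s l a d sl; have Hb := @flip_sum R^o s l b d sl.
rewrite /GRing.scale /= in Ha Hb; rewrite Ha Hb.
by case: (d s) => /=; rewrite ?expr1 ?expr0; field.
Qed.

Let sq2_cons s l d : s \notin l ->
  (sq (s :: l) d ^+ 2 + sq (s :: l) (flip_sign s d) ^+ 2) / 2 <=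
  sq l d ^+ 2 + 6 * (a s ^+ 2 + b s ^+ 2) * sq l d + (a s ^+ 2 + b s ^+ 2) ^+ 2.
Proof.
move=> sl; rewrite /sq !big_cons flip_sign_eq.
have Ha := @flip_sum R^o s l a d sl; have Hb := @flip_sum R^o s l b d sl.
rewrite /GRing.scale /= in Ha Hb; rewrite Ha Hb.
set S := \sum_(t <- l) _ * a t; set T := \sum_(t <- l) _ * b t.
(* Cauchy-Schwarz for the squared cross term, which adds [4] to the coefficient [2] of the mixed
   product and gives the [6]. *)
have cs : 0 <= (a s * T - b s * S) ^+ 2 by exact: sqr_ge0.
by case: (d s) => /=; rewrite ?expr1 ?expr0; nra.
Qed.

Lemma sign_second_moment (l : seq J) : uniq l ->
  \sum_d sq l d = #|{ffun J -> bool}|%:R * var l.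
Proof.
elim: l => [_|s l IH /= /andP[sl ul]].
  rewrite /var big_nil mulr0 big1 // => d _; rewrite /sq !big_nil; ring.
rewrite (sum_flip2 s); under eq_bigr => d _ do rewrite sq_cons //.
rewrite big_split /= IH // sumr_const /var big_cons -[X in _ + X]mulr_natl; ring.
Qed.

(** The constant [3] is propagated by [3 V ^ 2 + 6 A V + A ^ 2 <= 3 (V + A) ^ 2], where [A] is the
    variance of the added term. *)
Lemma sign_fourth_moment (l : seq J) : uniq l ->
  \sum_d sq l d ^+ 2 <= #|{ffun J -> bool}|%:R * (3 * var l ^+ 2).
Proof.
elim: l => [_|s l IH /= /andP[sl ul]].
  rewrite /var big_nil expr0n !mulr0 big1 // => d _; rewrite /sq !big_nil; ring.
rewrite (sum_flip2 s).
apply: le_trans (ler_sum _ (fun d _ => sq2_cons d sl)) _.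
rewrite !big_split /= -mulr_sumr sign_second_moment // sumr_const /var big_cons -/(var l).
have := IH ul; set A := \sum_d _; set N := #|_|; set al := a s ^+ 2 + b s ^+ 2 => hA.
move: al => al; rewrite -(mulr_natl (al ^+ 2)).
have : 0 <= (N%:R : R) * al ^+ 2 by rewrite mulr_ge0 ?ler0n ?sqr_ge0.
have E : 3 * (al + var l) ^+ 2 = 3 * var l ^+ 2 + 6 * al * var l + 3 * al ^+ 2 by ring.
rewrite E !mulrDr => h.
have E2 : 6 * al * (N%:R * var l) = N%:R * (6 * al * var l) by ring.
have E3 : N%:R * (3 * al ^+ 2) = 3 * (N%:R * al ^+ 2) by ring.
rewrite E2 E3; lra.
Qed.

End RandomSigns.

(** * The lower Khintchine inequality *)

Section Khintchine.
Context {R : realType} {J : finType}.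

Definition cmod (z : R[i]) : R := complex.Re `|z|.

Lemma cmodE z : cmod z = Num.sqrt (complex.Re z ^+ 2 + complex.Im z ^+ 2).
Proof. by rewrite /cmod normc_def. Qed.

Lemma cmod_ge0 z : 0 <= cmod z.
Proof. by rewrite cmodE sqrtr_ge0. Qed.

Lemma cmod_sqr z : cmod z ^+ 2 = complex.Re z ^+ 2 + complex.Im z ^+ 2.
Proof. by rewrite cmodE sqr_sqrtr // addr_ge0 ?sqr_ge0. Qed.

(* [t ^ 2 <= 3 s t + t ^ 4 / (9 s ^ 2)] trades the second and fourth moments for the first. *)
Lemma khintchine_L1 (a : J -> R[i]) (tau : R) : 0 <= tau ->
  tau ^+ 2 <= \sum_j cmod (a j) ^+ 2 ->
  2 / 9 * tau <= #|{ffun J -> bool}|%:R^-1 *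
    \sum_(d : {ffun J -> bool}) cmod (\sum_j (-1) ^+ d j * a j).
Proof.
move=> tau0; set s2 := \sum_j _ => ht.
have s20 : 0 <= s2 by apply: le_trans ht; exact: sqr_ge0.
set sg := Num.sqrt s2.
have sg2 : sg ^+ 2 = s2 by rewrite sqr_sqrtr.
have sg0 : 0 <= sg by rewrite sqrtr_ge0.
have tsg : tau <= sg by rewrite -(ger0_norm tau0) -sqrtr_sqr ler_wsqrtr.
set N : R := #|_|%:R.
have N0 : 0 < N by rewrite ltr0n; apply/card_gt0P; exists [ffun=> false].
set E := \sum_d _.
have E0 : 0 <= E by apply: sumr_ge0 => d _; exact: cmod_ge0.
have ReS (z : J -> R[i]) (d : {ffun J -> bool}) :
    complex.Re (\sum_j (-1) ^+ d j * z j) = \sum_j (-1) ^+ d j * complex.Re (z j).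
  rewrite (raddf_sum (@complex.Re R : Rcomplex R -> R)) /=; apply: eq_bigr => j _.
  by case: (d j); rewrite ?expr1 ?expr0 ?mul1r ?mulN1r //; case: (z j).
have ImS (z : J -> R[i]) (d : {ffun J -> bool}) :
    complex.Im (\sum_j (-1) ^+ d j * z j) = \sum_j (-1) ^+ d j * complex.Im (z j).
  rewrite (raddf_sum (@complex.Im R : Rcomplex R -> R)) /=; apply: eq_bigr => j _.
  by case: (d j); rewrite ?expr1 ?expr0 ?mul1r ?mulN1r //; case: (z j).
pose q (d : {ffun J -> bool}) := cmod (\sum_j (-1) ^+ d j * a j).
have q2 d : q d ^+ 2 = (\sum_(j <- index_enum J) (-1) ^+ d j * complex.Re (a j)) ^+ 2 +
                       (\sum_(j <- index_enum J) (-1) ^+ d j * complex.Im (a j)) ^+ 2.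
  by rewrite /q cmod_sqr ReS ImS.
have s2E : s2 = \sum_(j <- index_enum J) (complex.Re (a j) ^+ 2 + complex.Im (a j) ^+ 2).
  by apply: eq_bigr => j _; rewrite cmod_sqr.
have M2 : \sum_d q d ^+ 2 = N * s2.
  under eq_bigr do rewrite q2.
  by rewrite (@sign_second_moment R J _ _ _ (index_enum_uniq J)) s2E.
have M4 : \sum_d (q d ^+ 2) ^+ 2 <= N * (3 * s2 ^+ 2).
  under eq_bigr do rewrite q2.
  by rewrite s2E; exact: (@sign_fourth_moment R J _ _ _ (index_enum_uniq J)).
(* For [q <= 3 sg] the first term on the right suffices, otherwise the second. In the mean,
   [9 sg ^ 4 <= 27 sg ^ 3 E q + 3 sg ^ 4], whence the constant [6 / 27 = 2 / 9]. *)
have pt d : 9 * sg ^+ 2 * q d ^+ 2 <= 27 * sg ^+ 3 * q d + (q d ^+ 2) ^+ 2.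
  have q0 : 0 <= q d by exact: cmod_ge0.
  case: (lerP (q d) (3 * sg)) => h.
    have h1 : 0 <= sg ^+ 2 * q d * (3 * sg - q d).
      by rewrite mulr_ge0 ?subr_ge0 // mulr_ge0 // sqr_ge0.
    have h2 : 0 <= (q d ^+ 2) ^+ 2 by exact: sqr_ge0.
    rewrite (_ : 9 * _ * _ = 27 * sg ^+ 3 * q d - 9 * (sg ^+ 2 * q d * (3 * sg - q d)));
      last by ring.
    lra.
  have h1 : 0 <= (q d) ^+ 2 * (q d - 3 * sg) * (q d + 3 * sg).
    by rewrite !mulr_ge0 ?sqr_ge0 ?subr_ge0 ?addr_ge0 ?mulr_ge0 // ltW.
  have h2 : 0 <= 27 * sg ^+ 3 * q d by rewrite !mulr_ge0 ?exprn_ge0.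
  rewrite (_ : (q d ^+ 2) ^+ 2 = 9 * sg ^+ 2 * q d ^+ 2 + (q d) ^+ 2 * (q d - 3 * sg) * (q d + 3
    * sg)); last by ring.
  lra.
have := ler_sum (index_enum {ffun J -> bool}) (fun d (_ : xpredT d) => pt d).
rewrite big_split /= -!mulr_sumr M2 -/E => h.
have {}h : 9 * sg ^+ 2 * (N * s2) <= 27 * sg ^+ 3 * E + N * (3 * s2 ^+ 2).
  by apply: le_trans h _; rewrite lerD2l.
have h6 : 6 * N * sg ^+ 4 <= 27 * sg ^+ 3 * E.
  have e1 : 9 * sg ^+ 2 * (N * s2) = 9 * N * sg ^+ 4 by rewrite -sg2; ring.
  have e2 : N * (3 * s2 ^+ 2) = 3 * N * sg ^+ 4 by rewrite -sg2; ring.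
  by move: h; rewrite e1 e2; lra.
apply: (@le_trans _ _ (2 / 9 * sg)); first by rewrite ler_pM2l // divr_gt0.
have [->|sgn] := eqVneq sg 0; first by rewrite mulr0 mulr_ge0 // invr_ge0 ltW.
have sgp : 0 < sg by rewrite lt_neqAle eq_sym sgn.
rewrite ler_pdivlMl //.
rewrite -(@ler_pM2l _ (27 * sg ^+ 3)); last by rewrite mulr_gt0 // exprn_gt0.
by apply: le_trans h6; rewrite le_eqVlt; apply/orP; left; apply/eqP; field.
Qed.

End Khintchine.

(** * The contraction principle *)

Section Contraction.
Context {R : realType} {X : normedModType R[i]} {J : finType}.
Implicit Types (x : J -> X).

Lemma jensen_rnorm (I : finType) (w : I -> R) (v : I -> X) p : 1 <= p ->
  (forall i, 0 <= w i) -> \sum_i w i = 1 ->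
  rnorm (\sum_i ((w i)%:C)%C *: v i) `^ p <= \sum_i w i * rnorm (v i) `^ p.
Proof.
move=> p1 w0 w1; have p0 : 0 <= p by lra.
apply: le_trans (jensen_powR p1 w0 w1 (fun i => rnorm_ge0 (v i))).
apply: ge0_ler_powR => //; rewrite ?nnegrE ?rnorm_ge0 //.
  by apply: sumr_ge0 => i _; rewrite mulr_ge0 ?rnorm_ge0.
apply: le_trans (ler_rnorm_sum _ _ _) _; apply: ler_sum => i _.
by rewrite rnormZr ger0_norm.
Qed.

Definition sign_sum p x : R :=
  \sum_(d : {ffun J -> bool}) rnorm (\sum_j (-1) ^+ d j *: x j) `^ p.

(** A factor [t] in [[-1, 1]] is the convex combination of [1] and [-1] with weights [(1 + t) / 2]
    and [(1 - t) / 2], and changing the sign of one vector preserves the sum over all patterns. *)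
Lemma sign_sum_scale1 p x s (t : R) : 1 <= p -> `|t| <= 1 ->
  sign_sum p (fun j => if j == s then (t%:C)%C *: x j else x j) <= sign_sum p x.
Proof.
move=> p1; rewrite ler_norml => /andP[t1 t2].
rewrite [leRHS](_ : _ = \sum_(d : {ffun J -> bool})
   ((1 + t) / 2 * rnorm (\sum_j (-1) ^+ d j *: x j) `^ p +
    (1 - t) / 2 * rnorm (\sum_j (-1) ^+ flip_sign s d j *: x j) `^ p)); last first.
  rewrite big_split /= -!mulr_sumr.
  rewrite (sum_flip s (fun d => rnorm (\sum_j (-1) ^+ d j *: x j) `^ p)).
  by rewrite -/(sign_sum p x); field.
apply: ler_sum => d _.
have := @jensen_rnorm bool (fun b => if b then (1 + t) / 2 else (1 - t) / 2)
  (fun b => if b then \sum_j (-1) ^+ d j *: x j else \sum_j (-1) ^+ flip_sign s d j *: x j) p p1.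
rewrite !big_bool /= => h; apply: le_trans (h _ _); last 2 first.
- by case; lra.
- by field.
rewrite !scaler_sumr -big_split /= le_eqVlt; apply/orP; left; apply/eqP.
congr (rnorm _ `^ _); apply: eq_bigr => j _.
case: eqP => [->|/eqP js]; rewrite !scalerA; last first.
  rewrite flip_sign_neq // -scalerDl -mulrDl -rmorphD /=.
  by rewrite (_ : (1 + t) / 2 + (1 - t) / 2 = 1) ?mul1r //; field.
rewrite flip_sign_eq -scalerDl; congr (_ *: _).
have -> : (t%:C)%C = (((1 + t) / 2)%:C - ((1 - t) / 2)%:C)%C :> R[i].
  by rewrite -rmorphB /=; congr (_%:C)%C; field.
by case: (d s) => /=; rewrite ?expr1 ?expr0; ring.
Qed.

(** Kahane's contraction principle, one coefficient at a time along an enumeration of [J]. *)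
Lemma real_contraction p x (t : J -> R) : 1 <= p -> (forall j, `|t j| <= 1) ->
  sign_sum p (fun j => ((t j)%:C)%C *: x j) <= sign_sum p x.
Proof.
move=> p1 ht.
have h (l : seq J) : uniq l ->
    sign_sum p (fun j => if j \in l then ((t j)%:C)%C *: x j else x j) <= sign_sum p x.
  elim: l => [_|s l IH /= /andP[sl ul]]; first by [].
  apply: le_trans (IH ul).
  apply: le_trans (sign_sum_scale1 _ s p1 (ht s)).
  rewrite le_eqVlt; apply/orP; left; apply/eqP; rewrite /sign_sum; apply: eq_bigr => d _.
  congr (rnorm _ `^ _); apply: eq_bigr => j _; congr (_ *: _); rewrite inE.
  by case: eqP => [->|] //=; rewrite (negbTE sl).
apply: le_trans (h (index_enum J) (index_enum_uniq J)).
rewrite le_eqVlt; apply/orP; left; apply/eqP; rewrite /sign_sum; apply: eq_bigr => d _.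
by congr (rnorm _ `^ _); apply: eq_bigr => j _; rewrite mem_index_enum.
Qed.

(** Real and imaginary parts are contracted separately, the factor [i] being invisible to the norm;
    the triangle inequality for two terms costs [2 ^ p] and there are two sums. *)
Lemma complex_contraction p x (a : J -> R[i]) : 1 <= p -> (forall j, cmod (a j) <= 1) ->
  sign_sum p (fun j => a j *: x j) <= 2 `^ p * (2 * sign_sum p x).
Proof.
move=> p1 ha.
have sqr1 (u v : R) : u ^+ 2 + v ^+ 2 <= 1 -> `|u| <= 1.
  move=> h; rewrite -(@ler_pXn2r _ 2) ?nnegrE // expr1n -normrX ger0_norm ?sqr_ge0 //.
  by apply: le_trans h; rewrite lerDl sqr_ge0.
have ha2 j : complex.Re (a j) ^+ 2 + complex.Im (a j) ^+ 2 <= 1.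
  by rewrite -cmod_sqr expr_le1 ?cmod_ge0.
have h1 := real_contraction x p1 (fun j => sqr1 _ _ (ha2 j)).
have h2 : sign_sum p (fun j => ((complex.Im (a j))%:C)%C *: ('i%C *: x j)) <= sign_sum p x.
  have ha2' j : complex.Im (a j) ^+ 2 + complex.Re (a j) ^+ 2 <= 1 by rewrite addrC.
  apply: le_trans (real_contraction (fun j => 'i%C *: x j) p1 (fun j => sqr1 _ _ (ha2' j))) _.
  rewrite le_eqVlt; apply/orP; left; apply/eqP; rewrite /sign_sum; apply: eq_bigr => d _.
  under eq_bigr => j _ do rewrite scalerA mulrC -scalerA.
  by rewrite -scaler_sumr rnormZ normc_def /= expr0n add0r expr1n sqrtr1 mul1r.
apply: (@le_trans _ _ (2 `^ p * (sign_sum p (fun j => ((complex.Re (a j))%:C)%C *: x j) +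
   sign_sum p (fun j => ((complex.Im (a j))%:C)%C *: ('i%C *: x j))))); last first.
  rewrite ler_wpM2l ?powR_ge0 //; lra.
rewrite /sign_sum -big_split /= mulr_sumr; apply: ler_sum => d _.
apply: le_trans (ler_powRD p1 (rnorm_ge0 _) (rnorm_ge0 _)).
apply: ge0_ler_powR; rewrite ?nnegrE ?addr_ge0 ?rnorm_ge0 //; first by lra.
rewrite (_ : \sum_j _ *: (a j *: x j) = \sum_j (-1) ^+ d j *: (((complex.Re (a j))%:C)%C *: x j) +
  \sum_j (-1) ^+ d j *: (((complex.Im (a j))%:C)%C *: ('i%C *: x j))); first exact: ler_rnormD.
rewrite -big_split /=; apply: eq_bigr => j _.
rewrite -scalerDr; congr (_ *: _); rewrite scalerA -scalerDl; congr (_ *: _).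
by rewrite {1}[a j]complexE [('i)%C * _]mulrC.
Qed.

End Contraction.

(** * Type 2 *)

(** Cuts the integers below the total of [c] into consecutive runs, with [c j] of them sent to [j].
    It yields both the sets [B_j] and the transitions of the simulated trees. *)
Definition fiber_map (J : finType) (j0 : J) (c : J -> nat) (a : nat) : J :=
  nth j0 (flatten [seq nseq (c j) j | j <- enum J]) a.

Lemma sum_fiber_map (J : finType) (j0 : J) (c : J -> nat) (V : nmodType) (G : J -> V) M :
  (\sum_j c j)%N = M -> \sum_(a < M) G (fiber_map j0 c a) = \sum_j G j *+ c j.
Proof.
set l := flatten [seq nseq (c j) j | j <- enum J] => hM.
have sl : size l = M.
  rewrite size_flatten /shape -map_comp sumnE big_map -hM big_enum /=.
  by apply: eq_bigr => j _; rewrite /= size_nseq.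
have -> : \sum_(a < M) G (fiber_map j0 c a) = \sum_(i <- l) G i.
  by rewrite (big_nth j0) sl big_mkord.
rewrite big_flatten big_map big_enum /=; apply: eq_bigr => j _.
by rewrite big_nseq iter_addr_0.
Qed.

Section Type2.
Context {R : realType} {X : completeNormedModType R[i]}.
Variable m : nat -> nat.
Hypothesis hm : forall k, (2 <= m k)%N.

Lemma cmod_norm (z : R[i]) : ((cmod z)%:C)%C = `|z|.
Proof. by rewrite /cmod RRe_real ?normr_real. Qed.

Lemma cmod_vcharM L n a (z : R[i]) : cmod (vchar m L n a * z) = cmod z.
Proof. by rewrite /cmod normrM norm_vchar mul1r. Qed.

(** After expanding the square, the sum over [s] is a full Dirichlet kernel at two codes below
    [M_L], which vanishes unless they coincide. *)
Lemma plancherel_indic L (B : pred 'I_(vbase m L)) :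
  \sum_(s < vbase m L) cmod ((((vbase m L)%:R^-1 : R)%:C)%C * 
     \sum_(a < vbase m L | B a) (vchar m L s a)^*) ^+ 2 =
  (vbase m L)%:R^-1 * #|B|%:R :> R.
Proof.
set M := vbase m L; apply: (@complexI R); rewrite rmorph_sum /=.
have M0 : (M%:R : R[i]) != 0 by rewrite pnatr_eq0 -lt0n vbase_gt0.
have hc : ((M%:R^-1 : R)%:C)%C = M%:R^-1 :> R[i] by rewrite fmorphV rmorph_nat.
have E (s : nat) : ((cmod (((M%:R^-1 : R)%:C)%C * \sum_(a < M | B a) (vchar m L s a)^*) ^+
  2)%:C)%C =
    M%:R^-1 ^+ 2 * \sum_(a < M | B a) \sum_(b < M | B b)
    vchar m L s b * (vchar m L s a)^* :> R[i].
  rewrite rmorphXn /= cmod_norm normCK hc rmorphM fmorphV rmorph_nat mulrACA -expr2.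
  congr (_ * _); rewrite rmorph_sum /= mulr_suml; apply: eq_bigr => a _.
  by rewrite mulr_sumr; apply: eq_bigr => b _; rewrite conjCK mulrC.
rewrite (eq_bigr _ (fun (s : 'I_M) _ => E s)).
rewrite -mulr_sumr exchange_big /=.
rewrite (_ : \sum_(a | B a) _ = \sum_(a | B a) (M%:R : R[i])); last first.
  apply: eq_bigr => a Ba; rewrite exchange_big /= (bigD1 a) //= [X in _ + X]big1 ?addr0.
    rewrite (eq_bigr (fun=> 1)) => [|s _]; last exact: vchar_conj_mul.
    by rewrite sumr_const card_ord.
  move=> b /andP[_ ba].
  rewrite (eq_bigr _ (fun (s : 'I_M) _ => vchar_ratio m L s b a)).
  rewrite sum_digit_char //; last exact: char_ratio_expr.
  by rewrite trivial_upto_ratio // !modn_small ?ltn_ord // val_eqE (negbTE ba).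
rewrite sumr_const rmorphM fmorphV !rmorph_nat expr2 -mulrA -(mulr_natr (M%:R)) mulKf //.
Qed.

Lemma sign_sumZ (J : finType) p (c : R) (x : J -> X) : 
  sign_sum p (fun j => (c%:C)%C *: x j) = `|c| `^ p * sign_sum p x.
Proof.
rewrite /sign_sum mulr_sumr; apply: eq_bigr => d _.
rewrite -powRM ?rnorm_ge0 //; congr (_ `^ _).
under eq_bigr => j _ do rewrite scalerA mulrC -scalerA.
by rewrite -scaler_sumr rnormZr.
Qed.

(* The signs of the amplitudes [e j = E |g j|] are decoupled from [g] by averaging over
   independent signs, so that no Gaussian comparison is needed. *)
Lemma sign_sum_mean_le (J K : finType) p (a : K -> J -> R[i]) (x y : J -> X)
    (e kap : J -> R) : 1 <= p ->
  (forall j, e j = #|{ffun K -> bool}|%:R^-1 *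
      \sum_(d : {ffun K -> bool}) cmod (\sum_s (-1) ^+ d s * a s j)) ->
  (forall j, 0 <= kap j <= 9) ->
  (forall j, y j = ((kap j)%:C)%C *: (((e j)%:C)%C *: x j)) ->
  sign_sum p y <= 9 `^ p * (#|{ffun K -> bool}|%:R^-1 * \sum_(d : {ffun K -> bool})
     2 `^ p * (2 * sign_sum p (fun j => (\sum_s (-1) ^+ d s * a s j) *: x j))).
Proof.
move=> p1 he hk hy; have p0 : 0 <= p by lra.
set N : R := #|_|%:R; have N0 : 0 < N by rewrite ltr0n; apply/card_gt0P; exists [ffun=> false].
pose g (d : {ffun K -> bool}) j := \sum_s (-1) ^+ d s * a s j.
have -> : y = fun j => (9%:C)%C *: (((kap j / 9)%:C)%C *: (((e j)%:C)%C *: x j)).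
  apply/funext => j; rewrite hy [RHS]scalerA -rmorphM /=; congr ((_%:C)%C *: _); by field.
rewrite sign_sumZ ger0_norm // ler_wpM2l ?powR_ge0 //.
apply: le_trans (real_contraction _ p1 _) _.
  move=> j; have /andP[k0 k9] := hk j.
  by rewrite ger0_norm ?divr_ge0 // ler_pdivrMr // mul1r.
(* Jensen over the signs [d]: the amplitude [e j] is the mean of [|g d j|]. *)
apply: (@le_trans _ _ (N^-1 * \sum_(d : {ffun K -> bool})
    sign_sum p (fun j => ((cmod (g d j))%:C)%C *: x j))).
  rewrite mulr_sumr /sign_sum.
  under [leRHS]eq_bigr => d _ do rewrite mulr_sumr.
  rewrite exchange_big /=; apply: ler_sum => D _.
  apply: le_trans (@jensen_rnorm _ _ _ (fun=> N^-1)
    (fun d => \sum_j (-1) ^+ D j *: (((cmod (g d j))%:C)%C *: x j)) p p1 _ _); last 2 first.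
  - by move=> d; rewrite invr_ge0 ltW.
  - by rewrite sumr_const -mulr_natr mulVf ?gt_eqF.
  rewrite le_eqVlt; apply/orP; left; apply/eqP; congr (rnorm _ `^ _).
  rewrite -scaler_sumr exchange_big /= scaler_sumr; apply: eq_bigr => j _.
  rewrite -scaler_sumr [RHS]scalerA mulrC -[RHS]scalerA; congr (_ *: _).
  by rewrite -scaler_suml scalerA -rmorph_sum -rmorphM he.
rewrite ler_wpM2l ?invr_ge0 ?(ltW N0) //; apply: ler_sum => d _.
(* The quotient [|g| / g] has modulus one, or is zero when [g = 0], so contraction replaces [|g|] by
   [g]. *)
have -> : (fun j => ((cmod (g d j))%:C)%C *: x j) =
    (fun j => (((cmod (g d j))%:C)%C / g d j) *: (g d j *: x j)).
  apply/funext => j; rewrite scalerA.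
  have [->|gn] := eqVneq (g d j) 0; last by rewrite divfK.
  by rewrite /cmod normr0 /= mul0r mul0r.
apply: complex_contraction => // j.
have [->|gn] := eqVneq (g d j) 0; first by rewrite invr0 mulr0 /cmod normr0.
by rewrite cmod_norm /cmod normrM normr_id normfV mulfV ?normr_eq0.
Qed.

End Type2.

(** * Proof of type 2 *)

Section Type2Assembly.
Context {R : realType} {X : completeNormedModType R[i]}.
Variable m : nat -> nat.
Hypothesis hm : forall k, (2 <= m k)%N.

(** The shares are rounded up within [M - n] units, the reserve of [n] paying for the rounding, and
    [M - n] is at least [M / 2]. The fraction [1 / 4] is a square, which keeps the later amplitudes
    free of roots. *)
Lemma apportion (n M : nat) (t : 'I_n -> R) : (2 * n <= M)%N -> (forall j, 0 <= t j) ->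
  \sum_j t j = 1 -> exists c : 'I_n -> nat, (\sum_j c j <= M)%N /\
    forall j, t j / 4 <= M%:R^-1 * (c j)%:R.
Proof.
move=> nM t0 t1; exists (fun j => (Num.truncn (t j * (M - n)%:R)).+1); split.
  rewrite -(ler_nat R) natr_sum.
  apply: (@le_trans _ _ (\sum_j (t j * (M - n)%:R + 1))).
    apply: ler_sum => j _; rewrite -natr1 lerD2r truncn_le.
    by rewrite mulr_ge0 ?ler0n.
  rewrite big_split /= -mulr_suml t1 mul1r sumr_const card_ord -natrD subnK //.
  by apply: leq_trans nM; rewrite mul2n -addnn leq_addr.
move=> j; have [M0|M0] := posnP M.
  have n0 : n = 0%N by move: nM; rewrite M0 leqn0 muln_eq0 => /eqP.
  by exfalso; have := leq_ltn_trans (leq0n j) (ltn_ord j); rewrite n0.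
have Mr : (0 : R) < M%:R by rewrite ltr0n.
rewrite ler_pdivlMl //.
apply: (@le_trans _ _ (t j * (M - n)%:R)); last exact/ltW/truncnS_gt.
rewrite mulrCA ler_wpM2l // ler_pdivrMr //.
have -> : (M - n)%:R * 4 = ((M - n) * 4)%:R :> R by rewrite natrM.
rewrite ler_nat; lia.
Qed.

Lemma vmean_ler L (g h : nat -> R) : (forall a, g a <= h a) -> vmean m L g <= vmean m L h.
Proof. by move=> gh; rewrite ler_wpM2l ?invr_ge0 ?ler0n // ler_sum. Qed.

Lemma vmean_cst L (c : R) : vmean m L (fun=> c) = c.
Proof.
rewrite /vmean sumr_const card_ord -(mulr_natl c) mulKf // pnatr_eq0 -lt0n.
exact: vbase_gt0.
Qed.

Lemma exchange_vmean (I : finType) L (g : I -> nat -> R) :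
  \sum_i vmean m L (g i) = vmean m L (fun a => \sum_i g i a).
Proof. by rewrite /vmean -mulr_sumr exchange_big. Qed.

Lemma vmeanZ L (c : R) g : c * vmean m L g = vmean m L (fun a => c * g a).
Proof. by rewrite /vmean mulrCA mulr_sumr. Qed.

Variable mu : probability (vilenkin m) R.
Hypothesis hmu : normalized_haar mu.
Variable p : R.
Hypothesis hp : 2 <= p.

Lemma sign_sum_le_type2 : LPR_eq mu p X \/ LPR_eq_oplus mu p X ->
  exists K : R, 0 <= K /\ forall n (y : 'I_n -> X),
    #|{ffun 'I_n -> bool}|%:R^-1 * sign_sum p y <=
    K * Num.sqrt (\sum_j rnorm (y j) ^+ 2) `^ p.
Proof.
have p0 : 0 < p by exact: lt_le_trans hp.
have p1 : 1 <= p by apply: le_trans hp; rewrite ler1n.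
move=> /(finite_LPR hm hmu p0)[K [K0 hK]].
exists (9 `^ p * (2 `^ p * (2 * K))); split; first by rewrite !mulr_ge0 ?powR_ge0.
move=> n y; set s2 := \sum_j _; set sg := Num.sqrt s2.
have s20 : 0 <= s2 by apply: sumr_ge0 => j _; exact: sqr_ge0.
have [s0|s0] := eqVneq s2 0.
  have y0 j : y j = 0.
    apply: rnorm_eq0; apply/eqP; rewrite -sqrf_eq0; apply/eqP.
    by apply: (psumr_eq0P (F := fun i => rnorm (y i) ^+ 2) _ s0) => // i _; exact: sqr_ge0.
  rewrite /sign_sum big1 ?mulr0 ?mulr_ge0 ?powR_ge0 // => d _.
  by rewrite big1 ?rnorm0 ?powR0 ?gt_eqF // => j _; rewrite y0 scaler0.
have s2p : 0 < s2 by rewrite lt_neqAle eq_sym s0.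
have sgp : 0 < sg by rewrite sqrtr_gt0.
have sg2 : sg ^+ 2 = s2 by rewrite sqr_sqrtr.
(* [M_L > L = 2 n] gives the room needed for rounding. *)
pose L := (2 * n)%N; set M := vbase m L.
have nM : (2 * n <= M)%N by apply: ltnW; exact: ltn_vbase.
have M0 : (0 < M)%N by exact: vbase_gt0.
pose t j := rnorm (y j) ^+ 2 / s2.
have [c [cM hc]] : exists c : 'I_n -> nat, (\sum_j c j <= M)%N /\
    forall j, t j / 4 <= M%:R^-1 * (c j)%:R.
  apply: apportion => // [j|]; first by rewrite divr_ge0 ?sqr_ge0.
  by rewrite -mulr_suml divff.
(* The label [None] collects the points outside all [B_j], where the test function is zero. *)
pose c' (o : option 'I_n) := if o is Some j then c j else (M - \sum_j c j)%N.
have c'M : (\sum_o c' o)%N = M.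
  rewrite (bigD1 None) //= (reindex_omap Some id) /=; last by case.
  rewrite [X in (_ + X)%N](eq_bigl xpredT) => [|j]; last by rewrite /= eqxx.
  by rewrite /c' subnK.
pose tau := fiber_map None c'.
(* The norm of [x j] is [sg], except that [x j = 0] when [y j = 0]. *)
pose x j := ((sg / rnorm (y j))%:C)%C *: y j.
have rx j : rnorm (x j) <= sg.
  rewrite rnormZr ger0_norm ?divr_ge0 ?rnorm_ge0 ?(ltW sgp) //.
  have [->|r0] := eqVneq (rnorm (y j)) 0; first by rewrite mulr0 ltW.
  by rewrite divfK.
pose F (d : {ffun 'I_n -> bool}) a := if tau a is Some j then (-1) ^+ d j *: x j else 0.
have rF d a : rnorm (F d a) <= sg.
  by rewrite /F; case: (tau a) => [j|]; [rewrite rnorm_sign|rewrite rnorm0 ltW].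
(* The Fourier coefficient at [s] of the indicator of [B_j]. *)
pose h (s : nat) (j : 'I_n) : R[i] := ((M%:R^-1 : R)%:C)%C * \sum_(a < M | tau a == Some j)
  (vchar m L s a)^*.
have hF d s : vhat m L (F d) s = \sum_j (-1) ^+ d j *: (h s j *: x j).
  rewrite /vhat -/M.
  have -> : \sum_(a < M) (vchar m L s a)^* *: F d a =
      \sum_(a < M) \sum_j (if tau a == Some j then (vchar m L s a)^* else 0) *: ((-1) ^+ d j *:
        x j).
    apply: eq_bigr => a _; rewrite /F; case: (tau a) => [j|]; last first.
      by rewrite scaler0 big1 // => j _; rewrite scale0r.
    rewrite (bigD1 j) //= eqxx [X in _ + X]big1 ?addr0 // => i ij.
    by rewrite ifN ?scale0r //; apply: contra ij => /eqP[->].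
  rewrite exchange_big /= scaler_sumr; apply: eq_bigr => j _.
  rewrite -scaler_suml !scalerA; congr (_ *: _).
  by rewrite -big_mkcond /= /h; ring.
pose g (a : nat) (s : 'I_M) (j : 'I_n) : R[i] := vchar m L s a * h s j.
have key (d : {ffun 'I_n -> bool}) : 2^-1 ^+ M * \sum_(eps : {ffun 'I_M -> bool}) vmean m L (fun
  a =>
     rnorm (\sum_j (-1) ^+ d j *: ((\sum_s (-1) ^+ eps s * g a s j) *: x j)) `^ p)
     <= K * sg `^ p.
  have [_ h2] := hK L (F d).
  apply: (@le_trans _ _ (K * vmean m L (fun a => rnorm (F d a) `^ p))); last first.
    rewrite ler_wpM2l // -[X in _ <= X](vmean_cst L); apply: vmean_ler => a.
    by apply: ge0_ler_powR; rewrite ?nnegrE ?rnorm_ge0 ?(ltW sgp) ?(ltW p0).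
  apply: le_trans h2; rewrite le_eqVlt; apply/orP; left; apply/eqP.
  congr (_ * _); apply: eq_bigr => eps _; congr (_ * _); apply: eq_bigr => a _.
  congr (rnorm _ `^ _); under [RHS]eq_bigr => s _ do rewrite hF scaler_sumr scaler_sumr.
  rewrite exchange_big /=; apply: eq_bigr => j _.
  rewrite scaler_suml scaler_sumr; apply: eq_bigr => s _.
  rewrite /g !scalerA -!mulrA; congr (_ *: _).
  by rewrite mulrCA; congr (_ * _); rewrite mulrCA.
pose N : R := #|{ffun 'I_M -> bool}|%:R.
have NE : N^-1 = 2^-1 ^+ M by rewrite /N card_ffun card_bool card_ord natrX exprVn.
pose e (a : nat) j := N^-1 * \sum_(d : {ffun 'I_M -> bool}) cmod (\sum_s (-1) ^+ d s * g a s j).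
(* Khintchine with [mu(B_j) >= |y j| ^ 2 / (4 sg ^ 2)] gives an amplitude of at least
   [|y j| / (9 sg)]; this is the origin of the [9] in the decoupling lemma. *)
have he a j : 2 / 9 * (rnorm (y j) / (2 * sg)) <= e a j.
  apply: khintchine_L1; first by rewrite divr_ge0 ?mulr_ge0 ?rnorm_ge0 ?(ltW sgp).
  rewrite (eq_bigr (fun s : 'I_M => cmod (h s j) ^+ 2)); last first.
    by move=> s _; rewrite /g cmod_vcharM.
  rewrite (plancherel_indic hm (L := L) (fun a : 'I_(vbase m L) => tau a == Some j)) -/M.
  have -> : #|(fun a : 'I_M => tau a == Some j)| = c j.
    rewrite -sum1_card big_mkcond /=.
    rewrite (eq_bigr (fun a : 'I_M => (tau a == Some j : nat))); last by move=> b _;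
      rewrite unfold_in /=; case: eqP.
    rewrite (sum_fiber_map None (fun o : option 'I_n => (o == Some j : nat)) c'M).
    rewrite (bigD1 (Some j)) //= eqxx big1 ?addr0 => [|o /negbTE ->].
      by rewrite /c'; elim: (c j) => // k IH; rewrite mulrS IH.
    by rewrite mul0rn.
  apply: le_trans (hc j); rewrite /t -sg2 le_eqVlt; apply/orP; left; apply/eqP.
  by field; rewrite gt_eqF.
have eE a j : e a j = N^-1 * \sum_(d : {ffun 'I_M -> bool}) cmod (\sum_s (-1) ^+ d s * g a s j)
  by [].
clearbody e.
have claim a : sign_sum p y <= 9 `^ p * (N^-1 * \sum_(d : {ffun 'I_M -> bool})
     2 `^ p * (2 * sign_sum p (fun j => (\sum_s (-1) ^+ d s * g a s j) *: x j))).
  apply: (@sign_sum_mean_le R X 'I_n 'I_M p (g a) x y (e a)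
    (fun j => rnorm (y j) / (sg * e a j)) p1) => j; first exact: eE.
    have e0 : 0 <= e a j.
      by apply: le_trans (he a j); rewrite !mulr_ge0 ?invr_ge0 ?mulr_ge0 ?rnorm_ge0 ?(ltW sgp).
    rewrite divr_ge0 ?rnorm_ge0 ?mulr_ge0 ?(ltW sgp) //=.
    have [e00|en] := eqVneq (e a j) 0; first by rewrite e00 mulr0 invr0 mulr0.
    have ep : 0 < e a j by rewrite lt_neqAle eq_sym en.
    rewrite ler_pdivrMr ?mulr_gt0 //; have := he a j.
    rewrite -(ler_pM2l (_ : 0 < 9 * sg)) ?mulr_gt0 //.
    have -> : 9 * sg * (2 / 9 * (rnorm (y j) / (2 * sg))) = rnorm (y j) by field; rewrite gt_eqF.
    by rewrite -mulrA.
  rewrite /x !scalerA -!rmorphM /=.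
  have [r0|r0] := eqVneq (rnorm (y j)) 0.
    by rewrite (rnorm_eq0 r0) scaler0.
  have rp : 0 < rnorm (y j) by rewrite lt_neqAle eq_sym r0 rnorm_ge0.
  have ep : 0 < e a j.
    by apply: lt_le_trans (he a j); rewrite mulr_gt0 ?divr_gt0 ?mulr_gt0.
  rewrite (_ : _ * _ = 1) ?scale1r //; field.
  by rewrite !gt_eqF.
have : sign_sum p y <= vmean m L (fun a => 9 `^ p * (N^-1 * \sum_(d : {ffun 'I_M -> bool})
     2 `^ p * (2 * sign_sum p (fun j => (\sum_s (-1) ^+ d s * g a s j) *: x j)))).
  by rewrite -[X in X <= _](vmean_cst L); exact: vmean_ler.
move=> /le_trans h3; rewrite ler_pdivrMl ?ltr0n; last by apply/card_gt0P; exists [ffun=> false].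
apply: h3.
(* Summing over the signs [d] of the test function and exchanging sums recovers a [sign_sum] for
   each code [a] and each pattern [eps]. *)
have := ler_sum (index_enum {ffun 'I_n -> bool}) (fun d (_ : xpredT d) => key d).
rewrite sumr_const -mulr_sumr exchange_big /= => h4.
rewrite -vmeanZ -vmeanZ -exchange_vmean.
under eq_bigr => eps _ do rewrite -vmeanZ -vmeanZ /sign_sum -exchange_vmean.
rewrite -mulr_sumr -mulr_sumr NE.
set A := \sum_(eps : {ffun 'I_M -> bool}) _ in h4 *.
have h5 : 9 `^ p * (2 `^ p * 2) * (2^-1 ^+ M * A) <= 9 `^ p * (2 `^ p * 2) * (K * sg `^ p *+
  #|{ffun 'I_n -> bool}|).
  by rewrite ler_wpM2l // !mulr_ge0 ?powR_ge0.
apply: le_trans (le_trans _ h5) _; rewrite le_eqVlt; apply/orP; left; apply/eqP; first by ring.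
by rewrite -mulr_natl; ring.
Qed.

(** The second moment is bounded by the [p]-th through Jensen with exponent [p / 2 >= 1]; here
    [2 <= p] is used in full. *)
Lemma LPR_type2 : LPR_eq mu p X \/ LPR_eq_oplus mu p X -> type2 X.
Proof.
move=> /sign_sum_le_type2[K [K0 hK]].
have p0 : 0 < p by exact: lt_le_trans hp.
exists (K `^ p^-1) => n y.
rewrite rademacher_meanE sumEFin !poweR_EFin -EFinM lee_fin card_ord.
set s2 := \sum_j rnorm (y j) ^+ 2.
have s20 : 0 <= s2 by apply: sumr_ge0 => j _; exact: sqr_ge0.
have := hK n y; rewrite -/s2 /sign_sum card_ffun card_bool card_ord natrX -exprVn => h.
set q := 2^-1 ^+ n * _.
have q0 : 0 <= q.
  by rewrite mulr_ge0 ?exprn_ge0 ?invr_ge0 // sumr_ge0 // => d _; exact: sqr_ge0.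
have w1 : \sum_(d : {ffun 'I_n -> bool}) (2^-1 ^+ n : R) = 1.
  by rewrite sumr_const card_ffun card_bool card_ord -(mulr_natr (2^-1 ^+ n)) natrX -exprMn
    mulVf // expr1n.
have : q `^ (p / 2) <= K * (s2 `^ 2^-1) `^ p.
  rewrite powR12_sqrt //; apply: le_trans h.
  rewrite /q mulr_sumr.
  apply: le_trans (@jensen_powR R _ (fun=> 2^-1 ^+ n) (fun d : {ffun 'I_n -> bool} =>
     rnorm (\sum_j (-1) ^+ d j *: y j) ^+ 2) (p / 2) _ _ w1 _) _.
  - by rewrite ler_pdivlMr // mul1r.
  - by move=> d; rewrite exprn_ge0 ?invr_ge0.
  - by move=> d; exact: sqr_ge0.
  rewrite -mulr_sumr ler_wpM2l ?exprn_ge0 ?invr_ge0 //; apply: ler_sum => d _.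
  rewrite -powR_mulrn ?rnorm_ge0 // -powRrM (_ : 2%:R * (p / 2) = p) //; by field.
have p20 : 0 <= p^-1 by rewrite invr_ge0 ltW.
move=> h2; have := ge0_ler_powR p20 _ _ h2.
rewrite !nnegrE powR_ge0 mulr_ge0 ?powR_ge0 // => /(_ isT isT).
rewrite powRM ?powR_ge0 // -!powRrM.
have pn : p != 0 by rewrite gt_eqF.
have -> : p / 2 * p^-1 = 2^-1 by rewrite mulrAC divff // mul1r.
have -> : 2^-1 * (p * p^-1) = 2^-1 by rewrite divff // mulr1.
by [].
Qed.

End Type2Assembly.

(** * Martingales on finite trees *)

Lemma cvg_sumr (K : numFieldType) (V : pseudoMetricNormedZmodType K) (I : Type) (r : seq I)
    (P : pred I) (f : nat -> I -> V) (l : I -> V) :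
  (forall i, P i -> f n i @[n --> \oo] --> l i) ->
  \sum_(i <- r | P i) f n i @[n --> \oo] --> \sum_(i <- r | P i) l i.
Proof.
move=> h; elim: r => [|i r IH].
  rewrite big_nil (_ : (fun n => _) = fun=> 0); first exact: cvg_cst.
  by apply/funext => n; rewrite big_nil.
rewrite big_cons (_ : (fun n => _) = (fun n => (if P i then f n i else 0) + \sum_(j <- r | P j)
  f n j)); last first.
  by apply/funext => n; rewrite big_cons; case: ifP => _; rewrite ?add0r.
case: ifP => Pi; first by apply: cvgD => //; exact: h.
by apply: cvg_trans IH; apply: near_eq_cvg; apply: nearW => n; rewrite add0r.
Qed.

(** * Rounding of probability vectors *)

Section Counts.
Context {R : realType} {J : finType} (j0 : J).
Implicit Types (q : J -> R) (Q : nat).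

(** All entries but [j0] are rounded down, and [j0] receives the remainder, so the total is exactly
    [Q]. *)
Definition counts q Q (j : J) : nat :=
  if j == j0 then (Q - \sum_(i | i != j0) Num.truncn (q i * Q%:R))%N
  else Num.truncn (q j * Q%:R).

Lemma sum_counts q Q : (forall j, 0 <= q j) -> \sum_j q j = 1 ->
  (\sum_j counts q Q j)%N = Q.
Proof.
move=> q0 q1; rewrite (bigD1 j0) //= {1}/counts eqxx.
rewrite [X in (_ + X)%N](eq_bigr (fun i => Num.truncn (q i * Q%:R))) => [|i /negbTE ij];
  last by rewrite /counts ij.
rewrite subnK // -(ler_nat R) natr_sum.
apply: (@le_trans _ _ (\sum_(i | i != j0) q i * Q%:R)).
  by apply: ler_sum => i _; rewrite truncn_le mulr_ge0 ?ler0n.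
rewrite -mulr_suml -[leRHS]mul1r ler_wpM2r ?ler0n // -q1 [leRHS](bigD1 j0) //=.
by rewrite lerDr.
Qed.

(** Rounding costs at most [1 / Q N], which tends to zero; the entry at [j0] converges as the
    complement of the others. *)
Lemma cvg_counts q (Q : nat -> nat) : (forall j, 0 <= q j) -> \sum_j q j = 1 ->
  (forall N, (N < Q N)%N) ->
  forall j, (counts q (Q N) j)%:R / (Q N)%:R @[N --> \oo] --> q j.
Proof.
move=> q0 q1 hQ.
have Q0 N : (0 : R) < (Q N)%:R by rewrite ltr0n; apply: leq_ltn_trans (hQ N).
have invQ : ((Q N)%:R : R)^-1 @[N --> \oo] --> (0 : R).
  apply: (squeeze_cvgr (f := fun=> 0) (h := fun N => N.+1%:R^-1)).
  - apply: nearW => N; rewrite invr_ge0 ler0n /= lef_pV2 ?posrE ?ltr0n //; last first.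
      exact: leq_ltn_trans (hQ N).
    by rewrite ler_nat.
  - exact: cvg_cst.
  - exact: cvg_harmonic.
have ht j : (Num.truncn (q j * (Q N)%:R))%:R / (Q N)%:R @[N --> \oo] --> q j.
  apply: (squeeze_cvgr (f := fun N => q j - (Q N)%:R^-1) (h := fun=> q j)).
  - apply: nearW => N; have qQ : 0 <= q j * (Q N)%:R by rewrite mulr_ge0 ?ler0n.
    have /andP[h1 h2] := truncn_itv qQ.
    rewrite ler_pdivrMr // h1 andbT ler_pdivlMr // mulrBl mulVf ?gt_eqF // lerBlDr natr1.
    exact: ltW.
  - rewrite -[X in _ --> X]subr0; apply: cvgB => //; exact: cvg_cst.
  - exact: cvg_cst.
move=> j; rewrite /counts; case: eqP => [->|_]; last exact: ht.
have E N : ((Q N - \sum_(i | i != j0) Num.truncn (q i * (Q N)%:R))%N)%:R / (Q N)%:R =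
    1 - \sum_(i | i != j0) (Num.truncn (q i * (Q N)%:R))%:R / (Q N)%:R :> R.
  have h := sum_counts (Q N) q0 q1; move: h; rewrite (bigD1 j0) //= {1}/counts eqxx.
  rewrite [X in (_ + X)%N](eq_bigr (fun i => Num.truncn (q i * (Q N)%:R))) => [h|i /negbTE ij];
    last by rewrite /counts ij.
  rewrite natrB; last by rewrite -{2}h leq_addl.
  by rewrite natr_sum mulrBl mulfV ?gt_eqF // mulr_suml.
rewrite (_ : (fun N => _) = (fun N => 1 - \sum_(i | i != j0) (Num.truncn (q i * (Q N)%:R))%:R /
  (Q N)%:R)); last first.
  exact/funext.
have -> : q j0 = 1 - \sum_(i | i != j0) q i by rewrite -q1 (bigD1 j0) //= addrK.
apply: cvgB; first exact: cvg_cst.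
by apply: cvg_sumr => i _; exact: ht.
Qed.

End Counts.

Section Tree.
Context {R : realType} {X : completeNormedModType R[i]} {J : finType}.

(* Expectation of [Phi] at the end of an [n]-step martingale pair started at [(x, y)] with
   history [h], transition probabilities [q] and increments [D]; the increments of the
   second component carry the signs [th]. *)
Fixpoint tree (q : seq J -> J -> R) (D : seq J -> J -> X) (th : nat -> bool)
    (Phi : X -> X -> R) (n : nat) (h : seq J) (x y : X) : R :=
  if n is n'.+1 then
    \sum_j q h j * tree q D th Phi n' (rcons h j) (x + D h j) (y + (-1) ^+ th (size h) *: D h j)
  else Phi x y.

(** The starting points vary with [N] because after one step they contain the increments [DN N], to
    which the induction hypothesis must apply. *)
Lemma cvg_tree (qN : nat -> seq J -> J -> R) (DN : nat -> seq J -> J -> X)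
    (q : seq J -> J -> R) (D : seq J -> J -> X) (th : nat -> bool) (Phi : X -> X -> R) n :
  (forall h j, qN N h j @[N --> \oo] --> q h j) ->
  (forall h j, DN N h j @[N --> \oo] --> D h j) ->
  (forall (xN yN : nat -> X) x y, xN N @[N --> \oo] --> x -> yN N @[N --> \oo] --> y ->
     Phi (xN N) (yN N) @[N --> \oo] --> Phi x y) ->
  forall h (xN yN : nat -> X) x y, xN N @[N --> \oo] --> x -> yN N @[N --> \oo] --> y ->
  tree (qN N) (DN N) th Phi n h (xN N) (yN N) @[N --> \oo] --> tree q D th Phi n h x y.
Proof.
move=> hq hD hPhi; elim: n => [|n IH] h xN yN x y hx hy /=; first exact: hPhi.
apply: cvg_sumr => j _; apply: cvgM; first exact: hq.
apply: (IH (rcons h j) (fun N => xN N + DN N h j)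
  (fun N => yN N + (-1) ^+ th (size h) *: DN N h j)); first exact: cvgD.
by apply: (cvgD hy); apply: cvgZ; [exact: cvg_cst|exact: hD].
Qed.

End Tree.

(** * Simulation of a tree by blocks of coordinates *)

Section UniformTree.
Context {R : realType} {X : completeNormedModType R[i]} {J : finType} (j0 : J).
Variable m : nat -> nat.
Hypothesis hm : forall k, (2 <= m k)%N.
Variables (q : seq J -> J -> R) (D : seq J -> J -> X).
Hypotheses (q0 : forall h j, 0 <= q h j) (q1 : forall h, \sum_j q h j = 1).
Variables (N n : nat).

(** The product of [m_i] over [k N <= i < (k + 1) N], that is, the number of values of the [k]-th
    block of [N] coordinates. *)
Definition block_size (k : nat) : nat := (vbase m (k.+1 * N) %/ vbase m (k * N))%N.

Lemma vbase_block k : (vbase m (k.+1 * N) = block_size k * vbase m (k * N))%N.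
Proof. by rewrite divnK // vbase_dvd // leq_mul2r leqnSn orbT. Qed.

Lemma vbase_add a b : (vbase m a * b.+1 <= vbase m (a + b))%N.
Proof.
elim: b => [|b IH]; first by rewrite addn0 muln1.
rewrite addnS vbaseS; apply: (@leq_trans (vbase m a * b.+1 * 2)).
  by rewrite -mulnA leq_mul2l; apply/orP; right; lia.
exact: leq_mul.
Qed.

Lemma ltn_block_size k : (N < block_size k)%N.
Proof.
rewrite -(leq_pmul2r (vbase_gt0 hm (k * N))) -vbase_block mulnC.
have -> : (k.+1 * N = k * N + N)%N by rewrite mulSn addnC.
exact: vbase_add.
Qed.

Lemma block_size_gt0 k : (0 < block_size k)%N.
Proof. exact: leq_ltn_trans (ltn_block_size k). Qed.

Definition cnt (h : seq J) : J -> nat := counts j0 (q h) (block_size (size h)).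
Definition step (h : seq J) (u : nat) : J := fiber_map j0 (cnt h) u.
Definition qN (h : seq J) (j : J) : R := (cnt h j)%:R / (block_size (size h))%:R.
(** Recentred for the rounded probabilities, so that the simulated process is an exact
    martingale. *)
Definition DN (h : seq J) (j : J) : X := D h j - \sum_i ((qN h i)%:C)%C *: D h i.

Lemma sum_step (V : nmodType) h (G : J -> V) :
  \sum_(u < block_size (size h)) G (step h u) = \sum_j G j *+ cnt h j.
Proof. by apply: sum_fiber_map; exact: sum_counts. Qed.

Lemma sum_DN h : \sum_j DN h j *+ cnt h j = 0.
Proof.
rewrite /DN; under eq_bigr do rewrite mulrnBl.
rewrite sumrB sumrMnr sum_counts // -scaler_nat scaler_sumr -sumrB big1 // => j _.
have b0 : (block_size (size h))%:R != 0 :> R[i] by rewrite pnatr_eq0 -lt0n block_size_gt0.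
rewrite scalerA /qN rmorphM fmorphV !rmorph_nat mulrCA mulfV // mulr1.
by rewrite scaler_nat subrr.
Qed.

(** The digits of the code [x] in the base of the block sizes drive the successive steps. *)
Fixpoint hist (k x : nat) : seq J :=
  if k is k'.+1 then
    rcons (hist k' x) (step (hist k' x) ((x %/ vbase m (k' * N)) %% block_size k')%N)
  else [::].

Lemma size_hist k x : size (hist k x) = k.
Proof. by elim: k => //= k IH; rewrite size_rcons IH. Qed.

Definition incr (k x : nat) : X :=
  DN (hist k x) (step (hist k x) ((x %/ vbase m (k * N)) %% block_size k)%N).

Lemma hist_modn k x y : (x = y %[mod vbase m (k * N)])%N -> hist k x = hist k y.
Proof.
elim: k => //= k IH; rewrite vbase_block => h.
have hk : (x = y %[mod vbase m (k * N)])%N.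
  by rewrite -(modn_dvdm x (dvdn_mull (block_size k) (dvdnn _))) h modn_dvdm // dvdn_mull.
rewrite (IH hk); congr (rcons _ (step _ _)).
by rewrite !modn_divl h.
Qed.

Lemma digit_block k b u : (b < vbase m (k * N))%N ->
  ((b + u * vbase m (k * N)) %/ vbase m (k * N) = u)%N.
Proof. by move=> bM; rewrite addnC divnMDl ?vbase_gt0 // divn_small // addn0. Qed.

Lemma hist_block k b u : hist k (b + u * vbase m (k * N)) = hist k b.
Proof. by apply: hist_modn; rewrite addnC modnMDl. Qed.

Lemma incr_modn k x y : (x = y %[mod vbase m (k.+1 * N)])%N -> incr k x = incr k y.
Proof.
move=> h; have := hist_modn h; rewrite /= => /rcons_inj[h1 h2].
by rewrite /incr h1 -h2 -h1.
Qed.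

Lemma incr_block k b u : (b < vbase m (k * N))%N -> (u < block_size k)%N ->
  incr k (b + u * vbase m (k * N)) = DN (hist k b) (step (hist k b) u).
Proof. by move=> bM uQ; rewrite /incr hist_block digit_block // modn_small. Qed.

Lemma vmean_block k (g : nat -> R) :
  vmean m (k.+1 * N) g = vmean m (k * N) (fun b =>
    (block_size k)%:R^-1 * \sum_(u < block_size k) g (b + u * vbase m (k * N))%N).
Proof.
rewrite /vmean vbase_block (big_ord_mul _ _ g) exchange_big /= natrM invfM -mulrA.
by rewrite mulrCA; congr (_ * _); rewrite mulr_sumr.
Qed.

(** A uniform code has independent uniform block digits, and [step h] sends a uniform digit to the
    law [qN h]. *)
Lemma tree_vmean th Phi c c' :
  tree qN DN th Phi n [::] c c' =
  vmean m (n * N) (fun x => Phi (c + \sum_(k < n) incr k x)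
                                (c' + \sum_(k < n) (-1) ^+ th k *: incr k x)).
Proof.
(* Interpolation: the first [k] steps are read off the code, the others are still averaged by the
   tree. *)
have step1 k : (k <= n)%N -> tree qN DN th Phi n [::] c c' =
    vmean m (k * N) (fun x => tree qN DN th Phi (n - k) (hist k x)
       (c + \sum_(i < k) incr i x) (c' + \sum_(i < k) (-1) ^+ th i *: incr i x)).
  elim: k => [_|k IH kn].
    by rewrite /vmean mul0n vbase0 big_ord1 !big_ord0 invr1 mul1r subn0 !addr0.
  rewrite (IH (ltnW kn)) vmean_block /vmean; congr (_ * _); apply: eq_bigr => b _.
  rewrite -(subnSK kn) /= size_hist.
  have bM := ltn_ord b.
  rewrite mulr_sumr.
  transitivity (\sum_(u < block_size (size (hist k b)))
    (block_size k)%:R^-1 * tree qN DN th Phi (n - k.+1) (rcons (hist k b) (step (hist k b) u))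
     (c + \sum_(i < k) incr i b + DN (hist k b) (step (hist k b) u))
     (c' + \sum_(i < k) (-1) ^+ th i *: incr i b + (-1) ^+ th k *: DN (hist k b) (step (hist k
       b) u))).
    rewrite (sum_step (hist k b) (fun j => (block_size k)%:R^-1 * tree qN DN th Phi (n - k.+1)
      (rcons (hist k b) j)
     (c + \sum_(i < k) incr i b + DN (hist k b) j)
     (c' + \sum_(i < k) (-1) ^+ th i *: incr i b + (-1) ^+ th k *: DN (hist k b) j))).
    apply: eq_bigr => j _; rewrite -[RHS]mulr_natl mulrA; congr (_ * _).
    by rewrite /qN size_hist.
  rewrite size_hist; apply: eq_bigr => u _; congr (_ * _).
  have uQ := ltn_ord u.
  have Ei i : (i < k)%N -> incr i (b + u * vbase m (k * N)) = incr i b.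
    move=> ik; apply: incr_modn.
    have dv : (vbase m (i.+1 * N) %| vbase m (k * N))%N by rewrite vbase_dvd // leq_mul2r ik orbT.
    by rewrite -(modn_dvdm _ dv) addnC modnMDl modn_dvdm.
  have E1 : \sum_(i < k) incr i (b + u * vbase m (k * N)) = \sum_(i < k) incr i b.
    by apply: eq_bigr => i _; rewrite Ei.
  have E2 : \sum_(i < k) (-1) ^+ th i *: incr i (b + u * vbase m (k * N)) =
      \sum_(i < k) (-1) ^+ th i *: incr i b.
    by apply: eq_bigr => i _; rewrite Ei.
  rewrite hist_block digit_block // (modn_small uQ) !big_ord_recr /= incr_block // E1 E2.
  by rewrite (addrA c) (addrA c').
by rewrite (step1 n (leqnn n)) subnn.
Qed.

Lemma vcond_sumF (I : finType) L j (F : I -> nat -> X) x :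
  vcond m L j (fun a => \sum_i F i a) x = \sum_i vcond m L j (F i) x.
Proof. by rewrite /vcond exchange_big /= scaler_sumr. Qed.

Lemma vcondD L j (F G : nat -> X) x :
  vcond m L j (fun a => F a + G a) x = vcond m L j F x + vcond m L j G x.
Proof. by rewrite /vcond big_split /= scalerDr. Qed.

Lemma vcond_fiber_cst L j (F : nat -> X) x : (j <= L)%N ->
  (forall a, (x = a %[mod vbase m j])%N -> F a = F x) -> vcond m L j F x = F x.
Proof.
move=> jL hF; rewrite /vcond sum_fiber //.
rewrite (eq_bigr (fun=> F x)) => [|u _]; last first.
  by apply: hF; rewrite addnC modnMDl modn_mod.
rewrite sumr_const card_ord -[F x *+ _]scaler_nat scalerA.
have M0 k : (vbase m k)%:R != 0 :> R[i] by rewrite pnatr_eq0 -lt0n vbase_gt0.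
rewrite rmorphM fmorphV !rmorph_nat.
have -> : (vbase m L)%:R = (vbase m L %/ vbase m j)%:R * (vbase m j)%:R :> R[i].
  by rewrite -natrM divnK // vbase_dvd.
rewrite (_ : _ * _ = 1) ?scale1r //; field.
by rewrite M0 pnatr_eq0 -lt0n divn_gt0 ?vbase_gt0 ?vbase_leq.
Qed.

(** The code splits into lower blocks [b], the digit [u] of block [i] and higher blocks [v]. The
    condition modulo [M_(k N)] concerns only [b], and the sum over [u] vanishes by centring. *)
Lemma vcond_incr0 k i x : (k <= i)%N -> (i < n)%N -> vcond m (n * N) (k * N) (incr i) x = 0.
Proof.
move=> ki iN; rewrite /vcond (_ : \sum_(a < _ | _) _ = 0) ?scaler0 //.
have dv1 : (vbase m (k * N) %| vbase m (i * N))%N by rewrite vbase_dvd // leq_mul2r ki orbT.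
have dv2 : (vbase m (i.+1 * N) %| vbase m (n * N))%N by rewrite vbase_dvd // leq_mul2r iN orbT.
pose Pn := (vbase m (n * N) %/ vbase m (i.+1 * N))%N.
have E : (vbase m (n * N) = (Pn * block_size i) * vbase m (i * N))%N.
  by rewrite -mulnA -vbase_block divnK.
rewrite big_mkcond -(big_mkord xpredT (fun a => if x == a %[mod vbase m (k * N)] then incr i a
  else 0)).
rewrite E big_mkord (big_ord_mul _ _ (fun a => if x == a %[mod vbase m (k * N)] then incr i a
  else 0)).
rewrite exchange_big big1 // => b _ /=.
have bM := ltn_ord b.
have Ek u : (x == b + u * vbase m (i * N) %[mod vbase m (k * N)]) = (x == b %[mod vbase m (k *
  N)]).
  by rewrite -(modn_dvdm (b + _) dv1) (addnC (b : nat)) modnMDl modn_dvdm.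
under eq_bigr => u _ do rewrite Ek.
case: (_ == _); last by rewrite big1.
rewrite (big_ord_mul _ _ (fun u => incr i (b + u * vbase m (i * N)))) big1 // => v _.
transitivity (\sum_(u < block_size (size (hist i b))) DN (hist i b) (step (hist i b) u)).
  rewrite size_hist; apply: eq_bigr => u _.
  rewrite /incr hist_block digit_block // addnC modnMDl modn_small //.
by rewrite (sum_step (hist i b) (DN (hist i b))) sum_DN.
Qed.

Lemma vcond_partial c k x : (k <= n)%N ->
  vcond m (n * N) (k * N) (fun a => c + \sum_(i < n) incr i a) x = c + \sum_(i < k) incr i x.
Proof.
move=> kn; have kL : (k * N <= n * N)%N by rewrite leq_mul2r kn orbT.
rewrite (vcondD _ _ (fun=> c)) (vcond_fiber_cst (F := fun=> c)) //; congr (_ + _).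
rewrite (vcond_sumF _ _ (fun i : 'I_n => incr i)).
rewrite (big_ord_widen n (fun i => incr i x) kn) [RHS]big_mkcond; apply: eq_bigr => i _.
case: ltnP => ik; last exact: vcond_incr0.
apply: vcond_fiber_cst => // a h; apply/esym/incr_modn.
have dv : (vbase m (i.+1 * N) %| vbase m (k * N))%N by rewrite vbase_dvd // leq_mul2r ik orbT.
by rewrite -(modn_dvdm x dv) h modn_dvdm.
Qed.

(** A set of levels that is a union of blocks is used: inside a block the differences telescope to
    the increment of that step. *)
Lemma vcond_blocks c (S : pred nat) x : (0 < N)%N ->
  let F a := c + \sum_(i < n) incr i a in
  \sum_(j < n * N | S (j %/ N)%N) (vcond m (n * N) j.+1 F x - vcond m (n * N) j F x) =
  \sum_(k < n | S k) incr k x.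
Proof.
move=> N0 F; rewrite big_mkcond.
rewrite (big_ord_mul _ _ (fun j => if S (j %/ N)%N then vcond m (n * N) j.+1 F x - vcond m (n *
  N) j F x else 0)).
rewrite [RHS]big_mkcond; apply: eq_bigr => k _.
rewrite (eq_bigr (fun i : 'I_N => if S k then vcond m (n * N) (i.+1 + k * N) F x - vcond m (n *
  N) (i + k * N) F x else 0)); last first.
  by move=> i _; rewrite addnC divnMDl // divn_small // addn0 addnC addSn.
case: (S k); last by rewrite big1.
rewrite -(big_mkord xpredT (fun i => vcond m (n * N) (i.+1 + k * N) F x - vcond m (n * N) (i + k
  * N) F x)).
rewrite (telescope_sumr (fun i => vcond m (n * N) (i + k * N) F x)) // add0n -mulSn.
rewrite !vcond_partial ?(ltnW (ltn_ord k)) // big_ord_recr /=.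
by rewrite opprD addrACA subrr add0r addrAC subrr add0r.
Qed.

End UniformTree.

(** * The tree inequality *)

Section TreeInequality.
Context {R : realType} {X : completeNormedModType R[i]}.
Variable m : nat -> nat.
Hypothesis hm : forall k, (2 <= m k)%N.

(** With [x] a martingale and [y] its transform, a nonpositive mean is the UMD estimate for [p]-th
    powers. A single continuous function makes the passage to the limit direct. *)
Definition umd_gap (p K : R) (x y : X) : R := rnorm y `^ p - K * rnorm x `^ p.

(** With [F] the final value, [T] the sum of all increments and [S] of those with positive sign, the
    transform is [F - T], up to sign, plus [2 S - T]. *)
Lemma signed_sum_bound (n : nat) (th : nat -> bool) (s : bool) (c : X) (d : nat -> X) (p : R) :
  1 <= p ->
  rnorm ((-1) ^+ s *: c + \sum_(k < n) (-1) ^+ th k *: d k) `^ p <=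
  3 `^ p * (rnorm (c + \sum_(k < n) d k) `^ p + 2 `^ p * rnorm (\sum_(k < n) d k) `^ p +
            2 `^ p * rnorm (\sum_(k < n | ~~ th k) d k) `^ p).
Proof.
move=> p1; have p0 : 0 <= p by apply: le_trans p1.
set F := c + _; set PT := \sum_(k < n) d k; set PS := \sum_(k < n | ~~ th k) d k.
have -> : (-1) ^+ s *: c + \sum_(k < n) (-1) ^+ th k *: d k =
    (-1) ^+ s *: (F - PT) + ((2%:C)%C *: PS - PT).
  rewrite /F -/PT addrK; congr (_ + _).
  rewrite /PS /PT [X in _ *: X]big_mkcond scaler_sumr -sumrB; apply: eq_bigr => k _.
  case: (th k) => /=; first by rewrite expr1 scaleN1r scaler0 add0r.
  by rewrite expr0 scale1r rmorph_nat scaler_nat mulr2n addrK.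
have h : rnorm ((-1) ^+ s *: (F - PT) + ((2%:C)%C *: PS - PT)) <=
    rnorm F + 2 * rnorm PT + 2 * rnorm PS.
  apply: le_trans (ler_rnormD _ _) _; rewrite rnorm_sign.
  have h1 := ler_rnormD F (- PT); have h2 := ler_rnormD ((2%:C)%C *: PS) (- PT).
  rewrite rnormN in h1; rewrite rnormN rnormZr ger0_norm // in h2.
  lra.
pose t (i : 'I_3) : R := nth 0 [:: rnorm F; 2 * rnorm PT; 2 * rnorm PS] i.
have t0 i : 0 <= t i.
  by case: i => -[|[|[|//]]] ? /=; rewrite /t /= ?mulr_ge0 ?rnorm_ge0.
have := ler_powR_sum p1 t0.
rewrite card_ord !big_ord_recr !big_ord0 /= !add0r /t /=.
rewrite !powRM ?rnorm_ge0 //; apply: le_trans.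
by apply: ge0_ler_powR; rewrite ?nnegrE ?rnorm_ge0 // !addr_ge0 ?mulr_ge0 ?rnorm_ge0.
Qed.

Variable mu : probability (vilenkin m) R.
Hypothesis hmu : normalized_haar mu.
Variable p : R.
Hypothesis p1 : 1 <= p.

Lemma tree_inequality : LPR_eq mu p X \/ LPR_eq_oplus mu p X ->
  exists K : R, 0 <= K /\ forall (J : finType) (j0 : J) (q : seq J -> J -> R) (D : seq J -> J ->
    X)
    (th : nat -> bool) (s : bool) (c : X) (n : nat),
    (forall h j, 0 <= q h j) -> (forall h, \sum_j q h j = 1) ->
    (forall h, \sum_j ((q h j)%:C)%C *: D h j = 0) ->
    tree q D th (umd_gap p K) n [::] c ((-1) ^+ s *: c) <= 0.
Proof.
have p0 : 0 < p by apply: lt_le_trans p1.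
move=> /(vilenkin_unconditional hm hmu p0)[K [K0 hK]].
(* The three contributions of [signed_sum_bound]; the last two are controlled by unconditionality
   with constant [K]. *)
exists (3 `^ p * (1 + 2 `^ p * K + 2 `^ p * K)); split.
  by rewrite !(mulr_ge0, addr_ge0) ?powR_ge0.
move=> J j0 q D th s c n q0 q1 D0; set K2 := 3 `^ p * _.
(* Blocks have positive length [N + 1], so the level [j] lies in block [j / (N + 1)]. *)
have unif N : tree (qN j0 m q N.+1) (DN j0 m q D N.+1) th (umd_gap p K2) n [::] c ((-1) ^+ s *:
  c) <= 0.
  rewrite (tree_vmean j0 hm D q0 q1) /umd_gap.
  set d := incr j0 m q D N.+1.
  pose F x := c + \sum_(k < n) d k x.
  have hT : vmean m (n * N.+1) (fun x => rnorm (\sum_(k < n) d k x) `^ p) <=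
      K * vmean m (n * N.+1) (fun x => rnorm (F x) `^ p).
    have := hK (n * N.+1)%N (fun j => xpredT (j %/ N.+1)%N) F.
    apply: le_trans; rewrite le_eqVlt; apply/orP; left; apply/eqP.
    congr (_ * _); apply: eq_bigr => a _.
    by rewrite (vcond_blocks j0 hm D q0 q1 n c xpredT a (ltn0Sn N)).
  have hS : vmean m (n * N.+1) (fun x => rnorm (\sum_(k < n | ~~ th k) d k x) `^ p) <=
      K * vmean m (n * N.+1) (fun x => rnorm (F x) `^ p).
    have := hK (n * N.+1)%N (fun j => ~~ th (j %/ N.+1)%N) F.
    apply: le_trans; rewrite le_eqVlt; apply/orP; left; apply/eqP.
    congr (_ * _); apply: eq_bigr => a _.
    by rewrite (vcond_blocks j0 hm D q0 q1 n c (fun k => ~~ th k) a (ltn0Sn N)).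
  apply: (@le_trans _ _ (vmean m (n * N.+1) (fun x =>
     3 `^ p * (rnorm (F x) `^ p + 2 `^ p * rnorm (\sum_(k < n) d k x) `^ p +
            2 `^ p * rnorm (\sum_(k < n | ~~ th k) d k x) `^ p) - K2 * rnorm (F x) `^ p))).
    apply: vmean_ler => x; rewrite lerD2r.
    exact: (signed_sum_bound n th s c (fun k => d k x) p1).
  move: hT hS; rewrite /vmean.
  set A := \sum_(a < _) rnorm (\sum_(k < n) _) `^ p.
  set B := \sum_(a < _) rnorm (\sum_(k < n | ~~ th k) _) `^ p.
  set E := \sum_(a < _) rnorm (F a) `^ p; set M := _^-1 => hA hB.
  rewrite sumrB -!mulr_sumr !big_split /= -!mulr_sumr -/A -/B -/E.
  have a2 : 0 <= 2 `^ p :> R by exact: powR_ge0.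
  have a3 : 0 <= 3 `^ p :> R by exact: powR_ge0.
  have h1 : 3 `^ p * (2 `^ p * (M * A)) <= 3 `^ p * (2 `^ p * (K * (M * E))).
    by rewrite !ler_wpM2l.
  have h2 : 3 `^ p * (2 `^ p * (M * B)) <= 3 `^ p * (2 `^ p * (K * (M * E))).
    by rewrite !ler_wpM2l.
  have -> : M * (3 `^ p * (E + 2 `^ p * A + 2 `^ p * B) - K2 * E) =
    (3 `^ p * (2 `^ p * (M * A)) - 3 `^ p * (2 `^ p * (K * (M * E)))) +
    (3 `^ p * (2 `^ p * (M * B)) - 3 `^ p * (2 `^ p * (K * (M * E)))) by rewrite /K2; ring.
  by rewrite -[leRHS]addr0; apply: lerD; rewrite subr_le0.
have cq h j : qN j0 m q N.+1 h j @[N --> \oo] --> q h j.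
  apply: (cvg_counts j0 (Q := fun N => block_size m N.+1 (size h)) (q0 h) (q1 h)).
  by move=> N; apply: ltn_trans (ltn_block_size hm N.+1 (size h)).
have cD h j : DN j0 m q D N.+1 h j @[N --> \oo] --> D h j.
  (* The recentring term tends to the [q]-mean of [D h], which is zero. *)
  have E0 : D h j = D h j - \sum_i ((q h i)%:C)%C *: D h i by rewrite D0 subr0.
  rewrite /DN [X in _ --> X]E0; apply: cvgB; first exact: cvg_cst.
  apply: (@cvg_sumr _ X J _ xpredT (fun N i => ((qN j0 m q N.+1 h i)%:C)%C *: D h i)
    (fun i => ((q h i)%:C)%C *: D h i)) => i _; apply/cvg_rnormP.
  have E N : rnorm (((qN j0 m q N.+1 h i)%:C)%C *: D h i - ((q h i)%:C)%C *: D h i) =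
      `|qN j0 m q N.+1 h i - q h i| * rnorm (D h i).
    by rewrite -scalerBl -rmorphB rnormZr.
  under eq_fun => N do rewrite E.
  rewrite -(mul0r (rnorm (D h i))); apply: cvgM; last exact: cvg_cst.
  rewrite -(normr0 R) -(subrr (q h i)); apply: cvg_norm.
  by apply: cvgB; [exact: cq|exact: cvg_cst].
have cPhi (xN yN : nat -> X) (x y : X) : xN N @[N --> \oo] --> x -> yN N @[N --> \oo] --> y ->
     umd_gap p K2 (xN N) (yN N) @[N --> \oo] --> umd_gap p K2 x y.
  move=> hx hy; apply: cvgB.
    by apply: cvg_powR => // [N|]; [exact: rnorm_ge0|exact: cvg_rnorm].
  apply: cvgM; first exact: cvg_cst.
  by apply: cvg_powR => // [N|]; [exact: rnorm_ge0|exact: cvg_rnorm].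
have cst (x : X) : (fun=> x) N @[N --> \oo] --> x by exact: cvg_cst.
have lim := @cvg_tree R X J (fun N => qN j0 m q N.+1) (fun N => DN j0 m q D N.+1) q D th
  (umd_gap p K2) n cq cD cPhi [::] (fun=> c) (fun=> (-1) ^+ s *: c) c ((-1) ^+ s *: c)
  (cst _) (cst _).
by apply: (cvgr_to_le lim); apply: nearW.
Qed.

End TreeInequality.

(** * Reduction of martingales to trees *)

Section Indicator.
Context {R : realType} {X : completeNormedModType R[i]}.
Context {d : measure_display} {T : measurableType d} (P : probability T R).

Lemma simple_indic (A : set T) (s : T -> X) : measurable A ->
  simple_function measurable s -> simple_function measurable (fun t => (\1_A t : R[i]) *: s t).
Proof.
have sT := @sigma_algebra_measurable d T.
move=> mA /(simple_fun_factor sT)[J [c [v [-> mc]]]].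
pose o t : option J := if `[< A t >] then Some (c t) else None.
have -> : (fun t => (\1_A t : R[i]) *: (v \o c) t) = (fun z : option J => if z is Some j then v
  j else 0) \o o.
  apply/funext => t; rewrite /o /= indicE.
  case: asboolP => ht; first by rewrite mem_set // scale1r.
  by rewrite memNset // scale0r.
apply: simple_fin => // -[j|].
  have -> : o @^-1` [set Some j] = A `&` c @^-1` [set j].
    apply/seteqP; split=> t; rewrite /o /=; first by case: asboolP => // ht [].
    by case=> ht ->; rewrite asboolT.
  exact: measurableI.
have -> : o @^-1` [set None] = ~` A.
  apply/seteqP; split=> t; rewrite /o /=; first by case: asboolP.
  by move=> ht; rewrite asboolF.
exact: measurableC.
Qed.

Lemma strongly_measurable_indic (A : set T) (f : T -> X) : measurable A ->
  strongly_measurable measurable f -> strongly_measurable measurable (fun t => (\1_A t : R[i])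
    *: f t).
Proof.
move=> mA [s [ss sf]]; exists (fun k t => (\1_A t : R[i]) *: s k t); split=> [k|t].
  exact: simple_indic.
by apply: cvgZ; [exact: cvg_cst|exact: sf].
Qed.

Lemma rnorm_indic (A : set T) (x : X) t : rnorm ((\1_A t : R[i]) *: x) = \1_A t * rnorm x.
Proof.
rewrite rnormZ !indicE; congr (_ * _).
by case: (t \in A); rewrite ?normr1 ?normr0.
Qed.

Lemma integral_rnorm_indic (A : set T) (f : T -> X) : measurable A ->
  (\int[P]_t (rnorm ((\1_A t : R[i]) *: f t))%:E = \int[P]_(t in A) (rnorm (f t))%:E)%E.
Proof.
move=> mA; rewrite [RHS]integral_mkcond; apply: eq_integral => t _.
by rewrite rnorm_indic indicE /patch; case: ifP => _; rewrite ?mul1r ?mul0r.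
Qed.

(** [t <= 1 + t ^ p], and [P] has mass one. *)
Lemma integral_rnorm_lty (f : T -> X) p : 1 <= p -> strongly_measurable measurable f ->
  (\int[P]_t (rnorm (f t) `^ p)%:E < +oo -> \int[P]_t (rnorm (f t))%:E < +oo)%E.
Proof.
move=> p1 sf fp.
apply: (@le_lt_trans _ _ (\int[P]_t (1%:E + (rnorm (f t) `^ p)%:E))%E).
  apply: ge0_le_integral => //.
  - by move=> t _; rewrite lee_fin rnorm_ge0.
  - by apply/measurable_EFinP; exact: measurable_rnorm.
  - by apply: emeasurable_funD => //; exact: measurable_rnorm_powR.
  move=> t _; rewrite -EFinD lee_fin.
  have r0 := rnorm_ge0 (f t); have := powR_ge0 (rnorm (f t)) p.
  case: (lerP (rnorm (f t)) 1) => h h2; first by apply: le_trans h _; rewrite lerDl.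
  by apply: le_trans (le1r_powR (ltW h) p1) _; rewrite lerDr.
rewrite ge0_integralD //; last 2 first.
- by move=> t _; rewrite lee_fin powR_ge0.
- exact: measurable_rnorm_powR.
rewrite (_ : (fun=> 1%:E) = cst 1%:E) // integral_cst // mul1e.
by rewrite lte_add_pinfty // ltey_eq fin_num_measure.
Qed.

End Indicator.

(** * Simple adapted processes as trees *)

Section SimpleMartingale.
Context {R : realType} {X : completeNormedModType R[i]}.
Context {d : measure_display} {T : measurableType d} (P : probability T R).
Context {J : finType} (j0 : J) (v : J -> X).
Variables (F : nat -> set_system T) (n : nat) (c : nat -> T -> J).
Hypothesis hF : filtration F.
Hypothesis hc : forall k j, (k < n)%N -> F k (c k @^-1` [set j]).

Let path (k : nat) (t : T) : seq J := mkseq (c^~ t) k.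

Definition cylinder (h : seq J) : set T := [set t | path (size h) t = h].

Lemma cylinder0 : cylinder [::] = setT.
Proof. by apply/seteqP; split. Qed.

Lemma cylinderS h j : cylinder (rcons h j) = cylinder h `&` c (size h) @^-1` [set j].
Proof.
apply/seteqP; split=> t; rewrite /cylinder /= size_rcons /path mkseqS.
  by move=> /rcons_inj[].
by case=> -> ->.
Qed.

Lemma filtration_le k l : (k <= l)%N -> F k `<=` F l.
Proof.
move=> /subnK <-; elim: (l - k)%N => // i IH A FA; rewrite addSn.
by have [_ _] := hF (i + k)%N; apply; exact: IH.
Qed.

Lemma filtration_measurable k : F k `<=` measurable.
Proof. by have [_ ? _] := hF k. Qed.

(** A word of length [k + 1] involves only [c 0, ..., c k]. This shift by one is what makes the
    centring of the difference at time [k + 1] available on its cylinder. *)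
Lemma cylinder_filtration k : forall h j, size h = k -> (k < n)%N ->
  F k (cylinder (rcons h j)).
Proof.
elim: k => [|k IH] h j hk kn.
  by rewrite (size0nil hk) cylinderS cylinder0 setTI; exact: hc.
case/lastP: h hk => // h i; rewrite size_rcons => -[hk].
rewrite cylinderS size_rcons hk.
have [sF _ _] := hF k.+1.
have h1 : F k.+1 (cylinder (rcons h i)).
  by apply: (filtration_le (leqnSn k)); apply: IH => //; exact: ltnW.
have h2 : F k.+1 (c k.+1 @^-1` [set j]) by exact: hc.
move: h1 h2; rewrite -(sub_sigmaE sF); exact: measurableI.
Qed.

Lemma cylinder_measurable h : (size h <= n)%N -> measurable (cylinder h).
Proof.
case/lastP: h => [_|h j]; first by rewrite cylinder0; exact: measurableT.
rewrite size_rcons => hn.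
by apply: (@filtration_measurable (size h)); exact: cylinder_filtration.
Qed.

Definition weight (h : seq J) : R := fine (P (cylinder h)).

Lemma weight_ge0 h : 0 <= weight h.
Proof. by rewrite fine_ge0. Qed.

Lemma weightE h : (size h <= n)%N -> P (cylinder h) = (weight h)%:E.
Proof. by move=> hn; rewrite fineK // fin_num_measure //; exact: cylinder_measurable. Qed.

Lemma cylinder_split h : cylinder h = \big[setU/set0]_(j <- index_enum J) cylinder (rcons h j).
Proof.
rewrite -bigcup_seq; apply/seteqP; split=> t.
  by move=> ht; exists (c (size h) t); rewrite /= ?mem_index_enum // cylinderS.
by case=> j _; rewrite cylinderS => -[].
Qed.

Lemma trivIset_cylinder h D : trivIset D (fun j => cylinder (rcons h j)).
Proof. by move=> i j _ _ [t []]; rewrite !cylinderS => -[_ /= <-] [_ /= <-]. Qed.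

Lemma sum_weight h : (size h < n)%N -> \sum_j weight (rcons h j) = weight h.
Proof.
move=> hn; apply: EFin_inj.
have hj j : (size (rcons h j) <= n)%N by rewrite size_rcons.
rewrite -sumEFin -weightE ?(ltnW hn) // -[P (cylinder h)]mul1e -integral_cst; last first.
  by apply: cylinder_measurable; exact: ltnW.
rewrite [in RHS]cylinder_split ge0_integral_bigsetU //=.
- apply: eq_bigr => j _; rewrite integral_cst ?mul1e; first exact/esym/weightE.
  exact: cylinder_measurable (hj j).
- by move=> j; exact: cylinder_measurable (hj j).
- exact: index_enum_uniq.
- exact: trivIset_cylinder.
Qed.

(** Null histories and histories of length at least [n] receive a point mass, since the tree
    inequality asks for a probability vector at every [h]. *)
Definition cond_prob (h : seq J) (j : J) : R :=
  if (weight h == 0) || (n <= size h)%N then (j == j0)%:R else weight (rcons h j) / weight h.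

Definition cond_mean (h : seq J) : X := \sum_j ((cond_prob h j)%:C)%C *: v j.

Definition centred (h : seq J) (j : J) : X := v j - cond_mean h.

Lemma cond_prob_ge0 h j : 0 <= cond_prob h j.
Proof.
by rewrite /cond_prob; case: ifP => _; rewrite ?ler0n // divr_ge0 ?weight_ge0.
Qed.

Lemma sum_cond_prob h : \sum_j cond_prob h j = 1.
Proof.
rewrite /cond_prob; case: (boolP ((weight h == 0) || (n <= size h)%N)) => [_|].
  by rewrite (bigD1 j0) //= eqxx big1 ?addr0 // => j /negbTE ->.
rewrite negb_or -ltnNge => /andP[w0 hn].
by rewrite -mulr_suml sum_weight // divff.
Qed.

(** The default value on null histories is harmless, because their continuations are null too. *)
Lemma weight_cond_prob h j : (size h < n)%N -> weight h * cond_prob h j = weight (rcons h j).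
Proof.
move=> hn; rewrite /cond_prob leqNgt hn orbF; case: eqP => [w0|/eqP w0].
  rewrite w0 mul0r; apply/esym/eqP; have := sum_weight hn; rewrite w0 => /eqP.
  rewrite psumr_eq0; last by move=> i _; exact: weight_ge0.
  by move=> /allP/(_ j); rewrite mem_index_enum; apply.
by rewrite mulrC divfK.
Qed.

Lemma sum_centred h : \sum_j ((cond_prob h j)%:C)%C *: centred h j = 0.
Proof.
rewrite /centred; under eq_bigr do rewrite scalerBr.
by rewrite sumrB -scaler_suml -rmorph_sum sum_cond_prob scale1r subrr.
Qed.

Definition mart_incr (k : nat) (t : T) : X := centred (path k t) (c k t).

Lemma path_fiber_measurable k (h : k.-tuple J) : (k <= n)%N ->
  measurable ((fun t => [tuple of path k t]) @^-1` [set h]).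
Proof.
move=> kn; have -> : (fun t => [tuple of path k t]) @^-1` [set h] = cylinder h.
  apply/seteqP; split=> t /=; rewrite /cylinder /= size_tuple.
    by move=> <-.
  by move=> e; apply: val_inj.
by apply: cylinder_measurable; rewrite size_tuple.
Qed.

Lemma measurable_path (g : seq J -> R) k : (k <= n)%N ->
  measurable_fun setT (fun t => (g (path k t))%:E).
Proof.
move=> kn; apply/measurable_EFinP.
by apply: (measurable_fun_fin (c := fun t => [tuple of path k t])
  (fun h : k.-tuple J => g h)) => h; exact: path_fiber_measurable.
Qed.

Lemma path_take k t : (k <= n)%N -> path k t = take k (path n t).
Proof.
move=> kn; rewrite /path /mkseq -map_take take_iota.
by rewrite (minn_idPl kn).
Qed.

Lemma path_nth k t : (k < n)%N -> c k t = nth j0 (path n t) k.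
Proof. by move=> kn; rewrite nth_mkseq. Qed.

Lemma mart_incr_path k t : (k < n)%N ->
  mart_incr k t = centred (take k (path n t)) (nth j0 (path n t) k).
Proof. by move=> kn; rewrite /mart_incr -path_take ?(ltnW kn) // -path_nth. Qed.

(** The induction splits a cylinder according to the next letter, hence the arbitrary history
    [h]. *)
Lemma tree_integral (th : nat -> bool) (Phi : X -> X -> R) r h x y :
  (forall a b, 0 <= Phi a b) -> (size h + r <= n)%N ->
  ((weight h * tree cond_prob centred th Phi r h x y)%:E =
   \int[P]_(t in cylinder h) (Phi (x + \sum_(i < r) mart_incr (size h + i) t)
     (y + \sum_(i < r) (-1) ^+ th (size h + i)%N *: mart_incr (size h + i) t))%:E)%E.
Proof.
move=> Phi0; elim: r h x y => [|r IH] h x y hn /=.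
  under eq_integral => t _ do rewrite !big_ord0 !addr0.
  rewrite (_ : (fun t => _) = cst (Phi x y)%:E) // integral_cst; last first.
    by apply: cylinder_measurable; rewrite addn0 in hn.
  rewrite addn0 in hn; rewrite mulrC EFinM -weightE //.
have hn' : (size h < n)%N by apply: leq_trans hn; rewrite addnS ltnS leq_addr.
pose f t := (Phi (x + \sum_(i < r.+1) mart_incr (size h + i) t)
     (y + \sum_(i < r.+1) (-1) ^+ th (size h + i)%N *: mart_incr (size h + i) t))%:E.
have mf : measurable_fun setT f.
  pose g (l : seq J) := Phi
     (x + \sum_(i < r.+1) centred (take (size h + i) l) (nth j0 l (size h + i)))
     (y + \sum_(i < r.+1) (-1) ^+ th (size h + i)%N *:
        centred (take (size h + i) l) (nth j0 l (size h + i))).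
  rewrite (_ : f = fun t => (g (path n t))%:E); first exact: measurable_path.
  apply/funext => t; rewrite /f /g.
  have hi (i : 'I_r.+1) : (size h + i < n)%N.
    by apply: leq_trans hn; rewrite ltn_add2l.
  congr (Phi (_ + _) (_ + _))%:E; apply: eq_bigr => i _; by rewrite mart_incr_path.
rewrite -/f [in RHS]cylinder_split ge0_integral_bigsetU //=; last 5 first.
- move=> j; apply: cylinder_measurable; by rewrite size_rcons.
- exact: index_enum_uniq.
- exact: trivIset_cylinder.
- rewrite -cylinder_split; apply: measurable_funTS; exact: mf.
- by move=> t _; rewrite lee_fin.
rewrite mulr_sumr -sumEFin; apply: eq_bigr => j _.
rewrite mulrA weight_cond_prob // IH; last by rewrite size_rcons addSnnS.
apply: eq_integral => t; rewrite inE cylinderS => -[/= th1 th2].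
rewrite /f !big_ord_recl /= addn0.
have -> : mart_incr (size h) t = centred h j by rewrite /mart_incr th1 th2.
rewrite -(addrA x) -(addrA y).
by congr (Phi (_ + (_ + _)) (_ + (_ + _)))%:E; apply: eq_bigr => i _; rewrite size_rcons addSnnS.
Qed.

(** [umd_gap] takes both signs, whereas trees are identified with integrals for nonnegative
    functions. *)
Lemma tree_gap (p K : R) (th : nat -> bool) r h x y :
  tree cond_prob centred th (umd_gap p K) r h x y =
  tree cond_prob centred th (fun _ b => rnorm b `^ p) r h x y -
  K * tree cond_prob centred th (fun a _ => rnorm a `^ p) r h x y.
Proof.
elim: r h x y => [//|r IH] h x y /=.
by rewrite mulr_sumr -sumrB; apply: eq_bigr => j _; rewrite IH; ring.
Qed.

(** No correction at time [0], as the first difference need not be centred. *)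
Definition cond_corr (k : nat) (t : T) : X := if k is 0 then 0 else cond_mean (path k t).

(** Starting the tree at the mean of the first letter, with the first sign, restores what centring
    removed at time [0]. *)
Lemma sum_cond_corr (th : nat -> bool) t : (0 < n)%N ->
  (-1) ^+ th 0%N *: cond_mean [::] + \sum_(i < n) (-1) ^+ th i *: mart_incr i t =
  \sum_(k < n) (-1) ^+ th k *: (v (c k t) - cond_corr k t).
Proof.
case: n => // n' _; rewrite !big_ord_recl /= addrA -scalerDr; congr (_ + _).
by rewrite /mart_incr /centred /= addrC subrK subr0.
Qed.

Lemma simple_martingale_umd (p K : R) (th : nat -> bool) : (0 < n)%N ->
  tree cond_prob centred th (umd_gap p K) n [::] (cond_mean [::]) ((-1) ^+ th 0%N *: cond_mean
    [::]) <= 0 ->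
  (\int[P]_t (rnorm (\sum_(k < n) (-1) ^+ th k *: (v (c k t) - cond_corr k t)) `^ p)%:E <=
   K%:E * \int[P]_t (rnorm (\sum_(k < n) (v (c k t) - cond_corr k t)) `^ p)%:E)%E.
Proof.
move=> n0; rewrite tree_gap subr_le0 => h.
have w1 : weight [::] = 1 by rewrite /weight cylinder0 probability_setT.
have I1 : (\int[P]_t (rnorm (\sum_(k < n) (-1) ^+ th k *: (v (c k t) - cond_corr k t)) `^ p)%:E =
  (tree cond_prob centred th (fun _ b => rnorm b `^ p) n [::] (cond_mean [::])
     ((-1) ^+ th 0%N *: cond_mean [::]))%:E)%E.
  have := @tree_integral th (fun _ b => rnorm b `^ p) n [::] (cond_mean [::])
    ((-1) ^+ th 0%N *: cond_mean [::]) (fun _ b => powR_ge0 _ _) (leqnn n).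
  by rewrite w1 mul1r cylinder0 => ->; apply: eq_integral => t _; rewrite -sum_cond_corr.
have I2 : (\int[P]_t (rnorm (\sum_(k < n) (v (c k t) - cond_corr k t)) `^ p)%:E =
  (tree cond_prob centred th (fun a _ => rnorm a `^ p) n [::] (cond_mean [::])
     ((-1) ^+ th 0%N *: cond_mean [::]))%:E)%E.
  have := @tree_integral th (fun a _ => rnorm a `^ p) n [::] (cond_mean [::])
    ((-1) ^+ th 0%N *: cond_mean [::]) (fun a _ => powR_ge0 _ _) (leqnn n).
  rewrite w1 mul1r cylinder0 => ->; apply: eq_integral => t _; congr (rnorm _ `^ _)%:E.
  have := sum_cond_corr (fun=> false) t n0; rewrite /= expr0 scale1r => E.
  under eq_bigr => k _ do rewrite -[_ - _]scale1r.
  by rewrite -E; congr (_ + _); apply: eq_bigr => k _; rewrite scale1r.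
by rewrite I1 I2 -EFinM lee_fin.
Qed.

Lemma weight_cond_mean h : (size h < n)%N ->
  ((weight h)%:C)%C *: cond_mean h =
  simple_integral P (fun t => (\1_(cylinder h) t : R[i]) *: v (c (size h) t)).
Proof.
move=> hn; have hnS j : (size (rcons h j) <= n)%N by rewrite size_rcons.
pose o t : option J := if `[< cylinder h t >] then Some (c (size h) t) else None.
pose vo (z : option J) : X := if z is Some j then v j else 0.
have oS j : o @^-1` [set Some j] = cylinder (rcons h j).
  rewrite cylinderS; apply/seteqP; split=> t; rewrite /o /=.
    by case: asboolP => // ht [] <-.
  by case=> ht ->; rewrite asboolT.
have oN : o @^-1` [set None] = ~` cylinder h.
  apply/seteqP; split=> t; rewrite /o /=; first by case: asboolP.
  by move=> ht; rewrite asboolF.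
have mo z : measurable (o @^-1` [set z]).
  case: z => [j|]; first by rewrite oS; exact: cylinder_measurable.
  by rewrite oN; apply: measurableC; apply: cylinder_measurable; exact: ltnW.
have -> : (fun t => (\1_(cylinder h) t : R[i]) *: v (c (size h) t)) = vo \o o.
  apply/funext => t; rewrite /vo /o /= indicE.
  case: asboolP => ht; first by rewrite mem_set // scale1r.
  by rewrite memNset // scale0r.
rewrite (simple_integral_fin P vo mo) (bigD1 None) //= scaler0 add0r.
rewrite (reindex_omap Some id) /=; last by case.
rewrite [RHS](eq_bigl xpredT) => [|j]; last by rewrite /= eqxx.
rewrite /cond_mean scaler_sumr; apply: eq_bigr => j _.
by rewrite scalerA -rmorphM weight_cond_prob // oS.
Qed.


(** Jensen on one cylinder: as [f] has integral zero there, the mean of the approximant is, up to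
    sign, that of its difference with [f]. *)
Lemma cylinder_mean_le (p : R) (f : T -> X) h : 1 <= p -> (size h < n)%N ->
  strongly_measurable measurable f -> (\int[P]_t (rnorm (f t))%:E < +oo)%E ->
  bochner_integral P (fun t => (\1_(cylinder h) t : R[i]) *: f t) = 0 ->
  ((weight h * rnorm (cond_mean h) `^ p)%:E <=
   \int[P]_(t in cylinder h) (rnorm (f t - v (c (size h) t)) `^ p)%:E)%E.
Proof.
move=> p1 hn sf fi f0.
set A := cylinder h; set k := size h in hn *; set C := rnorm (cond_mean h).
have mA : measurable A by apply: cylinder_measurable; exact: ltnW.
have C0 : 0 <= C by exact: rnorm_ge0.
have w0 := weight_ge0 h.
have ss : simple_function measurable (fun t => v (c k t)).
  apply: (simple_fin (c := c k) v (@sigma_algebra_measurable d T)) => j.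
  by apply: (@filtration_measurable k); exact: hc.
have sfs : strongly_measurable measurable (fun t => f t - v (c k t)).
  by apply: strongly_measurableB => //; [exact: sigma_algebra_measurable|exact:
    simple_strongly_measurable].
set a := (\int[P]_(t in A) (rnorm (f t - v (c k t)))%:E)%E.
have hwC : ((weight h * C)%:E <= a)%E.
  have -> : weight h * C = rnorm (simple_integral P (fun t => (\1_A t : R[i]) *: v (c k t))).
    by rewrite -weight_cond_mean // rnormZr ger0_norm.
  apply: le_trans (bochner_integral0_simple (strongly_measurable_indic mA sf) _ f0 (simple_indic
    mA ss)) _.
    rewrite integral_rnorm_indic //; apply: le_lt_trans fi.
    apply: ge0_subset_integral => //.
    - by apply/measurable_EFinP; exact: measurable_rnorm.
    - by move=> t _; rewrite lee_fin rnorm_ge0.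
  rewrite /a -(integral_rnorm_indic P (fun t => f t - v (c k t)) mA).
  by rewrite le_eqVlt; apply/orP; left; apply/eqP; apply: eq_integral => t _; rewrite scalerBr.
have p0 : 0 <= p by lra.
set b := (\int[P]_(t in A) (rnorm (f t - v (c k t)) `^ p)%:E)%E.
(* The tangent inequality at [C], integrated over the cylinder; combined with [hwC], the terms in
   [p - 1] cancel. *)
have h1 : ((p * C `^ (p - 1))%:E * a <= b + ((p - 1) * C `^ p * weight h)%:E)%E.
  have E2 : (((p - 1) * C `^ p * weight h)%:E = \int[P]_(t in A) (cst ((p - 1) * C `^ p)%:E) t)%E.
    by rewrite integral_cst // EFinM -weightE //; exact: ltnW.
  have k0 : 0 <= p * C `^ (p - 1) by rewrite mulr_ge0 ?powR_ge0.
  have k1 : 0 <= (p - 1) * C `^ p by rewrite mulr_ge0 ?powR_ge0 ?subr_ge0.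
  have m1 : measurable_fun A (fun t => (rnorm (f t - v (c k t)))%:E).
    by apply: measurable_funTS; apply/measurable_EFinP; exact: measurable_rnorm.
  have m2 : measurable_fun A (fun t => (rnorm (f t - v (c k t)) `^ p)%:E).
    by apply: measurable_funTS; exact: measurable_rnorm_powR.
  rewrite E2 /a -ge0_integralZl_EFin //; last by move=> t _; rewrite lee_fin rnorm_ge0.
  rewrite /b -ge0_integralD //; last by move=> t _; rewrite lee_fin powR_ge0.
  apply: ge0_le_integral => //.
  - by move=> t _; rewrite mule_ge0 ?lee_fin ?rnorm_ge0.
  - exact: measurable_funeM.
  - exact: emeasurable_funD.
  move=> t _; rewrite -EFinM -EFinD lee_fin.
  have := powR_tangent p1 C0 (rnorm_ge0 (f t - v (c k t))).
  by rewrite mulrA; lra.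
have h2 : ((p * C `^ (p - 1))%:E * (weight h * C)%:E <= (p * C `^ (p - 1))%:E * a)%E.
  by apply: lee_wpmul2l => //; rewrite lee_fin mulr_ge0 ?powR_ge0.
have := le_trans h2 h1; rewrite -EFinM.
have -> : p * C `^ (p - 1) * (weight h * C) = weight h * C `^ p + (p - 1) * C `^ p * weight h.
  by rewrite -(powRSB1 p1 C0); ring.
by rewrite EFinD leeD2rE.
Qed.

Lemma integral_cond_corr_le (p : R) (f : T -> X) k : 1 <= p -> (k.+1 < n)%N ->
  strongly_measurable measurable f -> (\int[P]_t (rnorm (f t))%:E < +oo)%E ->
  (forall A, F k A -> bochner_integral P (fun t => (\1_A t : R[i]) *: f t) = 0) ->
  (\int[P]_t (rnorm (cond_corr k.+1 t) `^ p)%:E <=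
   \int[P]_t (rnorm (f t - v (c k.+1 t)) `^ p)%:E)%E.
Proof.
move=> p1 kn sf fi f0.
have mC (h : k.+1.-tuple J) := path_fiber_measurable h (ltnW kn).
have fibE (h : k.+1.-tuple J) : (fun t => [tuple of path k.+1 t]) @^-1` [set h] = cylinder h.
  apply/seteqP; split=> t /=; rewrite /cylinder /= size_tuple; first by move=> <-.
  by move=> e; apply: val_inj.
have ss : simple_function measurable (fun t => v (c k.+1 t)).
  apply: (simple_fin (c := c k.+1) v (@sigma_algebra_measurable d T)) => j.
  by apply: (@filtration_measurable k.+1); exact: hc.
rewrite (ge0_integral_fiber P mC); last 2 first.
- exact: (@measurable_path (fun h => rnorm (cond_mean h) `^ p) k.+1 (ltnW kn)).
- by move=> t; rewrite lee_fin powR_ge0.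
rewrite [leRHS](ge0_integral_fiber P mC); last 2 first.
- apply: measurable_rnorm_powR; apply: strongly_measurableB => //;
  first exact: sigma_algebra_measurable.
  exact: simple_strongly_measurable.
- by move=> t; rewrite lee_fin powR_ge0.
apply: lee_sum => h _; rewrite !fibE.
have sh : size h = k.+1 by rewrite size_tuple.
have hn : (size h < n)%N by rewrite sh.
have -> : (\int[P]_(t in cylinder h) (rnorm (cond_corr k.+1 t) `^ p)%:E =
    (weight h * rnorm (cond_mean h) `^ p)%:E)%E.
  transitivity (\int[P]_(t in cylinder h) (cst (rnorm (cond_mean h) `^ p)%:E) t)%E.
    by apply: eq_integral => t; rewrite inE /cylinder /= sh => ->.
  rewrite integral_cst; last exact: cylinder_measurable (ltnW hn).
  by rewrite mulrC EFinM -weightE // ltnW.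
have Fh : F k (cylinder h).
  case/lastP: (tval h) sh => // g j; rewrite size_rcons => -[gk].
  by apply: cylinder_filtration => //; exact: ltnW.
have := cylinder_mean_le p1 hn sf fi (f0 _ Fh); by rewrite sh.
Qed.

Lemma simple_cond_corr k : (k < n)%N -> simple_function measurable (cond_corr k).
Proof.
have sT := @sigma_algebra_measurable d T.
case: k => [|k] kn.
  apply: (simple_fin (c := fun=> tt) (fun=> 0)) => // j.
  rewrite (_ : _ @^-1` _ = setT); first exact: measurableT.
  by apply/seteqP; split=> // t _; case: j.
apply: (simple_fin (c := fun t => [tuple of path k.+1 t]) (fun h => cond_mean (tval h)) sT) => h.
exact: path_fiber_measurable (ltnW kn).
Qed.

End SimpleMartingale.

(** * Approximation of a general martingale *)

Section UMDAssembly.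
Context {R : realType} {X : completeNormedModType R[i]}.
Context {d : measure_display} {T : measurableType d} (P : probability T R).
Variable p : R.
Hypothesis p1 : 1 <= p.

Local Notation I f := (\int[P]_t (rnorm (f t) `^ p)%:E)%E.
Local Notation sm := (strongly_measurable measurable).

Let sT := @sigma_algebra_measurable d T.

Lemma integral_powR_sum (n : nat) (a : nat -> bool) (f : nat -> T -> X) :
  (forall k, (k < n)%N -> sm (f k)) ->
  (\int[P]_t (rnorm (\sum_(k < n) (-1) ^+ a k *: f k t) `^ p)%:E <=
   (n%:R `^ p)%:E * \sum_(k < n) I (f k))%E.
Proof.
move=> sf.
have m k : (k < n)%N -> measurable_fun setT (fun t => (rnorm (f k t) `^ p)%:E).
  by move=> kn; apply: measurable_rnorm_powR; exact: sf.
have E t : (\sum_(k < n) (rnorm (f k t) `^ p)%:E = (\sum_(k < n) rnorm (f k t) `^ p)%:E)%E.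
  by rewrite sumEFin.
rewrite -ge0_integral_sum //; last 2 first.
- by move=> k; exact: m.
- by move=> k t _; rewrite lee_fin powR_ge0.
rewrite -ge0_integralZl_EFin ?powR_ge0 //; last 2 first.
- by move=> t _; rewrite sume_ge0 // => k _; rewrite lee_fin powR_ge0.
- by apply: emeasurable_sum => k; exact: m.
apply: ge0_le_integral => //.
- by move=> t _; rewrite lee_fin powR_ge0.
- apply: measurable_rnorm_powR.
  apply: (@strongly_measurable_sum _ _ _ _ measurable 'I_n (index_enum _) xpredT
    (fun k => (-1) ^+ a k) (fun k => f k) sT) => k _; exact: sf.
- apply: measurable_funeM; apply: emeasurable_sum => k; exact: m.
move=> t _; rewrite E -EFinM lee_fin.
have := ler_powR_sum p1 (fun k : 'I_n => rnorm_ge0 (f k t)).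
rewrite card_ord; apply: le_trans.
have p0 : 0 <= p by apply: le_trans p1.
apply: ge0_ler_powR; rewrite ?nnegrE ?rnorm_ge0 ?sumr_ge0 //.
  by move=> k _; exact: rnorm_ge0.
apply: le_trans (ler_rnorm_sum _ _ _) _; apply: ler_sum => k _.
by rewrite rnorm_sign.
Qed.

Lemma integral_powRD (f g : T -> X) : sm f -> sm g ->
  (I f <= (2 `^ p)%:E * (I g + \int[P]_t (rnorm (f t - g t) `^ p)%:E))%E.
Proof.
move=> sf sg.
have sfg : sm (fun t => f t - g t) by exact: strongly_measurableB.
rewrite -ge0_integralD //; last 4 first.
- by move=> t _; rewrite lee_fin powR_ge0.
- exact: measurable_rnorm_powR.
- by move=> t _; rewrite lee_fin powR_ge0.
- exact: (measurable_rnorm_powR p sfg).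
have m := emeasurable_funD (measurable_rnorm_powR p sg) (measurable_rnorm_powR p sfg).
rewrite -ge0_integralZl_EFin ?powR_ge0 //; last first.
  by move=> t _; rewrite adde_ge0 // lee_fin powR_ge0.
apply: ge0_le_integral => //.
- by move=> t _; rewrite lee_fin powR_ge0.
- exact: measurable_rnorm_powR.
- exact: measurable_funeM m.
move=> t _; rewrite -EFinD -EFinM lee_fin.
apply: le_trans (ler_powRD p1 (rnorm_ge0 _) (rnorm_ge0 _)).
have p0 : 0 <= p by apply: le_trans p1.
apply: ge0_ler_powR; rewrite ?nnegrE ?addr_ge0 ?rnorm_ge0 //.
by rewrite -{1}(subrK (g t) (f t)) [leRHS]addrC; exact: ler_rnormD.
Qed.

Lemma bochner_integral_cst0 : bochner_integral P (fun _ : T => 0 : X) = 0.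
Proof.
have mc (j : unit) : measurable ((fun _ : T => tt) @^-1` [set j]).
  rewrite (_ : _ @^-1` _ = setT); first exact: measurableT.
  by apply/seteqP; split=> // t _; case: j.
have ss : simple_function measurable (fun _ : T => 0 : X).
  exact: (simple_fin (c := fun=> tt) (fun=> 0)).
rewrite bochner_integral_simple //.
rewrite (simple_integral_fin P (fun _ : unit => 0 : X) mc).
by rewrite big1 // => j _; rewrite scaler0.
Qed.

Variable K : R.
Hypothesis K0 : 0 <= K.
Hypothesis hK : forall (J : finType) (j0 : J) (q : seq J -> J -> R) (D : seq J -> J -> X)
    (th : nat -> bool) (s : bool) (c : X) (n : nat),
    (forall h j, 0 <= q h j) -> (forall h, \sum_j q h j = 1) ->
    (forall h, \sum_j ((q h j)%:C)%C *: D h j = 0) ->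
    tree q D th (umd_gap p K) n [::] c ((-1) ^+ s *: c) <= 0.

Variables (F : nat -> set_system T) (n : nat) (df : nat -> T -> X) (th : nat -> bool).
Hypothesis hF : filtration F.
Hypothesis hdf : mart_diff_seq P p F n df.

Let pn : p != 0. Proof. by rewrite gt_eqF // (lt_le_trans _ p1). Qed.

Let df_sm k : (k < n)%N -> sm (df k).
Proof. by move=> kn; have [/(_ k kn)[_ []]] := hdf. Qed.

Let df_lty k : (k < n)%N -> (I (df k) < +oo)%E.
Proof.
move=> kn; have [/(_ k kn)[_ [_ h]] _] := hdf.
by rewrite -bochner_normE // poweR_lty.
Qed.

Lemma umd_step (s : nat -> T -> X) (e : R) : (0 < n)%N ->
  (forall k, (k < n)%N -> simple_function (F k) (s k)) ->
  (forall k, (k < n)%N -> (\int[P]_t (rnorm (df k t - s k t) `^ p)%:E <= e%:E)%E) ->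
  (\int[P]_t (rnorm (\sum_(k < n) (-1) ^+ th k *: df k t) `^ p)%:E <=
   (2 `^ p * (2 `^ p * K))%:E * \int[P]_t (rnorm (\sum_(k < n) df k t) `^ p)%:E +
   ((2 `^ p * (2 `^ p * K) + 2 `^ p) * (n%:R `^ p * (n%:R * (2 `^ p * (e + e)))))%:E)%E.
Proof.
move=> n0 ss hs.
have [l [l0 hl]] := simple_common ss.
pose J : finType := seq_sub l; pose j0 : J := SeqSub l0.
pose v (j : J) : X := ssval j.
pose c k t : J := insubd j0 (s k t).
have vc k t : (k < n)%N -> v (c k t) = s k t.
  by move=> kn; rewrite /v /c -[ssval _]/(val (insubd j0 (s k t))) insubdK //; exact: hl.
have hc k j : (k < n)%N -> F k (c k @^-1` [set j]).
  move=> kn; rewrite (_ : c k @^-1` [set j] = s k @^-1` [set v j]).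
    by have [_] := ss k kn.
  apply/seteqP; split=> t /= h; first by rewrite -h vc.
  by apply: val_inj; rewrite -[LHS]/(v (c k t)) vc.
pose cc := cond_corr P j0 v n c.
have sc k : (k < n)%N -> sm (cc k).
  by move=> kn; apply: simple_strongly_measurable; exact: (simple_cond_corr P j0 v hF hc).
have sS k : (k < n)%N -> sm (s k).
  move=> kn; apply: simple_strongly_measurable; apply: simple_function_le (ss k kn).
  exact: filtration_measurable.
have key : (\int[P]_t (rnorm (\sum_(k < n) (-1) ^+ th k *: (s k t - cc k t)) `^ p)%:E <=
   K%:E * \int[P]_t (rnorm (\sum_(k < n) (s k t - cc k t)) `^ p)%:E)%E.
  have := simple_martingale_umd hF hc n0 (hK j0 th (th 0%N) (cond_mean P j0 v n c [::]) n
    (cond_prob_ge0 P j0 n c) (sum_cond_prob P j0 hF hc) (sum_centred P j0 v hF hc)).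
  under eq_integral => t _ do under eq_bigr => k _ do rewrite vc //.
  by under [X in (_ <= _ * X)%E -> _]eq_integral => t _ do under eq_bigr => k _ do rewrite vc //.
have ccle k : (k < n)%N -> (I (cc k) <= e%:E)%E.
  move=> kn; apply: le_trans (hs k kn).
  case: k kn => [|k] kn.
    apply: ge0_le_integral => //.
    - by move=> t _; rewrite lee_fin powR_ge0.
    - exact: measurable_rnorm_powR (sc _ kn).
    - apply: (measurable_rnorm_powR p (f := fun t => df 0 t - s 0 t)).
      by apply: strongly_measurableB => //; [exact: df_sm|exact: sS].
    by move=> t _; rewrite lee_fin /cc /= rnorm0 powR0 // powR_ge0.
  have := @integral_cond_corr_le R X d T P J j0 v F n c hF hc p (df k.+1) k p1 kn (df_sm kn)
    (integral_rnorm_lty p1 (df_sm kn) (df_lty kn)).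
  rewrite /cc => h; apply: le_trans (h _) _.
    move=> A FA; have [_ /(_ k kn)[_ _ /(_ A FA) <-]] := hdf.
    rewrite -[RHS]bochner_integral_cst0; congr (bochner_integral P _).
    by apply/funext => t; rewrite scaler0.
  by under eq_integral => t _ do rewrite vc //.
(* The approximation error and the correction each have [p]-th moment at most [e]; [eta] below
   collects [n] such errors. *)
pose a k t := df k t - (s k t - cc k t).
have sa k : (k < n)%N -> sm (a k).
  move=> kn; apply: strongly_measurableB => //; first exact: df_sm.
  by apply: strongly_measurableB => //; [exact: sS|exact: sc].
have ale k : (k < n)%N -> (I (a k) <= (2 `^ p * (e + e))%:E)%E.
  move=> kn; apply: le_trans (integral_powRD (sa k kn) (sc k kn)) _.
  rewrite EFinM lee_wpmul2l ?lee_fin ?powR_ge0 // EFinD addeC; apply: leeD; last exact: ccle.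
  apply: le_trans (hs k kn); rewrite le_eqVlt; apply/orP; left; apply/eqP.
  apply: eq_integral => t _; rewrite /a; congr (rnorm _ `^ _)%:E.
  by rewrite opprB addrA addrAC addrK.
set eta := n%:R `^ p * (n%:R * (2 `^ p * (e + e))).
have suma (b : nat -> bool) :
    (\int[P]_t (rnorm (\sum_(k < n) (-1) ^+ b k *: a k t) `^ p)%:E <= eta%:E)%E.
  apply: le_trans (integral_powR_sum b sa) _.
  rewrite /eta EFinM lee_wpmul2l ?lee_fin ?powR_ge0 //.
  apply: (@le_trans _ _ (\sum_(k < n) (2 `^ p * (e + e))%:E)%E).
    by apply: lee_sum => k _; exact: ale.
  by rewrite sumEFin sumr_const card_ord mulr_natl.
have ssum (f : nat -> T -> X) (b : nat -> bool) : (forall k, (k < n)%N -> sm (f k)) ->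
    sm (fun t => \sum_(k < n) (-1) ^+ b k *: f k t).
  by move=> sf; apply: (@strongly_measurable_sum _ _ _ _ measurable 'I_n (index_enum _) xpredT
    (fun k => (-1) ^+ b k) (fun k => f k) sT) => k _; exact: sf.
have ssc k : (k < n)%N -> sm (fun t => s k t - cc k t).
  by move=> kn; apply: strongly_measurableB => //; [exact: sS|exact: sc].
have noS (f : nat -> X) : \sum_(k < n) f k = \sum_(k < n) (-1) ^+ (fun=> false) k *: f k.
  by apply: eq_bigr => k _; rewrite expr0 scale1r.
set B := (\int[P]_t (rnorm (\sum_(k < n) df k t) `^ p)%:E)%E.
(* Finiteness of [B] turns the final comparison of constants into an identity of real numbers. *)
have Bfin : B \is a fin_num.
  rewrite ge0_fin_numE; last by apply: integral_ge0 => t _; rewrite lee_fin powR_ge0.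
  rewrite /B; under eq_integral => t _ do rewrite (noS (fun k => df k t)).
  apply: le_lt_trans (integral_powR_sum (fun=> false) df_sm) _.
  apply: lte_mul_pinfty; rewrite ?lee_fin ?powR_ge0 //.
  by apply: lte_sum_pinfty => k _; exact: df_lty.
have h1 : (\int[P]_t (rnorm (\sum_(k < n) (s k t - cc k t)) `^ p)%:E <= (2 `^ p)%:E * (B +
  eta%:E))%E.
  rewrite /B; under eq_integral => t _ do rewrite (noS (fun k => s k t - cc k t)).
  under [X in (_ <= _ * (X + _))%E]eq_integral => t _ do rewrite (noS (fun k => df k t)).
  apply: le_trans (integral_powRD (ssum _ (fun=> false) ssc) (ssum _ (fun=> false) df_sm)) _.
  rewrite lee_wpmul2l ?lee_fin ?powR_ge0 //; apply: leeD => //.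
  apply: le_trans (suma (fun=> false)); rewrite le_eqVlt; apply/orP; left; apply/eqP.
  apply: eq_integral => t _; congr (_ `^ _)%:E; rewrite -rnormN -sumrB -sumrN.
  by congr rnorm; apply: eq_bigr => k _; rewrite -scalerBr -scalerN opprB.
apply: le_trans (integral_powRD (ssum _ th df_sm) (ssum _ th ssc)) _.
have h2 : (\int[P]_t (rnorm (\sum_(k < n) (-1) ^+ th k *: df k t -
    \sum_(k < n) (-1) ^+ th k *: (s k t - cc k t)) `^ p)%:E <= eta%:E)%E.
  apply: le_trans (suma th); rewrite le_eqVlt; apply/orP; left; apply/eqP.
  apply: eq_integral => t _; congr (rnorm _ `^ _)%:E; rewrite -sumrB.
  by apply: eq_bigr => k _; rewrite -scalerBr.
apply: (@le_trans _ _ ((2 `^ p)%:E * (K%:E * ((2 `^ p)%:E * (B + eta%:E)) + eta%:E))%E).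
  rewrite lee_wpmul2l ?lee_fin ?powR_ge0 //; apply: leeD => //.
  by apply: le_trans key _; rewrite lee_wpmul2l ?lee_fin.
rewrite -(fineK Bfin) -?EFinD -?EFinM -?EFinD -?EFinM -?EFinD lee_fin le_eqVlt; apply/orP; left;
  apply/eqP.
by move: (eta) (fine B) (2 `^ p) => x y z; ring.
Qed.

Lemma umd_integral_le :
  (\int[P]_t (rnorm (\sum_(k < n) (-1) ^+ th k *: df k t) `^ p)%:E <=
   (2 `^ p * (2 `^ p * K))%:E * \int[P]_t (rnorm (\sum_(k < n) df k t) `^ p)%:E)%E.
Proof.
have [n0|n0] := posnP n.
  rewrite (_ : (\int[P]_t _)%E = 0%E).
    rewrite mule_ge0 ?lee_fin ?mulr_ge0 ?powR_ge0 //.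
    by apply: integral_ge0 => t _; rewrite lee_fin powR_ge0.
  rewrite -[RHS](integral0 P setT); apply: eq_integral => t _.
  by rewrite n0 big_ord0 rnorm0 powR0.
have /choice[s hs] : forall k, exists s : nat -> T -> X, (k < n)%N ->
    (forall N, simple_function (F k) (s N)) /\
    (\int[P]_t (rnorm (df k t - s N t) `^ p)%:E)%E @[N --> \oo] --> 0%E.
  move=> k; have [kn|kn] := ltnP k n; last by exists (fun _ _ => 0).
  have [sF Fm _] := hF k; have [/(_ k kn)[sk _] _] := hdf.
  have [s [ss cs]] := simple_approx sF Fm sk p1 (df_lty kn).
  by exists s.
(* The additive error of [umd_step] is [A] times its tolerance, so the tolerance [e / A] leaves
   exactly [e]. *)
set A := (2 `^ p * (2 `^ p * K) + 2 `^ p) * (n%:R `^ p * (n%:R * (2 `^ p * 2))).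
have A0 : 0 < A.
  rewrite mulr_gt0 ?ltr_wpDl ?mulr_ge0 ?mulr_gt0 ?powR_ge0 ?powR_gt0 ?ltr0n //.
apply/lee_addgt0Pr => e e0.
have eA : (0 < (e / A)%:E)%E by rewrite lte_fin divr_gt0.
have [N hN] : exists N, forall k, (k < n)%N -> (\int[P]_t (rnorm (df k t - s k N t) `^ p)%:E <=
  (e / A)%:E)%E.
  have : \forall N \near \oo, forall k : 'I_n, (\int[P]_t (rnorm (df k t - s k N t) `^ p)%:E <=
    (e / A)%:E)%E.
    apply: filter_forall => k; have [_ cs] := hs k (ltn_ord k).
    by have [M _ hM] := cs _ (open_ereal_lt' eA); exists M => // N /hM; exact: ltW.
  by case=> N _ hN; exists N => k kn; exact: hN N (leqnn N) (Ordinal kn).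
have := umd_step n0 (fun k kn => (hs k kn).1 N) hN.
move=> /le_trans; apply; apply: leeD => //; rewrite lee_fin.
rewrite le_eqVlt; apply/orP; left; apply/eqP.
rewrite (_ : _ * _ = A * (e / A)); first by rewrite mulrC divfK ?gt_eqF.
by rewrite /A; move: (e / _) => x; ring.
Qed.

End UMDAssembly.

Lemma LPR_UMD (R : realType) (p : R) (m : nat -> nat)
    (X : completeNormedModType R[i]) (mu : probability (vilenkin m) R) :
  1 < p -> (forall k : nat, (2 <= m k)%N) -> normalized_haar mu ->
  LPR_eq mu p X \/ LPR_eq_oplus mu p X -> UMD X.
Proof.
move=> p1 hm hmu h; have p1' := ltW p1.
have [K [K0 hK]] := tree_inequality hm hmu p1' h.
(* One exponent suffices for UMD, and [r = p] is the one at hand; the root undoes the [p]-th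
   powers. *)
exists p; split=> //; exists ((2 `^ p * (2 `^ p * K)) `^ p^-1).
move=> d T P F n df th hF hdf.
have := umd_integral_le p1' K0 hK th hF hdf.
have p0 : 0 < p by lra.
have pn : p != 0 by rewrite gt_eqF.
rewrite -!bochner_normE // => hI.
have c0 : 0 <= 2 `^ p * (2 `^ p * K) by rewrite !mulr_ge0 ?powR_ge0.
have itv0 (x : \bar R) : (0 <= x)%E -> x \in `[0%E, +oo%E] by move=> x0;
  rewrite in_itv /= x0 leey.
have pV : 0 <= p^-1 by rewrite invr_ge0 ltW.
have b0 : (0 <= (2 `^ p * (2 `^ p * K))%:E * bochner_norm P p (fun t => (\sum_(k < n) df k t)%R)
  `^ p)%E.
  by rewrite mule_ge0 ?lee_fin ?poweR_ge0.
have := gt0_ler_poweR pV (itv0 _ (poweR_ge0 _ _)) (itv0 _ b0) hI.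
rewrite -poweRrM mulfV // poweRe1; last exact: Lnorm_ge0.
rewrite poweRM ?poweR_ge0 // -poweRrM mulfV // poweRe1; last exact: Lnorm_ge0.
by rewrite poweR_EFin.
Qed.

Theorem theorem1p5 (R : realType) (p : R) (m : nat -> nat)
    (X : completeNormedModType R[i]) (mu : probability (vilenkin m) R)
    (hp : 2 <= p) (hm : forall k : nat, (2 <= m k)%N)
    (hmu : normalized_haar mu) :
  (LPR_eq mu p X -> UMD X /\ type2 X) /\
  (LPR_eq_oplus mu p X -> UMD X /\ type2 X).
Proof.
have p1 : 1 < p by apply: lt_le_trans hp; rewrite ltr1n.
have main : LPR_eq mu p X \/ LPR_eq_oplus mu p X -> UMD X /\ type2 X.
  by move=> h; split; [exact: LPR_UMD h|exact: LPR_type2 h].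
by split=> h; apply: main; [left|right].
Qed.
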